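(* Let $\mathbf{b}\in\mathbb{R}^d$ be constant, let $c:\Omega\to\mathbb{R}$ be bounded and nonnegative with $c_0=\inf_\Omega c$, let $f$ be bounded on $\Omega$ and $g$ continuous on $\partial\Omega$, and let $\epsilon,\sigma,\gamma\ge0$ and $p\in[0,1]$ be constants. Suppose $\epsilon>0$ or $c_0>0$. For each mesh $\mathbf{h}$ let $U$ be the solution of the finite difference scheme $$\widehat{L}^\epsilon_{\mathbf{h}}[U_\alpha]=f(\mathbf{x}_\alpha)\ \text{ if }\mathbf{x}_\alpha\in\mathcal{T}_{\mathbf{h}}\cap\Omega,\qquad U_\alpha=g(\mathbf{x}_\alpha)\ \text{ if }\mathbf{x}_\alpha\in\mathcal{T}_{\mathbf{h}}\cap\partial\Omega,$$ $$-\delta^2_{x_i,h_i}U_\alpha=0\ \text{ if }\mathbf{x}_\alpha\in\mathcal{S}_{h_i},\ i=1,\dots,d.$$ Then $$\Big(\prod_{i=1}^d h_i^{1/2}\Big)\|U\|_{\ell^2(\mathcal{T}_{\mathbf{h}}\cap\Omega)}\le C$$ for some constant $C$, independent of $\mathbf{h}$, that depends on $\Omega$, $f$ and $g$ (and on the fixed problem and scheme parameters $\epsilon,\mathbf{b},c,\sigma,\gamma,p$).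
   Context: Domain and mesh: $\Omega=(a_1,b_1)\times\cdots\times(a_d,b_d)\subset\mathbb{R}^d$. For integers $J_i\ge 3$ set $h_i=(b_i-a_i)/(J_i-1)$, $\mathbf{h}=(h_1,\dots,h_d)$. The grid is $\mathcal{T}_{\mathbf{h}}=\{\mathbf{x}_\alpha\}$ with $\mathbf{x}_\alpha=(a_1+(\alpha_1-1)h_1,\dots,a_d+(\alpha_d-1)h_d)$, $1\le\alpha_i\le J_i$. Let $\mathbf{e}_i$ be the canonical basis vectors. Boundary nodes and ghost points: $\mathcal{S}_{h_i}$ is the set of $\mathbf{x}_\alpha\in\mathcal{T}_{\mathbf{h}}\cap\partial\Omega$ such that $\mathbf{x}_\alpha+h_i\mathbf{e}_i\in\mathcal{T}_{\mathbf{h}}\cap\Omega$ or $\mathbf{x}_\alpha-h_i\mathbf{e}_i\in\mathcal{T}_{\mathbf{h}}\cap\Omega$. For each $\mathbf{x}_\alpha\in\mathcal{S}_{h_i}$ the one of $\mathbf{x}_\alpha\pm h_i\mathbf{e}_i$ lying outside $\overline{\Omega}$ is a ghost point; grid functions $U$ are defined on $\mathcal{T}_{\mathbf{h}}$ together with the ghost points. Difference operators: $\delta_{x_i,h_i}U_\alpha=\frac{U_{\alpha+\mathbf{e}_i}-U_{\alpha-\mathbf{e}_i}}{2h_i}$, $\nabla_{\mathbf{h}}=[\delta_{x_1,h_1},\dots,\delta_{x_d,h_d}]^T$, $\delta^2_{x_i,h_i}U_\alpha=\frac{U_{\alpha+\mathbf{e}_i}-2U_\alpha+U_{\alpha-\mathbf{e}_i}}{h_i^2}$,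 $\delta^2_{x_i,2h_i}U_\alpha=\frac{U_{\alpha+2\mathbf{e}_i}-2U_\alpha+U_{\alpha-2\mathbf{e}_i}}{4h_i^2}$, $\Delta_{\mathbf{h}}=\sum_{i=1}^d\delta^2_{x_i,h_i}$. Numerical moment: $M^p_{\mathbf{h}}U_\alpha=\sum_{i=1}^d h_i^p(\delta^2_{x_i,2h_i}-\delta^2_{x_i,h_i})U_\alpha$. Numerical operator, for $\mathbf{x}_\alpha\in\mathcal{T}_{\mathbf{h}}\cap\Omega$: $$\widehat{L}^\epsilon_{\mathbf{h}}[U_\alpha]=-\sigma\sum_{i=1}^d h_i^2\delta^2_{x_i,h_i}U_\alpha-\epsilon\Delta_{\mathbf{h}}U_\alpha+\mathbf{b}\cdot\nabla_{\mathbf{h}}U_\alpha+c(\mathbf{x}_\alpha)U_\alpha+\gamma M^p_{\mathbf{h}}U_\alpha .$$ Norm: $\|U\|_{\ell^2(\mathcal{T}_{\mathbf{h}}\cap\Omega)}=\big(\sum_{\mathbf{x}_\alpha\in\mathcal{T}_{\mathbf{h}}\cap\Omega}|U_\alpha|^2\big)^{1/2}$. Under the stated hypotheses the scheme has a unique solution. *)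

(* Defs.v *)
From mathcomp Require Export all_boot all_order all_algebra.
From mathcomp Require Export all_classical all_reals all_analysis.
Export Order.TTheory GRing.Theory Num.Theory.
Export numFieldNormedType.Exports.

Set Implicit Arguments.
Unset Strict Implicit.
Unset Printing Implicit Defensive.

Local Open Scope classical_set_scope.
Local Open Scope ring_scope.

Section Domain.
Context {R : realType} {d : nat}.
Implicit Types (a b x : 'rV[R]_d).

Definition open_box a b : set 'rV[R]_d :=
  [set x | forall i : 'I_d, a 0 i < x 0 i < b 0 i].

Definition boundary (A : set 'rV[R]_d) : set 'rV[R]_d :=
  closure A `\` interior A.

End Domain.

Section Mesh.
Context {R : realType} {d : nat}.
Variables (a b : 'rV[R]_d) (J : 'I_d -> nat).
Implicit Types (i : 'I_d) (alpha : 'rV[int]_d).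

Definition mesh_size i : R := (b 0 i - a 0 i) / ((J i)%:R - 1).

(* Indices are 1-based. They range over all of Z^d, so that ghost points are
   also addressed. *)
Definition node alpha : 'rV[R]_d :=
  \row_i (a 0 i + (alpha 0 i - 1)%:~R * mesh_size i).

Definition grid : set 'rV[int]_d :=
  [set alpha | forall i, (1 <= alpha 0 i) && (alpha 0 i <= (J i)%:Z)].

Definition interior_nodes : set 'rV[int]_d :=
  [set alpha | grid alpha /\ open_box a b (node alpha)].

Definition boundary_nodes : set 'rV[int]_d :=
  [set alpha | grid alpha /\ boundary (open_box a b) (node alpha)].

Definition unit_index i : 'rV[int]_d := delta_mx 0 i.

Definition ghosted_nodes i : set 'rV[int]_d :=
  [set alpha | boundary_nodes alpha /\
     (interior_nodes (alpha + unit_index i) \/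
      interior_nodes (alpha - unit_index i))].

End Mesh.

Section Operators.
Context {R : realType} {d : nat}.
(* A grid function is a total function on Z^d, of which only the values on the
   grid and at the ghost points enter the scheme. *)
Variables (h : 'I_d -> R) (U : 'rV[int]_d -> R).
Implicit Types (i : 'I_d) (alpha : 'rV[int]_d).

Definition central_diff i alpha : R :=
  (U (alpha + unit_index i) - U (alpha - unit_index i)) / (2 * h i).

Definition discrete_grad alpha : 'rV[R]_d := \row_i central_diff i alpha.

Definition second_diff i alpha : R :=
  (U (alpha + unit_index i) - 2 * U alpha + U (alpha - unit_index i))
  / h i ^+ 2.

Definition wide_second_diff i alpha : R :=
  (U (alpha + unit_index i *+ 2) - 2 * U alpha + U (alpha - unit_index i *+ 2))
  / (4 * h i ^+ 2).

Definition discrete_laplacian alpha : R := \sum_i second_diff i alpha.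

Definition numerical_moment (p : R) alpha : R :=
  \sum_i (h i `^ p) * (wide_second_diff i alpha - second_diff i alpha).

End Operators.

Section Scheme.
Context {R : realType} {d : nat}.
Variables (a b : 'rV[R]_d) (beta : 'rV[R]_d) (c f g : 'rV[R]_d -> R).
Variables (eps sigma gamma p : R) (J : 'I_d -> nat).
Implicit Types U : 'rV[int]_d -> R.

Let h := mesh_size a b J.

Definition numerical_operator U (alpha : 'rV[int]_d) : R :=
  - sigma * (\sum_i h i ^+ 2 * second_diff h U i alpha)
  - eps * discrete_laplacian h U alpha
  + (\sum_i beta 0 i * discrete_grad h U alpha 0 i)
  + c (node a b J alpha) * U alpha
  + gamma * numerical_moment h U p alpha.

Definition scheme_solution U : Prop :=
  [/\ forall alpha, interior_nodes a b J alpha ->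
        numerical_operator U alpha = f (node a b J alpha),
      forall alpha, boundary_nodes a b J alpha ->
        U alpha = g (node a b J alpha)
    & forall i alpha, ghosted_nodes a b J i alpha ->
        - second_diff h U i alpha = 0].

(* The index set is finite (finite_interior_nodes below), so that this
   finitely supported sum is the plain sum over all interior nodes. *)
Definition ell2_norm U : R :=
  Num.sqrt (\sum_(alpha \in interior_nodes a b J) `|U alpha| ^+ 2).

End Scheme.

Lemma finite_interior_nodes (R : realType) (d : nat) (a b : 'rV[R]_d)
  (J : 'I_d -> nat) : finite_set (interior_nodes a b J).
Proof.
pose N := (\max_i J i)%N.
pose idx (k : {ffun 'I_d -> 'I_N.+1}) : 'rV[int]_d := \row_i (nat_of_ord (k i))%:Z.
apply: (@sub_finite_set _ _ (range idx)); last first.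
  exact/finite_image/finite_finset.
move=> alpha [galpha _]; exists [ffun i : 'I_d => inord (absz (alpha 0 i))] => //.
apply/rowP => i; rewrite mxE ffunE inordK.
  by have /andP[a1 _] := galpha i; rewrite gez0_abs// (le_trans _ a1).
have /andP[a1 aJ] := galpha i; rewrite ltnS (leq_trans _ (leq_bigmax i))//.
by rewrite -lez_nat gez0_abs// (le_trans _ a1).
Qed.

(* Main.v *)
(* Duality. Identify opposite faces of the box, so that the grid becomes a
   torus prod_i Z/(J_i - 1) with one wall per direction, and let V solve the
   adjoint scheme with right-hand side u = U on the interior nodes and V = 0 on
   the walls. Summation by parts gives
     |u|^2 = (f, V) + (terms pairing g with the fluxes of V at the faces),
   so it suffices to bound, uniformly in the mesh, |V| by C |u| and the squared
   flux on each face by C |u|^2 / h_i.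
   - eps > 0: the operators H_i = - rho_i lap_i + nu_i lap_i^2 satisfy
     (H_i V, H_j V) >= 0, so every |H_i V| is O(|u|), and a trace inequality
     applies.
   - eps = 0 and gamma = 0: testing with r V(. + e_i) + r(. - e_i) V(. - e_i), where
     r decreases linearly away from the wall, controls V at the faces.
   - eps = 0 and gamma > 0: testing with V times an exponential weight resolves
     the numerical boundary layer, and testing with lap_i^2 V then controls the
     third-order part of the flux. *)

From HB Require Import structures.
Require Import Defs.
From mathcomp Require Import ring lra.

Set Implicit Arguments.
Unset Strict Implicit.
Unset Printing Implicit Defensive.

Local Open Scope classical_set_scope.
Local Open Scope ring_scope.

(** As g is merely continuous, it need not have a lifting whose second differences are bounded
    uniformly in the mesh, so subtracting the boundary data and using the energy of U is not an
    option; duality uses only the size of g. The admissible growth of the fluxes comes from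
    counting. Direction i has #T / len wall nodes, so a squared flux C |u|^2 / h_i on a face, paired
    with bounded data, costs sqrt (C #T / L_i) |u|, and sqrt #T is what the weight prod h_i^(1/2)
    compensates. The layer width comes from balancing nu_i lap_i^2 against be_i cen_i: decay by a
    factor 1 + tau per cell requires nu_i tau^4 ~ tau / h_i, so nu_i h_i tau^3 is kept constant.
    When eps = gamma = 0, a weight times V is blind at the wall: (r V, cen V) contains only products
    of neighbouring values of V, and at the wall one of them is zero. Shifting V by one cell turns
    these products into squares. *)

Lemma le_of_sqr_le (R : realDomainType) (x y : R) :
  0 <= y -> x ^+ 2 <= y ^+ 2 -> x <= y.
Proof. by move=> y0 xy; rewrite leNgt; apply/negP => yx; nra. Qed.

Lemma sqr_le_sqr (R : realDomainType) (x y : R) :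
  0 <= x -> x <= y -> x ^+ 2 <= y ^+ 2.
Proof. by move=> x0 xy; nra. Qed.

(** If the conclusion failed, x would exceed N, so A N^2 would be at most A N x and a factor x could
    be cancelled. The constant is cruder than the root of the quadratic but stays polynomial in A
    and B. *)
Lemma quadratic_bound (R : realDomainType) (A B N x : R) :
  0 <= A -> 0 <= B -> 0 <= N -> 0 <= x ->
  x ^+ 2 <= A * N ^+ 2 + B * N * x -> x <= (1 + A + B) * N.
Proof.
move=> A0 B0 N0 x0 h; rewrite leNgt; apply/negP => hx.
have Nx : N <= x by nra.
have AN : A * N ^+ 2 <= A * N * x by rewrite expr2 mulrA ler_wpM2l// mulr_ge0.
have : x * x <= ((A + B) * N) * x by move: h; rewrite expr2; lra.
by rewrite ler_pM2r//; nra.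
Qed.

(** * Euclidean geometry of functions on a finite set *)

Section Euclidean.
Context {R : rcfType} {T : finType}.
Implicit Types (f g k : T -> R) (x : R).

Definition dot f g : R := \sum_t f t * g t.
Definition nrm f : R := Num.sqrt (dot f f).

Lemma eq_dot f f' g g' : f =1 f' -> g =1 g' -> dot f g = dot f' g'.
Proof. by move=> ff gg; apply: eq_bigr => t _; rewrite ff gg. Qed.

Lemma dotC f g : dot f g = dot g f.
Proof. by apply: eq_bigr => t _; rewrite mulrC. Qed.

Lemma dotDr f g k : dot f (fun t => g t + k t) = dot f g + dot f k.
Proof. by rewrite -big_split; apply: eq_bigr => t _; rewrite mulrDr. Qed.

Lemma dotZr f g x : dot f (fun t => x * g t) = x * dot f g.
Proof. by rewrite big_distrr; apply: eq_bigr => t _; rewrite /= mulrCA. Qed.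

Lemma dotDl f g k : dot (fun t => g t + k t) f = dot g f + dot k f.
Proof. by rewrite dotC dotDr !(dotC f). Qed.

Lemma dotZl f g x : dot (fun t => x * g t) f = x * dot g f.
Proof. by rewrite dotC dotZr dotC. Qed.

Lemma dot_sumr (I : finType) f (g : I -> T -> R) :
  dot f (fun t => \sum_i g i t) = \sum_i dot f (g i).
Proof.
by rewrite exchange_big; apply: eq_bigr => t _; rewrite big_distrr.
Qed.

Lemma dot_ge0 f : 0 <= dot f f.
Proof. by apply: sumr_ge0 => t _; rewrite -expr2 sqr_ge0. Qed.

Lemma nrm_ge0 f : 0 <= nrm f.
Proof. exact: sqrtr_ge0. Qed.

Lemma nrm_sq f : nrm f ^+ 2 = dot f f.
Proof. by rewrite sqr_sqrtr// dot_ge0. Qed.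

Lemma nrm_sqE f : nrm f ^+ 2 = \sum_t f t ^+ 2.
Proof. by rewrite nrm_sq; apply: eq_bigr => t _; rewrite expr2. Qed.

Lemma nrm_le f x : 0 <= x -> \sum_t f t ^+ 2 <= x ^+ 2 -> nrm f <= x.
Proof. by move=> x0; rewrite -nrm_sqE; exact: le_of_sqr_le. Qed.

Lemma dot_nrm0 f g : nrm f = 0 -> dot f g = 0.
Proof.
move=> f0; have/eqP : nrm f ^+ 2 = 0 by rewrite f0 expr0n.
rewrite nrm_sqE psumr_eq0 => [/allP f00|t _]; last exact: sqr_ge0.
rewrite /dot big1// => t _; have := f00 t.
by rewrite mem_index_enum sqrf_eq0 => /(_ isT)/eqP ->; rewrite mul0r.
Qed.

(** Cauchy-Schwarz, from the nonnegative square of |g| f - |f| g. *)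
Lemma dot_le f g : dot f g <= nrm f * nrm g.
Proof.
have [f0|f0] := eqVneq (nrm f) 0; first by rewrite (dot_nrm0 _ f0) f0 mul0r.
have [g0|g0] := eqVneq (nrm g) 0.
  by rewrite dotC (dot_nrm0 _ g0) g0 mulr0.
have := dot_ge0 (fun t => nrm g * f t + - nrm f * g t).
rewrite dotDr !dotDl !dotZr !dotZl -!nrm_sq (dotC g).
have : 0 < nrm g by rewrite lt_def g0 nrm_ge0.
have : 0 < nrm f by rewrite lt_def f0 nrm_ge0.
move: (nrm f) (nrm g) (dot f g) => a b z a0 b0 h.
have : 0 <= (a * b) * (a * b - z) by nra.
by rewrite pmulr_rge0 ?mulr_gt0// subr_ge0.
Qed.

Lemma norm_dot_le f g : `|dot f g| <= nrm f * nrm g.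
Proof.
rewrite ler_norml dot_le andbT lerNl.
have -> : - dot f g = dot (fun t => -1 * f t) g by rewrite dotZl mulN1r.
apply: le_trans (dot_le _ _) _.
rewrite ler_wpM2r ?nrm_ge0//; apply: nrm_le; first exact: nrm_ge0.
by rewrite nrm_sqE ler_sum// => t _; rewrite mulN1r sqrrN.
Qed.

Lemma nrmM x f : nrm (fun t => x * f t) = `|x| * nrm f.
Proof.
by rewrite /nrm dotZl dotZr mulrA -expr2 sqrtrM ?sqr_ge0// sqrtr_sqr.
Qed.

Lemma nrmD f g : nrm (fun t => f t + g t) <= nrm f + nrm g.
Proof.
apply: le_of_sqr_le; first by rewrite addr_ge0 ?nrm_ge0.
rewrite nrm_sq dotDr !dotDl -!nrm_sq (dotC g).
by have := dot_le f g; nra.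
Qed.

Lemma nrm_mono f g : (forall t, `|f t| <= `|g t|) -> nrm f <= nrm g.
Proof.
move=> fg; apply: nrm_le; first exact: nrm_ge0.
rewrite nrm_sqE; apply: ler_sum => t _.
by rewrite -(real_normK (num_real (f t))) -(real_normK (num_real (g t)))
  ler_sqr ?nnegrE.
Qed.

Lemma nrm_eq f g : f =1 g -> nrm f = nrm g.
Proof. by move=> fg; rewrite /nrm (eq_dot fg fg). Qed.

Lemma nrm_sum (I : Type) (r : seq I) (g : I -> T -> R) :
  nrm (fun t => \sum_(i <- r) g i t) <= \sum_(i <- r) nrm (g i).
Proof.
elim: r => [|i r IH].
  rewrite big_nil; apply: nrm_le => //; rewrite expr0n /= big1// => t _.
  by rewrite big_nil expr0n.
rewrite big_cons (nrm_eq (g := fun t => g i t + \sum_(j <- r) g j t)); last first.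
  by move=> t; rewrite big_cons.
by apply: le_trans (nrmD _ _) _; rewrite lerD2l.
Qed.

Lemma nrm_bounded x f g : 0 <= x -> (forall t, `|f t| <= x * `|g t|) ->
  nrm f <= x * nrm g.
Proof.
move=> x0 fg; rewrite -[x](ger0_norm x0) -nrmM; apply: nrm_mono => t.
by rewrite normrM (ger0_norm x0).
Qed.

End Euclidean.

(* A cyclic direction of the discrete torus: [pos] is the coordinate modulo
   [len], and the hyperplane [pos = 0] carries both opposite faces of the box. *)
Record direction (T : finType) := Direction {
  fwd : T -> T;
  bwd : T -> T;
  pos : T -> nat;
  len : nat;
  fwdK : cancel fwd bwd;
  bwdK : cancel bwd fwd;
  len_gt1 : (1 < len)%N;
  pos_lt : forall t, (pos t < len)%N;
  pos_fwd : forall t, pos (fwd t) = ((pos t).+1 %% len)%N }.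

(** * Difference calculus along one cyclic direction *)

Section Direction.
Context {R : rcfType} {T : finType}.
Variable D : direction T.
Implicit Types (f g w : T -> R).

Local Notation s := (fwd D).
Local Notation s' := (bwd D).
Local Notation n := (len D).

Definition wall t := pos D t == 0.
Definition vanish f := forall t, wall t -> f t = 0.
Definition dif f t := f (s t) - f t.
Definition cen f t := f (s t) - f (s' t).
(** The truncation at the wall makes every value of [lap] vanish there again, so [lap] can be
    iterated and stays symmetric on functions vanishing on the wall. *)
Definition lap f t := if wall t then 0 else f (s t) - 2 * f t + f (s' t).
(** For f zero on the wall this is the squared normal difference at the wall. Since [fwd] leaves the
    wall on one side, only one of the two faces is seen; the other belongs to the reversed
    direction. *)
Definition face f : R := \sum_(t | wall t) f (s t) ^+ 2.

Lemma len_gt0 : 0 < n%:R :> R.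
Proof. by rewrite ltr0n (ltn_trans _ (len_gt1 D)). Qed.

Lemma step_le (x y : R) : 0 < x -> x * n%:R = y -> x <= y.
Proof. by move=> x0 <-; rewrite ler_peMr ?(ltW x0)// ler1n ltnW// len_gt1. Qed.

Lemma pos_fwd_wall t : wall (s t) -> (pos D t).+1 = n.
Proof.
rewrite /wall pos_fwd; have := pos_lt D t; rewrite leq_eqVlt.
by case/predU1P => // h; rewrite modn_small.
Qed.

Lemma pos_fwdS t : ~~ wall (s t) -> pos D (s t) = (pos D t).+1.
Proof.
rewrite /wall pos_fwd; have := pos_lt D t; rewrite leq_eqVlt.
by case/predU1P => [->|h]; rewrite ?modnn// modn_small.
Qed.

Lemma wall_fwd t : wall t -> ~~ wall (s t).
Proof.
move=> wt; apply/negP => /pos_fwd_wall; rewrite (eqP wt) => n1.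
by have := len_gt1 D; rewrite -n1.
Qed.

Lemma wall_bwd t : wall t -> ~~ wall (s' t).
Proof. by move=> wt; apply/negP => /wall_fwd; rewrite bwdK wt. Qed.

Lemma sum_fwd f : \sum_t f (s t) = \sum_t f t.
Proof. by rewrite [RHS](reindex s)//=; exists s' => t _; rewrite ?fwdK ?bwdK. Qed.

(** The cycle has no ends, so a total difference sums to zero. Summation by parts thus reduces to a
    pointwise check once the potential [G] is exhibited. *)
Lemma sum_telescope f g (G : T -> R) :
  (forall t, f t - g t = G (s t) - G t) -> \sum_t f t = \sum_t g t.
Proof.
move=> fg; apply/eqP; rewrite -subr_eq0 -sumrB (eq_bigr _ (fun t _ => fg t)).
by rewrite sumrB sum_fwd subrr.
Qed.

Lemma sum_telescope0 f (G : T -> R) :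
  (forall t, f t = G (s t) - G t) -> \sum_t f t = 0.
Proof.
by move=> fG; rewrite (eq_bigr _ (fun t _ => fG t)) sumrB sum_fwd subrr.
Qed.

Lemma vanish_lap f : vanish (lap f).
Proof. by move=> t wt; rewrite /lap wt. Qed.

Lemma lap_lin (x y : R) f g t :
  lap (fun t => x * f t - y * g t) t = x * lap f t - y * lap g t.
Proof. by rewrite /lap; case: ifP => _; ring. Qed.

(** It is enough that f vanishes: at a wall node the truncation discards terms that f would have
    multiplied by zero. *)
Lemma dot_lap f g : vanish f -> dot f (lap g) = - dot (dif f) (dif g).
Proof.
move=> vf; rewrite /dot -sumrN.
apply: (sum_telescope (G := fun t => f t * (g t - g (s' t)))) => t.
rewrite fwdK /lap /dif; case: ifPn => [wt|_]; last by ring.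
by rewrite (vf t wt); ring.
Qed.

Lemma dot_lapC f g : vanish f -> vanish g -> dot f (lap g) = dot (lap f) g.
Proof. by move=> vf vg; rewrite dot_lap// [RHS]dotC dot_lap// dotC. Qed.

Lemma dot_cen f g : dot f (cen g) = - dot (cen f) g.
Proof.
rewrite /dot -sumrN.
apply: (sum_telescope (G := fun t => f t * g (s' t) + f (s' t) * g t)) => t.
by rewrite fwdK /cen; ring.
Qed.

Lemma dot_cen_self f : dot f (cen f) = 0.
Proof. by have := dot_cen f f; rewrite (dotC (cen f)); lra. Qed.

Lemma nrm_dif_sq f : vanish f -> nrm (dif f) ^+ 2 = - dot f (lap f).
Proof. by move=> vf; rewrite nrm_sq dot_lap// opprK. Qed.

Lemma nrm_dif_interp f : vanish f -> nrm (dif f) ^+ 2 <= nrm f * nrm (lap f).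
Proof.
by move=> vf; rewrite nrm_dif_sq// (le_trans (ler_norm _))// normrN norm_dot_le.
Qed.

Lemma sum_sqr_fwd f : \sum_t f (s t) ^+ 2 = nrm f ^+ 2.
Proof. by rewrite (sum_fwd (fun t => f t ^+ 2)) nrm_sqE. Qed.

Lemma sum_sqr_bwd f : \sum_t f (s' t) ^+ 2 = nrm f ^+ 2.
Proof.
rewrite nrm_sqE -(sum_fwd (fun t => f (s' t) ^+ 2)).
by apply: eq_bigr => t _; rewrite fwdK.
Qed.

Lemma nrm_fwd f : nrm (f \o s) = nrm f.
Proof. by rewrite /nrm; congr Num.sqrt; rewrite -nrm_sq nrm_sqE sum_sqr_fwd nrm_sq. Qed.

Lemma nrm_bwd f : nrm (f \o s') = nrm f.
Proof. by rewrite /nrm; congr Num.sqrt; rewrite -nrm_sq nrm_sqE sum_sqr_bwd nrm_sq. Qed.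

Lemma nrm_dif_le f : nrm (dif f) <= 2 * nrm f.
Proof.
apply: le_trans (nrmD (f \o s) (fun t => - f t)) _.
rewrite nrm_fwd (nrm_eq (f := fun t => - f t) (g := fun t => -1 * f t)).
  by rewrite nrmM normrN1 mul1r; lra.
by move=> t; rewrite mulN1r.
Qed.

Lemma nrm_cen_le f : nrm (cen f) <= 2 * nrm (dif f).
Proof.
have -> : nrm (cen f) = nrm (fun t => dif f t + (dif f \o s') t).
  by apply: nrm_eq => t; rewrite /cen /dif /= bwdK; ring.
by apply: le_trans (nrmD _ _) _; rewrite nrm_bwd; lra.
Qed.

Lemma nrm_lap_le f : nrm (lap f) <= 4 * nrm f.
Proof.
apply: (@le_trans _ _ (nrm (fun t => dif f t + -1 * (dif f \o s') t))).
  apply: nrm_mono => t; rewrite /lap /dif /= bwdK; case: ifP => _.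
    by rewrite normr0 normr_ge0.
  by rewrite le_eqVlt; apply/orP; left; apply/eqP; congr `|_|; ring.
apply: le_trans (nrmD _ _) _; rewrite nrmM normrN1 mul1r nrm_bwd.
by have := nrm_dif_le f; lra.
Qed.

(** The multiplier is the coordinate: the increment of pos f^2 releases one f^2 per cell, and the
    jump of pos at the wall is multiplied by f = 0. *)
Lemma poincare f : vanish f -> nrm f <= 2 * n%:R * nrm (dif f).
Proof.
move=> vf.
have e : \sum_t ((pos D t)%:R * dif f t * (f (s t) + f t) + f (s t) ^+ 2) =
    \sum_(t : T) 0.
  apply: (sum_telescope (G := fun t => (pos D t)%:R * f t ^+ 2)) => t.
  have [wst|wst] := boolP (wall (s t)).
    by rewrite /dif (vf _ wst); ring.
  by rewrite /dif pos_fwdS// -natr1; ring.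
rewrite big_split /= sum_sqr_fwd [RHS]big1// in e.
have : nrm f ^+ 2 <= n%:R * nrm (dif f) * (2 * nrm f).
  have -> : nrm f ^+ 2 = - dot (fun t => (pos D t)%:R * dif f t)
                               (fun t => f (s t) + f t).
    by rewrite /dot; lra.
  rewrite (le_trans (ler_norm _))// normrN (le_trans (norm_dot_le _ _))//.
  apply: ler_pM; rewrite ?nrm_ge0//.
    apply: nrm_bounded; first exact: ltW len_gt0.
    by move=> t; rewrite normrM ler_wpM2r// ger0_norm// ler_nat ltnW// pos_lt.
  by apply: le_trans (nrmD (f \o s) _) _; rewrite nrm_fwd; lra.
move: (nrm_ge0 f); rewrite le_eqVlt => /predU1P[<- _|f0].
  by rewrite !mulr_ge0 ?nrm_ge0// ler0n.
by rewrite expr2 [leRHS]mulrA ler_pM2r// => /le_trans; apply; lra.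
Qed.

Lemma nrm_dif_lap f : vanish f -> nrm (dif f) <= 2 * n%:R * nrm (lap f).
Proof.
move=> vf; have h1 := nrm_dif_interp vf; have h2 := poincare vf.
have : nrm (dif f) ^+ 2 <= 2 * n%:R * nrm (dif f) * nrm (lap f).
  by apply: le_trans h1 _; rewrite ler_wpM2r ?nrm_ge0.
move: (nrm_ge0 (dif f)); rewrite le_eqVlt => /predU1P[<- _|f0].
  by rewrite !mulr_ge0 ?nrm_ge0// ler0n.
by rewrite expr2 -mulrA (mulrC (nrm _) (nrm (lap _))) !mulrA ler_pM2r.
Qed.

Lemma lap_cen f t : ~~ wall t ->
  lap f t * cen f t = dif f t ^+ 2 - dif f (s' t) ^+ 2.
Proof. by move=> /negbTE wt; rewrite /lap wt /cen /dif bwdK; ring. Qed.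

Lemma face_dif f : vanish f -> face f = \sum_(t | wall t) dif f t ^+ 2.
Proof. by move=> vf; apply: eq_bigr => t wt; rewrite /dif (vf t wt) subr0. Qed.

(** A Rellich-type identity: off the wall, [lap f] and [cen f] are the difference and the sum of two
    consecutive values of [dif f], so their product is a difference of squares. *)
Lemma dot_lap_cen_weighted f w : vanish f -> vanish w ->
  dot (fun t => w t * lap f t) (cen f) =
  \sum_t (w t - w (s t)) * dif f t ^+ 2.
Proof.
move=> vf vw.
apply: (sum_telescope (G := fun t => w t * dif f (s' t) ^+ 2)) => t.
rewrite fwdK -mulrA; have [wt|wt] := boolP (wall t); last by rewrite lap_cen//; ring.
by rewrite (vw t wt); ring.
Qed.

(** The weight drops by 1 across each cell, except for its jump at the wall, where the increment is
    1 - n. The weighted identity therefore reads |dif f|^2 - n face f, and dividing by n leaves a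
    constant independent of the mesh. *)
Lemma face_le f : vanish f -> face f <= 4 * nrm (dif f) * nrm (lap f).
Proof.
move=> vf; pose w t : R := if wall t then 0 else n%:R - (pos D t)%:R.
have vw : vanish w by move=> t wt; rewrite /w wt.
have dw t : w t - w (s t) = 1 - n%:R * (wall t)%:R.
  rewrite /w; have [wt|wt] := boolP (wall t).
    by rewrite (negbTE (wall_fwd wt)) (pos_fwdS (wall_fwd wt)) (eqP wt) /=; ring.
  have [wst|wst] := boolP (wall (s t)).
    by rewrite -(pos_fwd_wall wst) -natr1 /=; ring.
  by rewrite (pos_fwdS wst) -natr1 /=; ring.
have := dot_lap_cen_weighted vf vw.
rewrite (eq_bigr (fun t => dif f t ^+ 2 - n%:R * ((wall t)%:R * dif f t ^+ 2))); last first.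
  by move=> t _; rewrite dw; ring.
rewrite sumrB -nrm_sqE -big_distrr /=.
rewrite (eq_bigr (fun t => if wall t then dif f t ^+ 2 else 0)); last first.
  by move=> t _; case: ifP => _; rewrite ?mul1r ?mul0r.
rewrite -big_mkcond /= -face_dif// => e.
have : `|dot (fun t => w t * lap f t) (cen f)| <=
    n%:R * nrm (lap f) * (2 * nrm (dif f)).
  rewrite (le_trans (norm_dot_le _ _))//; apply: ler_pM; rewrite ?nrm_ge0//.
    apply: nrm_bounded; first exact: ltW len_gt0.
    move=> t; rewrite normrM ler_wpM2r// /w; case: ifP => _; rewrite ?normr0 ?ler0n//.
    have pn : (pos D t)%:R <= n%:R :> R by rewrite ler_nat; exact/ltnW/pos_lt.
    by rewrite ger0_norm ?subr_ge0// gerBl.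
  exact: nrm_cen_le.
rewrite e ler_norml => /andP[h _].
have h2 := nrm_dif_lap vf.
have h3 : nrm (dif f) ^+ 2 <= 2 * n%:R * nrm (lap f) * nrm (dif f).
  by rewrite expr2 ler_wpM2r ?nrm_ge0.
rewrite -(ler_pM2l len_gt0); lra.
Qed.

Lemma face_le_nrm f : face f <= nrm f ^+ 2.
Proof.
rewrite -sum_sqr_fwd [leRHS](bigID wall) /= lerDl.
by apply: sumr_ge0 => t _; exact: sqr_ge0.
Qed.

Lemma face_ge0 f : 0 <= face f.
Proof. by apply: sumr_ge0 => t _; exact: sqr_ge0. Qed.

Lemma faceM (x : R) f : face (fun t => x * f t) = x ^+ 2 * face f.
Proof. by rewrite big_distrr; apply: eq_bigr => t _; rewrite exprMn. Qed.

Lemma faceD f g : face (fun t => f t + g t) <= 2 * face f + 2 * face g.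
Proof.
rewrite !big_distrr -big_split /=; apply: ler_sum => t _.
by have := sqr_ge0 (f (s t) - g (s t)); nra.
Qed.

End Direction.

(** * The reversed direction, and transport tested with the fourth difference *)

Section Reversal.
Context {R : rcfType} {T : finType}.
Variable D : direction T.
Implicit Types (f V : T -> R).

Definition rev_pos t := if pos D t == 0 then 0%N else (len D - pos D t)%N.

Lemma rev_pos_lt t : (rev_pos t < len D)%N.
Proof.
rewrite /rev_pos; have := pos_lt D t; case: eqP => [_|/eqP]; first exact: leq_trans.
by rewrite -lt0n => p0 pn; rewrite ltn_subrL p0 (ltn_trans p0).
Qed.

Lemma rev_pos_fwd t : rev_pos (bwd D t) = ((rev_pos t).+1 %% len D)%N.
Proof.
rewrite -[in RHS](bwdK D t); move: (bwd D t) => {}t.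
have n1 := len_gt1 D; have pt := pos_lt D t; rewrite /rev_pos.
have [wt|wt] := boolP (wall D (fwd D t)).
  have pn := pos_fwd_wall wt; rewrite /wall in wt; rewrite wt modn_small//.
  case: eqP => [p0|_]; last by rewrite -pn subSnn.
  by move: n1; rewrite -pn p0.
rewrite (pos_fwdS wt) /= subnSK//; case: eqP => [->|/eqP p0].
  by rewrite subn0 modnn.
by rewrite modn_small// ltn_subrL lt0n p0 (ltn_trans _ n1).
Qed.

(** Makes the second face of the wall the first face of a direction, so that each face estimate is
    proved once. *)
Definition rev : direction T :=
  Direction (bwdK D) (fwdK D) (len_gt1 D) rev_pos_lt rev_pos_fwd.

Lemma wall_rev t : wall rev t = wall D t.
Proof.
rewrite /wall /= /rev_pos; case: ifP => // _.
by rewrite subn_eq0 leqNgt pos_lt.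
Qed.

Lemma lap_rev f : lap rev f =1 lap D f.
Proof. by move=> t; rewrite /lap wall_rev /=; case: ifP => // _; ring. Qed.

Lemma cen_rev f t : cen rev f t = -1 * cen D f t.
Proof. by rewrite /cen /=; ring. Qed.

Lemma face_rev f : face rev f = \sum_(t | wall D t) f (bwd D t) ^+ 2.
Proof. by apply: eq_bigl => t; rewrite wall_rev. Qed.

(* Since the truncated Laplacian and the central difference commute up to the
   walls, only a boundary term remains. *)
Lemma dot_lap2_cen V : vanish D V ->
  dot (lap D (lap D V)) (cen D V) =
  2 * \sum_(t | wall D t) lap D V (bwd D t) * V (bwd D t)
  - 2 * \sum_(t | wall D t) lap D V (fwd D t) * V (fwd D t).
Proof.
move=> vV; set X := lap D V.
have vX : vanish D X by exact: vanish_lap.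
(* [bd] collects the boundary terms at both faces; what is left of the summand is
   [- X t * cen D X t] up to a telescoping term, and it sums to zero by antisymmetry. *)
pose bd t : R := if wall D t then 2 * (X (bwd D t) * V (bwd D t)) -
   2 * (X (fwd D t) * V (fwd D t)) else 0.
have -> : dot (lap D X) (cen D V) = \sum_t (bd t - X t * cen D X t).
  apply: (sum_telescope (D := D) (G := fun t =>
    2 * (X t - X (bwd D t)) * (V t - V (bwd D t)))) => t.
  rewrite fwdK /bd {1}/lap /cen; case: ifPn => wt.
    by rewrite (vX t wt) (vV t wt); ring.
  have : X t = V (fwd D t) - 2 * V t + V (bwd D t) by rewrite /X /lap (negbTE wt).
  move: (X t) (X _) (X _) => x x1 x2 ->; ring.
rewrite sumrB [X in _ - X](_ : _ = dot X (cen D X))// dot_cen_self subr0.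
by rewrite -big_mkcond sumrB -!big_distrr.
Qed.

Lemma norm_dot_lap2_cen V : vanish D V ->
  `|dot (lap D (lap D V)) (cen D V)| <=
  2 * (Num.sqrt (face rev (lap D V)) * Num.sqrt (face rev V))
  + 2 * (Num.sqrt (face D (lap D V)) * Num.sqrt (face D V)).
Proof.
move=> vV.
have cs (g k : T -> R) : `|\sum_(t | wall D t) g t * k t| <=
    Num.sqrt (\sum_(t | wall D t) g t ^+ 2) *
    Num.sqrt (\sum_(t | wall D t) k t ^+ 2).
  have e (a b : T -> R) : \sum_(t | wall D t) a t * b t =
      dot (fun t => (wall D t)%:R * a t) (fun t => (wall D t)%:R * b t).
    rewrite big_mkcond; apply: eq_bigr => t _.
    by case: (wall D t); rewrite ?mul1r ?mul0r.
  have e2 (a : T -> R) : \sum_(t | wall D t) a t ^+ 2 = \sum_(t | wall D t) a t * a t.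
    by apply: eq_bigr => t _; rewrite expr2.
  by rewrite !e2 !e; exact: norm_dot_le.
rewrite dot_lap2_cen// (le_trans (ler_normB _ _))// !normrM !normr_nat.
rewrite !face_rev; apply: lerD; rewrite ler_pM2l//; exact: cs.
Qed.

End Reversal.

(** * A test operator for pure transport *)

Section Hop.
Context {R : rcfType} {T : finType}.
Variable D : direction T.
Implicit Types (V : T -> R).
Local Notation n := (len D).

(** Zero on the wall and also at the last node before it, so that no term of [hop] crosses the
    wall. *)
Definition ramp t : R := if wall D t then 0 else n%:R - 1 - (pos D t)%:R.

(* A symmetric operator whose commutator with [cen] concentrates on a face. *)
Definition hop V t := ramp t * V (fwd D t) + ramp (bwd D t) * V (bwd D t).

Lemma ramp_bwd_wall t : wall D t -> ramp (bwd D t) = 0.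
Proof.
move=> wt; rewrite /ramp (negbTE (wall_bwd wt)).
have := @pos_fwd_wall _ D (bwd D t); rewrite bwdK => /(_ wt) <-.
by rewrite -natr1; ring.
Qed.

Lemma vanish_hop V : vanish D (hop V).
Proof.
by move=> t wt; rewrite /hop ramp_bwd_wall// /ramp wt !mul0r addr0.
Qed.

Lemma ramp_norm t : `|ramp t| <= n%:R.
Proof.
rewrite /ramp; case: ifPn => [_|wt]; first by rewrite normr0 ler0n.
have : (pos D t)%:R + 1 <= n%:R :> R by rewrite natr1 ler_nat pos_lt.
have : 0 <= (pos D t)%:R :> R by [].
by move=> p0 pn; rewrite ger0_norm; lra.
Qed.

Lemma nrm_hop V : nrm (hop V) <= 2 * n%:R * nrm V.
Proof.
apply: le_trans (nrmD _ _) _.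
have h1 : nrm (fun t => ramp t * V (fwd D t)) <= n%:R * nrm (V \o fwd D).
  by apply: nrm_bounded => // t; rewrite normrM ler_wpM2r// ramp_norm.
have h2 : nrm (fun t => ramp (bwd D t) * V (bwd D t)) <= n%:R * nrm (V \o bwd D).
  by apply: nrm_bounded => // t; rewrite normrM ler_wpM2r// ramp_norm.
by rewrite nrm_fwd nrm_bwd in h1 h2 *; lra.
Qed.

(** Pairing with [cen] replaces the ramp by its increments: 1 in general, and 1 - (n - 1) at the
    first node off the wall. There one neighbour lies on the wall, so of V^2 + V(fwd) V(bwd) only
    the square survives, with a factor n - 1. *)
Lemma face_hop V : vanish D V ->
  (n%:R - 1) * face D V <= 2 * nrm V ^+ 2 + `|dot (hop V) (cen D V)|.
Proof.
move=> vV.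
have e : dot (hop V) (cen D V) =
    \sum_t (ramp (bwd D t) - ramp t) * (V t ^+ 2 + V (fwd D t) * V (bwd D t)).
  apply: (sum_telescope (D := D) (G := fun t =>
    ramp (bwd D t) * (V t ^+ 2 + V (bwd D t) ^+ 2))) => t.
  by rewrite fwdK /hop /cen; ring.
have dr t : ~~ wall D t ->
    ramp (bwd D t) - ramp t = 1 - (n%:R - 1) * (wall D (bwd D t))%:R.
  rewrite /ramp => wt; rewrite (negbTE wt); have [wb|wb] := boolP (wall D (bwd D t)).
    have := @pos_fwdS _ D (bwd D t); rewrite bwdK => /(_ wt) ->.
    by rewrite (eqP wb) /=; ring.
  have := @pos_fwdS _ D (bwd D t); rewrite bwdK => /(_ wt) ->.
  by rewrite -natr1 /=; ring.
have e2 : dot (hop V) (cen D V) =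
    \sum_t (if wall D t then 0 else V t ^+ 2 + V (fwd D t) * V (bwd D t))
    - (n%:R - 1) * face D V.
  rewrite e.
  have -> : face D V = \sum_t (wall D (bwd D t))%:R * V t ^+ 2.
    rewrite -(sum_fwd D (fun t => (wall D (bwd D t))%:R * _)) /face big_mkcond.
    by apply: eq_bigr => t _; rewrite fwdK; case: ifP => _; rewrite ?mul1r ?mul0r.
  rewrite big_distrr -sumrB; apply: eq_bigr => t _ /=.
  case: ifPn => wt.
    by rewrite ramp_bwd_wall// /ramp wt (vV t wt) expr0n /=; ring.
  rewrite dr//; have [wb|_] := boolP (wall D (bwd D t)); last by rewrite /=; ring.
  by rewrite (vV _ wb) /=; ring.
have h : \sum_t (if wall D t then 0 else V t ^+ 2 + V (fwd D t) * V (bwd D t)) <=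
    2 * nrm V ^+ 2.
  apply: (@le_trans _ _ (\sum_t (V t ^+ 2 + 2^-1 * V (fwd D t) ^+ 2 +
      2^-1 * V (bwd D t) ^+ 2))).
    apply: ler_sum => t _.
    have := sqr_ge0 (V t); have := sqr_ge0 (V (fwd D t)).
    have := sqr_ge0 (V (bwd D t)); have := sqr_ge0 (V (fwd D t) - V (bwd D t)).
    by case: ifP => _; nra.
  rewrite !big_split -!big_distrr /= sum_sqr_fwd sum_sqr_bwd -nrm_sqE.
  lra.
by have := ler_norm (- dot (hop V) (cen D V)); rewrite normrN e2; lra.
Qed.

End Hop.

(** * Estimates with an exponential weight *)

Section ExponentialWeight.
Context {R : rcfType} {T : finType}.
Variable D : direction T.
Variables (tau th : R).
Hypotheses (tau_gt0 : 0 < tau) (tau_le : tau <= 2^-1) (thE : th * (1 + tau) = 1).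
Implicit Types (V : T -> R).
Local Notation n := (len D).

(** The forward factor [th] and the backward factor [1 + tau] are both kept and tied by [thE], so
    that the identities below remain polynomial. *)
Definition expw t : R := th ^+ pos D t.

Lemma th_gt0 : 0 < th.
Proof.
have t1 : 0 < 1 + tau by rewrite addr_gt0.
by rewrite -(pmulr_lgt0 _ t1) thE.
Qed.

Lemma th_lt1 : th < 1.
Proof.
have := mulr_gt0 th_gt0 tau_gt0; have := thE; rewrite mulrDr mulr1; lra.
Qed.

Lemma expw_gt0 t : 0 < expw t.
Proof. by rewrite exprn_gt0// th_gt0. Qed.

Lemma expw_le1 t : expw t <= 1.
Proof. by rewrite exprn_ile1 ?ltW ?th_gt0 ?th_lt1. Qed.

Lemma expw_fwd t : ~~ wall D (fwd D t) -> expw (fwd D t) = th * expw t.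
Proof. by move=> /pos_fwdS e; rewrite /expw e exprS. Qed.

Lemma expw_bwd t : ~~ wall D t -> expw (bwd D t) = (1 + tau) * expw t.
Proof.
move=> wt; have := @expw_fwd (bwd D t); rewrite bwdK => /(_ wt) ->.
by rewrite mulrA (mulrC (1 + tau)) thE mul1r.
Qed.

Definition wnrm f : R := nrm (fun t => Num.sqrt (expw t) * f t).

Lemma wnrm_ge0 f : 0 <= wnrm f. Proof. exact: nrm_ge0. Qed.

Lemma wnrm_sq f : wnrm f ^+ 2 = \sum_t expw t * f t ^+ 2.
Proof.
rewrite /wnrm nrm_sqE; apply: eq_bigr => t _.
by rewrite exprMn sqr_sqrtr// ltW// expw_gt0.
Qed.

(** Half of the weight stays on f and the half on g is dropped. This suits g = [lap D V], for which
    the energy gives an unweighted bound. *)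
Lemma wdot_le f g : `|\sum_t expw t * (f t * g t)| <= wnrm f * nrm g.
Proof.
have -> : \sum_t expw t * (f t * g t) =
    dot (fun t => Num.sqrt (expw t) * f t) (fun t => Num.sqrt (expw t) * g t).
  apply: eq_bigr => t _; rewrite -{1}[expw t]sqr_sqrtr ?expr2; first by ring.
  exact/ltW/expw_gt0.
apply: le_trans (norm_dot_le _ _) _; rewrite ler_wpM2l ?nrm_ge0//.
apply: nrm_mono => t; rewrite normrM ger0_norm ?sqrtr_ge0// ler_piMl//.
by rewrite -[leRHS](sqrtr1 R) ler_wsqrtr// expw_le1.
Qed.

(** Polarization: moving the weight along with the shifted V costs exactly the factor 1 + tau, and
    the jump of the weight at the wall meets V = 0. *)
Lemma wdot_fwd V : vanish D V ->
  2 * (\sum_t expw t * (V t * V (fwd D t))) =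
  (2 + tau) * wnrm V ^+ 2 - wnrm (dif D V) ^+ 2.
Proof.
move=> vV; rewrite !wnrm_sq.
have e : \sum_t expw t * V (fwd D t) ^+ 2 = \sum_t (1 + tau) * (expw t * V t ^+ 2).
  rewrite -(sum_fwd D (fun t => (1 + tau) * _)); apply: eq_bigr => t _.
  have [wt|wt] := boolP (wall D (fwd D t)); first by rewrite (vV _ wt); ring.
  by rewrite (expw_fwd wt) !mulrA (mulrC _ th) thE mul1r.
move: e; rewrite -big_distrr /= => e.
have -> : \sum_t expw t * dif D V t ^+ 2 = \sum_t expw t * V (fwd D t) ^+ 2 +
   \sum_t expw t * V t ^+ 2 - 2 * \sum_t expw t * (V t * V (fwd D t)).
  rewrite big_distrr -big_split -sumrB; apply: eq_bigr => t _ /=.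
  by rewrite /dif; ring.
by rewrite e; ring.
Qed.

(** Weighted form of [nrm_dif_interp]. Commuting a difference with the weight leaves terms of first
    order in tau, but [wdot_fwd] combines them into tau (1 - th), which is at most tau^2. *)
Lemma wnrm_dif V : vanish D V -> wnrm (dif D V) ^+ 2 <=
  2 * (wnrm V * nrm (lap D V)) + tau ^+ 2 * wnrm V ^+ 2.
Proof.
move=> vV.
have e : wnrm (dif D V) ^+ 2 = - (\sum_t expw t * (V t * lap D V t)) +
    tau * (wnrm V ^+ 2 - \sum_t th * (expw t * (V t * V (fwd D t)))).
  rewrite !wnrm_sq -sumrN -sumrB big_distrr -big_split.
  apply: (sum_telescope (D := D) (G := fun t => if wall D t then 0 else
    (1 + tau) * expw t * V t * dif D V (bwd D t)
    + tau * expw t * V t * V (bwd D t))) => t.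
  rewrite /dif fwdK bwdK /lap.
  have thK x : (1 + tau) * (th * x) = x by rewrite mulrA (mulrC _ th) thE mul1r.
  have [wt|wt] := boolP (wall D t).
    rewrite (vV t wt) (negbTE (wall_fwd wt)) (expw_fwd (wall_fwd wt)) thK /=.
    by ring.
  have [wst|wst] := boolP (wall D (fwd D t)).
    by rewrite (vV _ wst) /=; ring.
  rewrite (expw_fwd wst) thK /=.
  set VS := V (fwd D t); set VB := V (bwd D t); set x := expw t.
  by ring.
have h1 := wdot_le V (lap D V); have h2 := wdot_fwd vV.
rewrite -big_distrr /= in e.
set z := \sum_t expw t * (V t * V (fwd D t)) in e h2.
move: h1; rewrite ler_norml => /andP[h1 _].
have thE' : th * tau = 1 - th by rewrite -thE; ring.
have := th_gt0; have := th_lt1 => t1 t0.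
have e3 : wnrm (dif D V) ^+ 2 * (1 + th) = - 2 * (\sum_t expw t * (V t * lap D V t))
   + tau * (1 - th) * wnrm V ^+ 2.
  move: e h2 thE'; move: (\sum_t _) (wnrm V ^+ 2) (wnrm (dif D V) ^+ 2) => a b c.
  move=> /eqP; rewrite -subr_eq0 => /eqP e1 /eqP; rewrite -subr_eq0 => /eqP e2.
  move=> /eqP; rewrite -subr_eq0 => /eqP e3; apply/eqP; rewrite -subr_eq0; apply/eqP.
  (* A linear combination of the three identities in which z cancels. *)
  rewrite [LHS](_ : _ = 2 * (c - (- a + tau * (b - th * z))) -
    tau * th * (2 * z - ((2 + tau) * b - c)) +
    (c - tau * b) * (th * tau - (1 - th))); last by ring.
  by rewrite e1 e2 e3; ring.
have th2 : (1 - th) <= tau by rewrite -thE'; nra.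
have q0 := sqr_ge0 (wnrm V); have y0 := sqr_ge0 (wnrm (dif D V)).
have : tau * (1 - th) * wnrm V ^+ 2 <= tau ^+ 2 * wnrm V ^+ 2.
  by rewrite ler_wpM2r// expr2 ler_wpM2l// ltW.
have := mulr_ge0 y0 (ltW t0); lra.
Qed.

Lemma sum_wcen_sq V : vanish D V ->
  \sum_t (if wall D t then 0 else expw t * cen D V t ^+ 2)
  <= 4 * wnrm (dif D V) ^+ 2.
Proof.
move=> vV; have -> : 4 * wnrm (dif D V) ^+ 2 =
    \sum_t (2 * (expw t * dif D V t ^+ 2) +
            2 * (expw (bwd D t) * dif D V (bwd D t) ^+ 2)).
  rewrite -(sum_fwd D); under eq_bigr do rewrite fwdK.
  rewrite big_split /= -!big_distrr /= -!wnrm_sq.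
  rewrite (sum_fwd D (fun t => expw t * dif D V t ^+ 2)) -wnrm_sq; lra.
apply: ler_sum => t _; have w0 := expw_gt0 t; have w1 := expw_gt0 (bwd D t).
case: ifPn => wt.
  by rewrite addr_ge0// mulr_ge0// mulr_ge0 ?sqr_ge0// ltW.
rewrite (expw_bwd wt) (_ : cen D V t = dif D V t + dif D V (bwd D t)); last first.
  by rewrite /cen /dif bwdK; ring.
move: (dif D V t) (dif D V (bwd D t)) => a b.
have : 0 <= expw t * (a - b) ^+ 2 by rewrite mulr_ge0 ?sqr_ge0// ltW.
have : 0 <= tau * (expw t * b ^+ 2).
  by rewrite mulr_ge0 ?(ltW tau_gt0)// mulr_ge0 ?sqr_ge0// ltW.
lra.
Qed.

(** The source of control on V: against an exponential weight, transport returns the increments 1 -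
    th = tau th of the weight, with a fixed sign. *)
Lemma dot_wV_cen V : vanish D V ->
  dot (fun t => expw t * V t) (cen D V) =
  tau * th * \sum_t expw t * (V t * V (fwd D t)).
Proof.
move=> vV; rewrite big_distrr.
apply: (sum_telescope (D := D) (G := fun t => expw t * V t * V (bwd D t))) => t.
rewrite fwdK /cen /=; have [wst|wst] := boolP (wall D (fwd D t)).
  by rewrite (vV _ wst); ring.
rewrite (expw_fwd wst) (_ : tau * th = 1 - th); first by ring.
by rewrite -thE; ring.
Qed.

(** Discrete Leibniz rule: off the wall, lap (w V) = w (lap V - tau cen V + tau^2 th V(fwd)).
    Leaving half of the weight in [cw] and [fw] produces weighted norms in the commutator terms. *)
Lemma dot_wV_lap2 V : vanish D V ->
  `|dot (fun t => expw t * V t) (lap D (lap D V))| <= nrm (lap D V) ^+ 2 +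
  tau * nrm (lap D V) * (2 * wnrm (dif D V) + 2 * tau * wnrm V).
Proof.
move=> vV; rewrite dot_lapC; [|by move=> t wt; rewrite (vV t wt) mulr0|exact: vanish_lap].
pose cw t : R := if wall D t then 0 else Num.sqrt (expw t) * cen D V t.
pose fw t : R := if wall D t then 0 else Num.sqrt (expw t) * V (fwd D t).
have sw t : Num.sqrt (expw t) * Num.sqrt (expw t) = expw t.
  by rewrite -expr2 sqr_sqrtr// ltW// expw_gt0.
have e t : lap D (fun t => expw t * V t) t = expw t * lap D V t +
    tau * (Num.sqrt (expw t) * (-1 * cw t + tau * th * fw t)).
  rewrite /cw /fw /lap; case: ifPn => wt; first by ring.
  have sE x y c : Num.sqrt (expw t) * (-1 * (Num.sqrt (expw t) * x) +
      c * (Num.sqrt (expw t) * y)) = expw t * (-1 * x + c * y).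
    by rewrite -[in RHS]sw; ring.
  rewrite (expw_bwd wt) sE /cen.
  have [wst|wst] := boolP (wall D (fwd D t)); first by rewrite (vV _ wst); ring.
  rewrite (expw_fwd wst); have /eqP := thE; rewrite -subr_eq0 => /eqP e0.
  apply/eqP; rewrite -subr_eq0; apply/eqP; rewrite [LHS](_ : _ =
    expw t * V (fwd D t) * (1 - tau) * (th * (1 + tau) - 1)); last by ring.
  by rewrite e0 mulr0.
have cwn : nrm cw <= 2 * wnrm (dif D V).
  apply: nrm_le; first by rewrite mulr_ge0// wnrm_ge0.
  rewrite exprMn (_ : 2 ^+ 2 = 4); last by ring.
  apply: le_trans (sum_wcen_sq vV); apply: ler_sum => t _.
  rewrite /cw; case: ifP => _; first by rewrite expr0n.
  by rewrite exprMn expr2 sw.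
have fwn : nrm fw <= 2 * wnrm V.
  apply: nrm_le; first by rewrite mulr_ge0// wnrm_ge0.
  rewrite exprMn wnrm_sq -(sum_fwd D (fun t => expw t * V t ^+ 2)) big_distrr.
  apply: ler_sum => t _; rewrite /fw /=.
  have r0 x (y : R) : 0 <= 2 ^+ 2 * (expw x * y ^+ 2).
    by rewrite mulr_ge0 ?sqr_ge0// mulr_ge0 ?sqr_ge0//; exact/ltW/expw_gt0.
  case: ifP => _; first by rewrite {1}expr2 mul0r.
  rewrite exprMn expr2 sw.
  have [wst|wst] := boolP (wall D (fwd D t)).
    by rewrite (vV _ wst) {1}expr2 mul0r mulr0.
  have : th * tau <= th * 2^-1 by rewrite ler_wpM2l// ltW// th_gt0.
  have := thE; rewrite mulrDr mulr1 (expw_fwd wst) => h1 h2.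
  have : 0 <= (4 * th - 1) * (expw t * V (fwd D t) ^+ 2).
    apply: mulr_ge0; first by lra.
    by apply: mulr_ge0; [exact/ltW/expw_gt0 | exact: sqr_ge0].
  lra.
have -> : dot (lap D (fun t => expw t * V t)) (lap D V) =
    dot (fun t => expw t * lap D V t + tau *
    (Num.sqrt (expw t) * (-1 * cw t + tau * th * fw t))) (lap D V).
  exact: eq_dot.
rewrite dotDl dotZl; apply: le_trans (ler_normD _ _) _; apply: lerD.
  rewrite expr2; apply: le_trans (norm_dot_le _ _) _; rewrite ler_wpM2r ?nrm_ge0//.
  apply: nrm_mono => t; rewrite normrM (ger0_norm (ltW (expw_gt0 t))).
  by rewrite ler_piMl// expw_le1.
rewrite normrM gtr0_norm// -mulrA ler_pM2l//.
apply: le_trans (norm_dot_le _ _) _; rewrite mulrC ler_wpM2l ?nrm_ge0//.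
apply: (@le_trans _ _ (nrm (fun t => -1 * cw t + tau * th * fw t))).
  apply: nrm_mono => t; rewrite normrM ger0_norm ?sqrtr_ge0// ler_piMl//.
  by rewrite -[leRHS](sqrtr1 R) ler_wsqrtr// expw_le1.
apply: le_trans (nrmD _ _) _; apply: lerD; rewrite nrmM.
  by rewrite normrN1 mul1r.
rewrite ger0_norm; last by apply: mulr_ge0; apply/ltW => //; exact: th_gt0.
have h1 : th * nrm fw <= nrm fw.
  by rewrite ler_piMl ?nrm_ge0//; exact/ltW/th_lt1.
have := ler_wpM2l (ltW tau_gt0) (le_trans h1 fwn); lra.
Qed.

(** The multiplier argument of [face_le] with an exponential profile. Subtracting th^n lets the
    weight reach zero at the far end without an extra jump, so the face term carries exactly the
    jump th - th^n at the near end. *)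
Lemma face_exp V : vanish D V ->
  (th - th ^+ n) * face D V <=
  tau * wnrm (dif D V) ^+ 2 + 2 * nrm (lap D V) * wnrm (dif D V).
Proof.
move=> vV; pose w t : R := if wall D t then 0 else expw t - th ^+ n.
have vw : vanish D w by move=> t wt; rewrite /w wt.
have th0 := th_gt0; have th1 := th_lt1.
have w_le t : 0 <= th ^+ n <= expw t.
  apply/andP; split; first exact/exprn_ge0/ltW.
  by rewrite /expw; apply: ler_wiXn2l; [exact: ltW..|exact/ltnW/pos_lt].
have ttE : tau * th = 1 - th by rewrite -thE; ring.
have e := dot_lap_cen_weighted vV vw.
have e2 : \sum_t (w t - w (fwd D t)) * dif D V t ^+ 2 =
    \sum_t (if wall D t then 0 else (1 - th) * (expw t * dif D V t ^+ 2))
    - (th - th ^+ n) * face D V.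
  rewrite face_dif// [X in _ * X]big_mkcond big_distrr -sumrB.
  apply: eq_bigr => t _; rewrite /w /=; have [wt|wt] := boolP (wall D t).
    rewrite (negbTE (wall_fwd wt)) (expw_fwd (wall_fwd wt)) {1}/expw (eqP wt) expr0.
    by ring.
  have [wst|wst] := boolP (wall D (fwd D t)); last by rewrite (expw_fwd wst); ring.
  by rewrite -(pos_fwd_wall wst) exprS -/(expw t); ring.
have e3 : \sum_t (if wall D t then 0 else (1 - th) * (expw t * dif D V t ^+ 2))
    <= tau * wnrm (dif D V) ^+ 2.
  rewrite wnrm_sq big_distrr; apply: ler_sum => t _ /=.
  have h : 0 <= expw t * dif D V t ^+ 2 by rewrite mulr_ge0 ?sqr_ge0// ltW// expw_gt0.
  case: ifP => _; first by rewrite mulr_ge0// ltW.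
  by rewrite ler_wpM2r// -ttE ler_piMr// ltW.
have e4 : `|dot (fun t => w t * lap D V t) (cen D V)| <=
    nrm (lap D V) * (2 * wnrm (dif D V)).
  pose cw t : R := if wall D t then 0 else Num.sqrt (expw t) * cen D V t.
  pose lw t : R := if wall D t then 0 else (w t / Num.sqrt (expw t)) * lap D V t.
  rewrite (_ : dot _ _ = dot lw cw).
    apply: le_trans (norm_dot_le _ _) _; apply: ler_pM; rewrite ?nrm_ge0//.
      apply: nrm_mono => t; rewrite /lw; case: ifPn => wt; first by rewrite normr0.
      rewrite normrM ler_piMl// /w (negbTE wt).
      have := expw_gt0 t; have := expw_le1 t; have /andP[] := w_le t => a1 a2 a3 a4.
      have s0 : 0 < Num.sqrt (expw t) by rewrite sqrtr_gt0.
      rewrite ger0_norm; last by rewrite divr_ge0 ?subr_ge0// ltW.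
      rewrite ler_pdivrMr// mul1r (le_trans (_ : _ <= expw t)) ?gerBl//.
      by have := sqr_sqrtr (ltW a4); nra.
    apply: nrm_le; first by rewrite mulr_ge0// wnrm_ge0.
    rewrite exprMn (_ : 2 ^+ 2 = 4); last by ring.
    apply: le_trans (sum_wcen_sq vV); apply: ler_sum => t _.
    rewrite /cw; case: ifP => _; first by rewrite expr0n.
    by rewrite exprMn sqr_sqrtr// ltW// expw_gt0.
  apply: eq_bigr => t _; rewrite /lw /cw /w; case: ifP => _; first by rewrite !mul0r.
  have s0 : Num.sqrt (expw t) != 0 by rewrite gt_eqF// sqrtr_gt0 expw_gt0.
  by field.
move: e4; rewrite e e2 ler_norml => /andP[e4 _]; lra.
Qed.

End ExponentialWeight.

(** * Interaction of two different axes *)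

Definition indep (T : finType) (D E : direction T) : Prop :=
  [/\ forall t, fwd D (fwd E t) = fwd E (fwd D t),
      forall t, pos D (fwd E t) = pos D t
    & forall t, pos E (fwd D t) = pos E t].

Lemma indep_sym (T : finType) (D E : direction T) : indep D E -> indep E D.
Proof. by case=> h1 h2 h3; split. Qed.

Section Pair.
Context {R : rcfType} {T : finType}.
Variables (D E : direction T).
Hypothesis DE : indep D E.
Implicit Types (f : T -> R).

Lemma fwd_fwd t : fwd D (fwd E t) = fwd E (fwd D t).
Proof. by case: DE. Qed.

Lemma bwd_fwd t : bwd D (fwd E t) = fwd E (bwd D t).
Proof. by rewrite -{1}(bwdK D t) -fwd_fwd fwdK. Qed.

Lemma fwd_bwd t : fwd D (bwd E t) = bwd E (fwd D t).
Proof. by rewrite -{2}(bwdK E t) fwd_fwd fwdK. Qed.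

Lemma bwd_bwd t : bwd D (bwd E t) = bwd E (bwd D t).
Proof. by rewrite -{1}(bwdK D t) -fwd_bwd fwdK. Qed.

Lemma pos_fwd_indep t : pos D (fwd E t) = pos D t.
Proof. by case: DE. Qed.

Lemma pos_bwd_indep t : pos D (bwd E t) = pos D t.
Proof. by rewrite -[in RHS](bwdK E t) pos_fwd_indep. Qed.

Lemma wall_fwd_indep t : wall D (fwd E t) = wall D t.
Proof. by rewrite /wall pos_fwd_indep. Qed.

Lemma wall_bwd_indep t : wall D (bwd E t) = wall D t.
Proof. by rewrite /wall pos_bwd_indep. Qed.

Lemma vanish_lap_indep f : vanish D f -> vanish D (lap E f).
Proof.
move=> vf t wt; rewrite /lap !vf ?wall_fwd_indep ?wall_bwd_indep//.
by case: ifP => // _; ring.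
Qed.

Lemma vanish_dif_indep f : vanish D f -> vanish D (dif E f).
Proof. by move=> vf t wt; rewrite /dif !vf ?wall_fwd_indep//; ring. Qed.

Lemma vanish_hop_indep f : vanish D f -> vanish D (hop E f).
Proof.
move=> vf t wt; rewrite /hop (vf (fwd E t)) ?wall_fwd_indep//.
by rewrite (vf (bwd E t)) ?wall_bwd_indep// !mulr0 addr0.
Qed.

Lemma lap_dif f : lap D (dif E f) =1 dif E (lap D f).
Proof.
move=> t; rewrite /lap /dif wall_fwd_indep; case: ifP => _; first by ring.
by rewrite fwd_fwd bwd_fwd; ring.
Qed.

Lemma lap_cen_indep f : lap D (cen E f) =1 cen E (lap D f).
Proof.
move=> t; rewrite /lap /cen wall_fwd_indep wall_bwd_indep; case: ifP => _.
  by ring.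
by rewrite fwd_fwd bwd_fwd fwd_bwd bwd_bwd; ring.
Qed.

End Pair.

Lemma lap_lapC (R : rcfType) (T : finType) (D E : direction T) (f : T -> R) :
  indep D E -> lap D (lap E f) =1 lap E (lap D f).
Proof.
move=> DE t; have ED := indep_sym DE; rewrite /lap.
rewrite !(wall_fwd_indep DE) !(wall_bwd_indep DE) !(wall_fwd_indep ED).
rewrite !(wall_bwd_indep ED).
case: ifP => _; case: ifP => _; try by ring.
rewrite (fwd_fwd DE) (bwd_fwd DE) (fwd_bwd DE) (bwd_bwd DE).
by ring.
Qed.

Section PairDot.
Context {R : rcfType} {T : finType}.
Variables (D E : direction T).
Hypothesis DE : indep D E.
Implicit Types (V : T -> R).
Let ED := indep_sym DE.

Lemma eq_lap (F : direction T) (f g : T -> R) : f =1 g -> lap F f =1 lap F g.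
Proof. by move=> fg t; rewrite /lap !fg. Qed.

Lemma eq_cen (F : direction T) (f g : T -> R) : f =1 g -> cen F f =1 cen F g.
Proof. by move=> fg t; rewrite /cen !fg. Qed.

(** Each truncated Laplacian preserves vanishing on the other wall and commutes with the other one.
    So this product and those of the next two lemmas are, up to sign, the squared norms of
    [dif D (dif E V)], [dif D (lap E V)] and [lap D (lap E V)]. *)
Lemma dot_lap_lap_ge0 V : vanish D V -> vanish E V ->
  0 <= dot (lap D V) (lap E V).
Proof.
move=> vD vE.
rewrite dotC -(dot_lapC (D := E)) //; last exact: vanish_lap_indep.
rewrite dot_lap// (_ : dot _ _ = dot (dif E V) (lap D (dif E V))); last first.
  by apply: eq_dot => // t; rewrite lap_dif.
by rewrite -nrm_dif_sq ?sqr_ge0//; exact: vanish_dif_indep.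
Qed.

Lemma dot_lap_lap2_le0 V : vanish D V -> vanish E V ->
  dot (lap D V) (lap E (lap E V)) <= 0.
Proof.
move=> vD vE.
rewrite dot_lapC; [|exact: vanish_lap_indep|exact: vanish_lap].
rewrite (eq_dot (f' := lap D (lap E V)) (g' := lap E V))//; last first.
  by move=> t; rewrite lap_lapC.
rewrite dotC -oppr_ge0 -nrm_dif_sq ?sqr_ge0//; exact: vanish_lap_indep.
Qed.

Lemma dot_lap2_lap2_ge0 V : vanish D V -> vanish E V ->
  0 <= dot (lap D (lap D V)) (lap E (lap E V)).
Proof.
move=> vD vE; have vE2 : vanish E (lap D V) by exact: vanish_lap_indep.
rewrite dot_lapC; [|exact: vanish_lap_indep|exact: vanish_lap].
have e : lap E (lap D (lap D V)) =1 lap D (lap D (lap E V)).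
  by move=> t; rewrite (lap_lapC _ ED); apply: eq_lap => r; rewrite lap_lapC.
rewrite (eq_dot e (fun=> erefl)) dotC dot_lapC ?dot_ge0//.
  exact: vanish_lap_indep.
exact: vanish_lap.
Qed.

(** Carrying one [lap D] across leaves [cen E] between two copies of [lap D V], where antisymmetry
    applies. *)
Lemma dot_lap2_cen_indep V : vanish D V -> dot (lap D (lap D V)) (cen E V) = 0.
Proof.
move=> vD; rewrite -dot_lapC; [|exact: vanish_lap|]; last first.
  move=> t wt; rewrite /cen !vD ?subrr//.
    by rewrite (wall_bwd_indep DE).
  by rewrite (wall_fwd_indep DE).
rewrite (eq_dot (fun=> erefl) (lap_cen_indep DE V)).
exact: dot_cen_self.
Qed.

Lemma dot_weight_cen (w : T -> R) V : (forall t, w (fwd E t) = w t) ->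
  dot (fun t => w t * V t) (cen E V) = 0.
Proof.
move=> wE; apply: (sum_telescope0 (D := E) (G := fun t => w t * V t * V (bwd E t))) => t.
by rewrite fwdK wE /cen; ring.
Qed.

Lemma dot_weight_lap2 (w : T -> R) V : (forall t, w (fwd E t) = w t) ->
  vanish E V ->
  dot (fun t => w t * V t) (lap E (lap E V)) = \sum_t w t * lap E V t ^+ 2.
Proof.
move=> wE vE; have wE' t : w (bwd E t) = w t by rewrite -{2}(bwdK E t) wE.
rewrite dot_lapC; [|by move=> t wt; rewrite vE// mulr0|exact: vanish_lap].
apply: eq_bigr => t _; rewrite {1}/lap wE wE'.
by have := vanish_lap (D := E) V (t := t); rewrite /lap; case: ifP => _ _; ring.
Qed.

(** The ramp is constant along E, so the symmetric operator [hop D] commutes with the antisymmetric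
    [cen E]. *)
Lemma dot_hop_cen_indep V : dot (hop D V) (cen E V) = 0.
Proof.
have rE t : ramp D (fwd E t) = ramp D t :> R.
  by rewrite /ramp (wall_fwd_indep DE) (pos_fwd_indep DE).
have rE' t : ramp D (bwd E t) = ramp D t :> R.
  by rewrite /ramp (wall_bwd_indep DE) (pos_bwd_indep DE).
pose G1 t := ramp D (bwd D t) * V (bwd D t) * cen E V t.
pose g t := ramp D t * (V (fwd D t) * cen E V t + V t * cen E V (fwd D t)).
have -> : dot (hop D V) (cen E V) = \sum_t g t.
  apply: (sum_telescope (D := D) (G := fun t => - G1 t)) => t.
  by rewrite /G1 /g /hop fwdK; ring.
apply: (sum_telescope0 (D := E) (G := fun t => ramp D t *
  (V (fwd D (bwd E t)) * V t + V (bwd E t) * V (fwd D t)))) => t.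
rewrite /g /cen rE fwdK (fwd_bwd DE) (fwd_fwd DE).
ring.
Qed.

End PairDot.

Lemma indep_rev (T : finType) (D E : direction T) : indep D E -> indep (rev D) E.
Proof.
move=> DE; split => t /=; first exact: bwd_fwd.
- by rewrite /rev_pos (pos_fwd_indep DE).
- exact: (pos_bwd_indep (indep_sym DE)).
Qed.

(* The formal adjoint of the scheme, hence the sign of [cen]. The ghost-point
   conditions are encoded in [lap], which is zero on the walls. *)
Record adjoint (R : rcfType) (d : nat) := Adjoint {
  adom : finType;
  adir : 'I_d -> direction adom;
  ah : 'I_d -> R;
  arho : 'I_d -> R;
  anu : 'I_d -> R;
  abe : 'I_d -> R;
  ac : adom -> R;
  aV : adom -> R;
  au : adom -> R;
  aindep : forall i j, i != j -> indep (adir i) (adir j);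
  avanish : forall i, vanish (adir i) aV;
  aeq : forall t, (forall i, ~~ wall (adir i) t) ->
    \sum_i (- arho i * lap (adir i) aV t
            + anu i * lap (adir i) (lap (adir i) aV) t
            - abe i * cen (adir i) aV t) + ac t * aV t = au t }.

Arguments ac {R d} a t.
Arguments aV {R d} a t.
Arguments au {R d} a t.

(** * Weak form and energy identity of the adjoint scheme *)

Section Adjoint.
Context {R : rcfType} {d : nat}.
Variable P : adjoint R d.
Local Notation T := (adom P).
Local Notation D := (@adir _ _ P).
Local Notation V := (@aV _ _ P).
Local Notation u := (@au _ _ P).
Local Notation rho := (@arho _ _ P).
Local Notation nu := (@anu _ _ P).
Local Notation be := (@abe _ _ P).
Local Notation c := (@ac _ _ P).
Implicit Types (f g : T -> R) (i j : 'I_d).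

Definition vanish_all f := forall i, vanish (D i) f.

Lemma aV_vanish : vanish_all V.
Proof. exact: avanish. Qed.

Lemma vanish_all_lap i f : vanish_all f -> vanish_all (lap (D i) f).
Proof.
move=> vf j; have [->|ij] := eqVneq j i; first exact: vanish_lap.
by apply: vanish_lap_indep => //; exact: aindep.
Qed.

(** The equation is given at interior nodes only; a test function vanishing on all walls does not
    see the other nodes. *)
Lemma adjoint_weak f : vanish_all f ->
  \sum_i (- rho i * dot f (lap (D i) V) + nu i * dot f (lap (D i) (lap (D i) V))
          - be i * dot f (cen (D i) V)) + dot f (fun t => c t * V t) = dot f u.
Proof.
move=> vf; rewrite [RHS](_ : _ = dot f (fun t =>
    \sum_i (- rho i * lap (D i) V t + nu i * lap (D i) (lap (D i) V) t
            - be i * cen (D i) V t) + c t * V t)); last first.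
  apply: eq_bigr => t _; have [h|/existsP[i]] := boolP [forall i, ~~ wall (D i) t].
    by rewrite aeq//; exact/forallP.
  by rewrite negbK => wt; rewrite (vf i t wt) !mul0r.
rewrite dotDr dot_sumr; congr (_ + _); apply: eq_bigr => i _.
rewrite /dot !big_distrr -big_split -sumrB.
by apply: eq_bigr => t _ /=; ring.
Qed.

Lemma adjoint_energy :
  \sum_i (rho i * nrm (dif (D i) V) ^+ 2 + nu i * nrm (lap (D i) V) ^+ 2)
  + dot V (fun t => c t * V t) = dot V u.
Proof.
rewrite -(adjoint_weak aV_vanish); congr (_ + _); apply: eq_bigr => i _.
rewrite dot_cen_self (nrm_dif_sq (@aV_vanish i)) mulr0 subr0 nrm_sq.
rewrite -dot_lapC; [by ring|exact: avanish|exact: vanish_lap].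
Qed.

Lemma dot_mass_ge (x : R) : (forall t, x <= c t) ->
  x * nrm V ^+ 2 <= dot V (fun t => c t * V t).
Proof.
move=> xc; rewrite nrm_sqE big_distrr; apply: ler_sum => t _ /=.
by rewrite [leRHS]mulrCA -expr2 ler_wpM2r// sqr_ge0.
Qed.

(** Lets one argument treat both faces orthogonal to axis i. *)
Definition along i (E : direction T) := E = D i \/ E = rev (D i).

Lemma along_indep i E j : along i E -> j != i -> indep E (D j).
Proof.
by case=> -> ij; [|apply: indep_rev]; apply: aindep; rewrite eq_sym.
Qed.

Lemma along_wall i E t : along i E -> wall E t = wall (D i) t.
Proof. by case=> ->; rewrite ?wall_rev. Qed.

Lemma along_len i E : along i E -> len E = len (D i).
Proof. by case=> ->. Qed.

Lemma along_lap i E f : along i E -> lap E f =1 lap (D i) f.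
Proof. by case=> -> // t; rewrite lap_rev. Qed.

Lemma along_lap2 i E f : along i E -> lap E (lap E f) =1 lap (D i) (lap (D i) f).
Proof. by case=> -> // t; rewrite lap_rev; apply: eq_lap => r; rewrite lap_rev. Qed.

Lemma along_dot_cen i E f g : along i E ->
  `|dot f (cen E g)| = `|dot f (cen (D i) g)|.
Proof.
case=> -> //; rewrite (_ : dot _ _ = -1 * dot f (cen (D i) g)).
  by rewrite normrM normrN1 mul1r.
by rewrite -dotZr; apply: eq_bigr => t _; rewrite cen_rev.
Qed.

Lemma along_vanish i E f : along i E -> vanish_all f -> vanish E f.
Proof. by move=> iE vf t; rewrite (along_wall _ iE); exact: vf. Qed.

Lemma along_nrm_lap i E f : along i E -> nrm (lap E f) = nrm (lap (D i) f).
Proof. by move=> iE; apply: nrm_eq; exact: along_lap. Qed.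

(* With [x = be i] or [x = - be i], the flux paired in Green's formula with the
   Dirichlet data on one of the two faces. *)
Definition flux (x : R) i t := rho i * V t - nu i * lap (D i) V t + x * V t.

(** Prescribing only the square of x covers both signs of [be i], one for each face. *)
Definition adjoint_bound (C : R) := nrm V <= C * nrm u /\
  forall i E x, along i E -> x ^+ 2 = be i ^+ 2 ->
    face E (flux x i) <= C * nrm u ^+ 2 / ah P i.

End Adjoint.

Arguments along {R d} P i E.
Arguments flux {R d} P x i t.
Arguments adjoint_bound {R d} P C.

(* Each one-dimensional operator is dominated by their sum, because the
   truncated Laplacians along different axes commute. *)
Section Parabolic.
Context {R : rcfType} {d : nat}.
Variable P : adjoint R d.
Local Notation D := (@adir _ _ P).
Local Notation V := (@aV _ _ P).
Local Notation u := (@au _ _ P).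
Local Notation rho := (@arho _ _ P).
Local Notation nu := (@anu _ _ P).
Local Notation be := (@abe _ _ P).
Local Notation c := (@ac _ _ P).
Hypothesis rho_ge0 : forall i, 0 <= rho i.
Hypothesis nu_ge0 : forall i, 0 <= nu i.

Definition axis_op i t : R := - rho i * lap (D i) V t + nu i * lap (D i) (lap (D i) V) t.

Lemma vanish_axis_op i : vanish_all (axis_op i).
Proof.
have h1 : vanish_all (lap (D i) V) := vanish_all_lap i (@aV_vanish _ _ P).
have h2 : vanish_all (lap (D i) (lap (D i) V)) := vanish_all_lap i h1.
by move=> j t wt; rewrite /axis_op (h1 j t wt) (h2 j t wt) !mulr0 addr0.
Qed.

Lemma dot_axis_op_ge0 i j : 0 <= dot (axis_op i) (axis_op j).
Proof.
have [->|ij] := eqVneq i j; first exact: dot_ge0.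
have IJ := @aindep _ _ P _ _ ij; have JI := indep_sym IJ.
have vi := @avanish _ _ P i; have vj := @avanish _ _ P j.
rewrite /axis_op dotDl !dotDr !dotZl !dotZr.
have h1 := dot_lap_lap_ge0 IJ vi vj; have h2 := dot_lap_lap2_le0 IJ vi vj.
have h3 := dot_lap_lap2_le0 JI vj vi; rewrite dotC in h3.
have h4 := dot_lap2_lap2_ge0 IJ vi vj.
have ri := rho_ge0 i; have rj := rho_ge0 j; have ni := nu_ge0 i; have nj := nu_ge0 j.
have := mulr_ge0 (mulr_ge0 ri rj) h1.
have := mulr_ge0 (mulr_ge0 ni nj) h4.
have := mulr_ge0_le0 (mulr_ge0 ri nj) h2.
have := mulr_ge0_le0 (mulr_ge0 ni rj) h3.
lra.
Qed.

Lemma rho_lap_le i : rho i * nrm (lap (D i) V) <= nrm (axis_op i).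
Proof.
have e : dot (fun t => -1 * lap (D i) V t) (axis_op i) =
    rho i * nrm (lap (D i) V) ^+ 2 + nu i * nrm (dif (D i) (lap (D i) V)) ^+ 2.
  rewrite dotZl /axis_op dotDr !dotZr nrm_sq nrm_dif_sq; last exact: vanish_lap.
  by ring.
have := dot_le (fun t => -1 * lap (D i) V t) (axis_op i).
rewrite nrmM normrN1 mul1r e => h1.
have h2 : rho i * nrm (lap (D i) V) ^+ 2 <= nrm (lap (D i) V) * nrm (axis_op i).
  by apply: le_trans h1; rewrite lerDl mulr_ge0 ?sqr_ge0.
have := nrm_ge0 (lap (D i) V); rewrite le_eqVlt => /predU1P[<-|l0].
  by rewrite mulr0 nrm_ge0.
by rewrite -(ler_pM2l l0) (le_trans _ h2)// expr2 mulrCA.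
Qed.

(** The equation is tested with [axis_op i] itself; the products with the other axes have the good
    sign by [dot_axis_op_ge0]. *)
Lemma axis_op_le i : nrm (axis_op i) <=
  nrm (fun t => u t + -1 * (c t * V t) + \sum_j be j * cen (D j) V t).
Proof.
set F := fun t => _.
have e : \sum_j dot (axis_op i) (axis_op j) = dot (axis_op i) F.
  rewrite /F dotDr dotDr dotZr dot_sumr -(adjoint_weak (vanish_axis_op i)).
  rewrite mulN1r addrK -big_split; apply: eq_bigr => j _ /=.
  have -> : dot (axis_op i) (axis_op j) = - rho j * dot (axis_op i) (lap (D j) V)
      + nu j * dot (axis_op i) (lap (D j) (lap (D j) V)).
    by rewrite -!dotZr -dotDr.
  by rewrite dotZr; ring.
have h1 : nrm (axis_op i) ^+ 2 <= dot (axis_op i) F.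
  rewrite -e (bigD1 i)//= -nrm_sq lerDl; apply: sumr_ge0 => j _.
  exact: dot_axis_op_ge0.
have := le_trans h1 (dot_le _ _).
have := nrm_ge0 (axis_op i); rewrite le_eqVlt => /predU1P[<-|l0].
  by rewrite nrm_ge0.
by rewrite expr2 ler_pM2l.
Qed.

End Parabolic.

Arguments axis_op {R d} P i t.

(** * The adjoint bound for positive eps *)

Section BoundParabolic.
Context {R : rcfType} {d : nat}.
Variables (L b : 'I_d -> R) (eps sigma cm : R).
Hypotheses (d_gt0 : (0 < d)%N) (L_gt0 : forall i, 0 < L i) (eps_gt0 : 0 < eps)
  (sigma_ge0 : 0 <= sigma) (cm_ge0 : 0 <= cm).
Variable P : adjoint R d.
Local Notation D := (@adir _ _ P).
Local Notation V := (@aV _ _ P).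
Local Notation h := (@ah _ _ P).
Local Notation rho := (@arho _ _ P).
Local Notation nu := (@anu _ _ P).
Local Notation be := (@abe _ _ P).
Local Notation c := (@ac _ _ P).
Local Notation M := (nrm (@au _ _ P)).
Hypotheses (h_gt0 : forall i, 0 < h i)
  (hn : forall i, h i * (len (D i))%:R = L i)
  (rhoE : forall i, rho i = eps / h i ^+ 2 + sigma) (nu_ge0 : forall i, 0 <= nu i)
  (beE : forall i, be i = b i / (2 * h i)) (c_bound : forall t, 0 <= c t <= cm).

Let L_ge0 i : 0 <= L i. Proof. exact: ltW. Qed.
Let h_ge0 i : 0 <= h i. Proof. exact: ltW. Qed.
Let eps_ge0 : 0 <= eps. Proof. exact: ltW. Qed.
Let V_ge0 : 0 <= nrm V. Proof. exact: nrm_ge0. Qed.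
Let M_ge0 : 0 <= M. Proof. exact: nrm_ge0. Qed.
#[local] Hint Resolve L_ge0 h_ge0 eps_ge0 V_ge0 M_ge0 : core.

Lemma rho_ge i : eps / h i ^+ 2 <= rho i.
Proof. by rewrite rhoE lerDl. Qed.

Lemma rho_gt0 i : 0 < rho i.
Proof. by apply: lt_le_trans (rho_ge i); rewrite divr_gt0// exprn_gt0. Qed.

Lemma parabolic_dif i : eps * nrm (dif (D i) V) ^+ 2 <= h i ^+ 2 * (nrm V * M).
Proof.
have h2 : 0 < h i ^+ 2 by rewrite exprn_gt0.
have e := adjoint_energy P; have le := dot_le V (@au _ _ P).
have c0 : 0 <= dot V (fun t => c t * V t).
  have := @dot_mass_ge _ _ P 0; rewrite mul0r; apply => t.
  by have /andP[] := c_bound t.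
have : rho i * nrm (dif (D i) V) ^+ 2 <= nrm V * M.
  apply: le_trans le; rewrite -e (bigD1 i)//= -!addrA lerDl.
  have n0 j : 0 <= nu j * nrm (lap (D j) V) ^+ 2.
    by apply: mulr_ge0; [exact: nu_ge0 | exact: sqr_ge0].
  apply: addr_ge0 => //; apply: addr_ge0 => //; apply: sumr_ge0 => j _.
  apply: addr_ge0 => //; apply: mulr_ge0; last exact: sqr_ge0.
  exact/ltW/rho_gt0.
move=> h1; have := le_trans (ler_wpM2r (sqr_ge0 (nrm (dif (D i) V))) (rho_ge i)) h1.
by rewrite mulrAC ler_pdivrMr// (mulrC _ (h i ^+ 2)).
Qed.

(** The Poincare inequality along a single axis suffices; summing the squared lengths makes the
    constant independent of that choice. *)
Definition KV : R := 4 * (\sum_i L i ^+ 2) / eps.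

Lemma parabolic_nrm : nrm V <= KV * M.
Proof.
pose i := Ordinal d_gt0; have h1 := parabolic_dif i.
have h2 := poincare (@avanish _ _ P i).
have V0 := nrm_ge0 V.
have LL : L i ^+ 2 <= \sum_i L i ^+ 2.
  by rewrite (bigD1 i)//= lerDl; apply: sumr_ge0 => j _; exact: sqr_ge0.
have h3 : nrm V ^+ 2 <= 4 * (len (D i))%:R ^+ 2 * nrm (dif (D i) V) ^+ 2.
  rewrite (_ : 4 * _ * _ = (2 * (len (D i))%:R * nrm (dif (D i) V)) ^+ 2); last by ring.
  by rewrite ler_sqr// nnegrE// mulr_ge0 ?nrm_ge0// mulr_ge0.
have h4 : eps * nrm V ^+ 2 <= 4 * L i ^+ 2 * (nrm V * M).
  have := ler_wpM2l eps_ge0 h3 => /le_trans; apply.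
  rewrite mulrCA (mulrC eps) -mulrA [leLHS](_ : _ = 4 * (len (D i))%:R ^+ 2 *
    (eps * nrm (dif (D i) V) ^+ 2)); last by ring.
  apply: le_trans (ler_wpM2l _ h1) _; first by rewrite mulr_ge0// sqr_ge0.
  by rewrite -hn; rewrite le_eqVlt; apply/orP; left; apply/eqP; ring.
have h5 : eps * nrm V * nrm V <= 4 * (\sum_i L i ^+ 2) * M * nrm V.
  rewrite -mulrA -expr2 (le_trans h4)// [leRHS](_ : _ =
   4 * (\sum_i L i ^+ 2) * (nrm V * M)); last by ring.
  by rewrite ler_wpM2r ?mulr_ge0// ler_wpM2l.
rewrite /KV mulrAC ler_pdivlMr// mulrC.
move: V0; rewrite le_eqVlt => /predU1P[<-|V0]; last by rewrite -(ler_pM2r V0).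
by rewrite mulr0 !mulr_ge0// sumr_ge0// => j _; exact: sqr_ge0.
Qed.

Lemma KV_ge0 : 0 <= KV.
Proof.
by rewrite divr_ge0// mulr_ge0// sumr_ge0// => j _; exact: sqr_ge0.
Qed.

Lemma parabolic_cen i : `|be i| * nrm (cen (D i) V) <= `|b i| * (1 + KV / eps) * M.
Proof.
have h1 := parabolic_dif i; have h2 := parabolic_nrm; have h0 := h_gt0 i.
have k0 : 0 <= KV / eps by rewrite divr_ge0 ?KV_ge0//.
(* The factor 1 + KV / eps stands in for the square root of KV / eps. *)
have h3 : nrm (dif (D i) V) <= h i * ((1 + KV / eps) * M).
  apply: le_of_sqr_le; first by rewrite !mulr_ge0 ?addr_ge0.
  have h3 : nrm V * M <= eps * ((1 + KV / eps) * M) ^+ 2.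
    apply: (@le_trans _ _ (KV * M * M)); first by rewrite ler_wpM2r.
    have -> : KV * M * M = eps * (KV / eps * M ^+ 2) by field; rewrite gt_eqF.
    rewrite ler_wpM2l// exprMn ler_wpM2r ?sqr_ge0//.
    by move: (KV / eps) k0 => k k0; nra.
  rewrite -(ler_pM2l eps_gt0); apply: le_trans h1 _.
  have := ler_wpM2l (sqr_ge0 (h i)) h3; lra.
have h4 := nrm_cen_le (D i) V.
move: (KV / eps) h3 {k0} => k h3.
rewrite beE normrM normfV normrM normr_nat (gtr0_norm h0) -!mulrA ler_wpM2l//.
rewrite mulrC ler_pdivrMr ?mulr_gt0// (le_trans h4)//.
by move: h3; lra.
Qed.

Definition KH : R := 1 + cm * KV + \sum_i `|b i| * (1 + KV / eps).

Lemma parabolic_axis_op i : nrm (axis_op P i) <= KH * M.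
Proof.
have r0 j : 0 <= rho j by exact/ltW/rho_gt0.
apply: le_trans (axis_op_le r0 nu_ge0 i) _.
apply: le_trans (nrmD _ _) _; rewrite mulrDl; apply: lerD.
  apply: le_trans (nrmD _ _) _; rewrite mulrDl mul1r lerD2l nrmM normrN1 mul1r.
  apply: (@le_trans _ _ (cm * nrm V)); last first.
    by rewrite -mulrA ler_wpM2l// parabolic_nrm.
  apply: nrm_bounded => // t; rewrite normrM ler_wpM2r//.
  by have /andP[? ?] := c_bound t; rewrite ger0_norm.
apply: le_trans (nrm_sum _ _) _; rewrite big_distrl; apply: ler_sum => j _ /=.
by rewrite nrmM parabolic_cen.
Qed.

Lemma parabolic_lap i : nrm (lap (D i) V) <= h i ^+ 2 * (KH * M) / eps.
Proof.
have h2 : 0 < h i ^+ 2 by rewrite exprn_gt0.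
have h1 := le_trans (rho_lap_le nu_ge0 i) (parabolic_axis_op i).
have := le_trans (ler_wpM2r (nrm_ge0 (lap (D i) V)) (rho_ge i)) h1.
by rewrite mulrAC ler_pdivrMr// ler_pdivlMr// (mulrC (h i ^+ 2)) (mulrC eps).
Qed.

(** Up to sign, the Laplacian of the transport-free flux [Z] is [axis_op], already bounded, so the
    trace inequality costs only len = L / h. In the transport part, be^2 ~ h^(-2) is outweighed by
    |lap V|^2 ~ h^4, and the surplus h^2 is bounded by L^2. *)
Lemma parabolic_flux i E x : along P i E -> x ^+ 2 = be i ^+ 2 ->
  face E (flux P x i) <= (16 * L i * KH ^+ 2 +
    4 * b i ^+ 2 * L i ^+ 3 * KH ^+ 2 / eps ^+ 2) * M ^+ 2 / h i.
Proof.
move=> iE xE.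
have nE : (len (D i))%:R = L i / h i by rewrite -hn mulrC mulKf// gt_eqF.
have vV := along_vanish iE (@aV_vanish _ _ P).
pose Z t := rho i * V t - nu i * lap (D i) V t.
have vZ : vanish E Z.
  move=> t wt; rewrite /Z vV// /lap -(along_wall _ iE) wt; ring.
have face2 f : vanish E f -> face E f <= 8 * (L i / h i) * nrm (lap E f) ^+ 2.
  move=> vf; apply: le_trans (face_le vf) _.
  have := nrm_dif_lap vf; rewrite (along_len iE) nE => h1.
  have := ler_wpM2r (nrm_ge0 (lap E f)) h1.
  rewrite expr2; lra.
rewrite /face (eq_bigr (fun t => (Z (fwd E t) + x * V (fwd E t)) ^+ 2))//.
apply: le_trans (faceD E Z (fun t => x * V t)) _; rewrite faceM xE.
have h1 : nrm (lap E Z) <= KH * M.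
  apply: le_trans (parabolic_axis_op i); apply: nrm_mono => t.
  rewrite (along_lap _ iE) (_ : lap (D i) Z t = -1 * axis_op P i t).
    by rewrite normrM normrN1 mul1r.
  by rewrite /axis_op /Z lap_lin; ring.
have h2 : nrm (lap E V) <= h i ^+ 2 * (KH * M) / eps.
  by rewrite (along_nrm_lap _ iE) parabolic_lap.
have s1 : nrm (lap E Z) ^+ 2 <= (KH * M) ^+ 2.
  by apply: sqr_le_sqr; rewrite ?nrm_ge0.
have s2 : nrm (lap E V) ^+ 2 <= (h i ^+ 2 * (KH * M) / eps) ^+ 2.
  by apply: sqr_le_sqr; rewrite ?nrm_ge0.
have q0 : 0 <= 8 * (L i / h i) by rewrite mulr_ge0// divr_ge0.
have f1 := le_trans (face2 _ vZ) (ler_wpM2l q0 s1).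
have f2 := le_trans (face2 _ vV) (ler_wpM2l q0 s2).
have f3 := ler_wpM2l (sqr_ge0 (be i)) f2.
have f4 : be i ^+ 2 * (8 * (L i / h i) * (h i ^+ 2 * (KH * M) / eps) ^+ 2) <=
    2 * b i ^+ 2 * L i ^+ 3 * KH ^+ 2 / eps ^+ 2 * M ^+ 2 / h i.
  have -> : be i ^+ 2 * (8 * (L i / h i) * (h i ^+ 2 * (KH * M) / eps) ^+ 2) =
     2 * b i ^+ 2 * L i * h i ^+ 2 * KH ^+ 2 / eps ^+ 2 * M ^+ 2 / h i.
    by rewrite beE; field; rewrite !gt_eqF.
  rewrite ler_pM2r ?invr_gt0// ler_wpM2r ?sqr_ge0//.
  rewrite ler_pM2r ?invr_gt0 ?exprn_gt0// ler_wpM2r ?sqr_ge0//.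
  have -> : 2 * b i ^+ 2 * L i ^+ 3 = 2 * b i ^+ 2 * L i * L i ^+ 2 by ring.
  apply: ler_wpM2l; last by apply: sqr_le_sqr => //; exact: step_le (hn i).
  by apply: mulr_ge0 => //; apply: mulr_ge0 => //; exact: sqr_ge0.
have -> : (16 * L i * KH ^+ 2 + 4 * b i ^+ 2 * L i ^+ 3 * KH ^+ 2 / eps ^+ 2) *
    M ^+ 2 / h i = 2 * (8 * (L i / h i) * (KH * M) ^+ 2) +
    2 * (2 * b i ^+ 2 * L i ^+ 3 * KH ^+ 2 / eps ^+ 2 * M ^+ 2 / h i).
  by field; rewrite !gt_eqF.
apply: lerD; rewrite ler_pM2l//.
exact: le_trans f4.
Qed.

Definition parabolic_const : R := KV + \sum_i (16 * L i * KH ^+ 2 +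
    4 * b i ^+ 2 * L i ^+ 3 * KH ^+ 2 / eps ^+ 2).

Lemma parabolic_bound : adjoint_bound P parabolic_const.
Proof.
have k0 i : 0 <= 16 * L i * KH ^+ 2 + 4 * b i ^+ 2 * L i ^+ 3 * KH ^+ 2 / eps ^+ 2.
  apply: addr_ge0; first by rewrite mulr_ge0 ?sqr_ge0// mulr_ge0.
  apply: divr_ge0; last exact: sqr_ge0.
  apply: mulr_ge0; last exact: sqr_ge0.
  apply: mulr_ge0; last exact: exprn_ge0.
  by apply: mulr_ge0 => //; exact: sqr_ge0.
split.
  apply: le_trans parabolic_nrm _; rewrite ler_wpM2r// lerDl sumr_ge0//.
move=> i E x iE xE; apply: le_trans (parabolic_flux iE xE) _.
rewrite ler_pM2r ?invr_gt0// ler_wpM2r ?sqr_ge0// /parabolic_const (bigD1 i)//=.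
rewrite addrCA lerDl addr_ge0 ?KV_ge0// sumr_ge0//.
Qed.

End BoundParabolic.

(** * Scalar inequalities closing the layer estimates *)

Section LayerArithmetic.
Context {R : realFieldType}.

(** Here a, s, e will be the rescaled norms of V, [dif V] and [lap V], the first two weighted. As
    tau <= 1/2, the bound on s^2 gives a^2 <= X + K1 N a / 2, and the last hypothesis, with s <= a +
    e, then becomes a quadratic inequality for a. *)
Lemma layer_arith (K1 K2 b mu N a s e X tau : R) :
  0 < b -> 0 <= K1 -> 0 <= K2 -> 0 <= mu -> 0 <= N ->
  0 <= a -> 0 <= s -> 0 <= e -> 0 <= tau -> tau <= 2^-1 -> e <= K1 * N ->
  s ^+ 2 <= 2 * (a * e) + a ^+ 2 ->
  2 * a ^+ 2 - tau ^+ 2 * s ^+ 2 <= X ->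
  b / 4 * X <= (1 + tau) * (K2 * N ^+ 2 + mu * (e ^+ 2 + 2 * (e * s) + 2 * (e * a))) ->
  a <= (1 + 6 / b * (K2 + 3 * mu * K1 ^+ 2) + (K1 / 2 + 24 * mu * K1 / b)) * N.
Proof.
move=> b0 k1 k2 mu0 N0 a0 s0 e0 t0 t1 eN h1 h2 h3.
have sae : s <= a + e by apply: le_of_sqr_le; [lra | nra].
have t2 : tau ^+ 2 <= 4^-1 by nra.
have ea := mulr_ge0 e0 a0; have es := mulr_ge0 e0 s0.
have hes : e * s <= e * (a + e) by rewrite ler_wpM2l.
have e2 : e ^+ 2 <= K1 ^+ 2 * N ^+ 2 by rewrite -exprMn; exact: sqr_le_sqr.
have hea : e * a <= K1 * N * a by rewrite ler_wpM2r.
have S0 : 0 <= K2 * N ^+ 2 + mu * (e ^+ 2 + 2 * (e * s) + 2 * (e * a)).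
  by rewrite addr_ge0 ?mulr_ge0 ?sqr_ge0// !addr_ge0 ?sqr_ge0// mulr_ge0.
have h5 : b / 4 * X <= 3 / 2 * (K2 * N ^+ 2 +
     mu * (3 * (K1 ^+ 2 * N ^+ 2) + 4 * (K1 * N * a))).
  apply: (le_trans h3); apply: ler_pM => //; [lra | lra |].
  rewrite lerD2l ler_wpM2l//; lra.
have h6 : a ^+ 2 <= X + K1 * N * a / 2 by nra.
have h7 : X <= 6 / b * (K2 * N ^+ 2 +
     mu * (3 * (K1 ^+ 2 * N ^+ 2) + 4 * (K1 * N * a))).
  rewrite -(ler_pM2l (_ : 0 < b / 4)) ?divr_gt0//; apply: le_trans h5 _.
  by rewrite le_eqVlt; apply/orP; left; apply/eqP; field; rewrite gt_eqF.
apply: quadratic_bound => //.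
- rewrite mulr_ge0 ?divr_ge0 ?(ltW b0)// addr_ge0// mulr_ge0// mulr_ge0//.
- by rewrite addr_ge0 ?divr_ge0 ?mulr_ge0 ?(ltW b0).
apply: (le_trans h6); apply: le_trans (lerD h7 (lexx _)) _.
by rewrite le_eqVlt; apply/orP; left; apply/eqP; field; rewrite gt_eqF.
Qed.

(** Young's inequality absorbs v z into mu z^2 / 2; the remaining v^2 is linear in z by hypothesis,
    so [quadratic_bound] applies. *)
Lemma interior_arith (K1 K4 K b mu lam N z v : R) :
  0 <= b -> 0 <= K1 -> 0 <= K4 -> 0 <= K -> 0 < mu -> 0 <= lam -> 0 <= N ->
  0 <= z -> 0 <= v -> v ^+ 2 <= K1 * N * z ->
  mu * z ^+ 2 <= z * K * lam * N + b * (4 * (v * z) + K4 * N ^+ 2) ->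
  z <= (1 + 2 / mu * (b * K4) + 2 / mu * (K * lam + 8 * b ^+ 2 * K1 / mu)) * N.
Proof.
move=> b0 k1 k4 k mu0 l0 N0 z0 v0 h1 h2.
apply: quadratic_bound => //.
- by rewrite mulr_ge0 ?divr_ge0 ?mulr_ge0 ?(ltW mu0).
- apply: mulr_ge0; first by rewrite divr_ge0 ?(ltW mu0).
  by rewrite addr_ge0 ?divr_ge0 ?mulr_ge0 ?sqr_ge0 ?(ltW mu0).
have h3 : 4 * b * (v * z) <= mu / 2 * z ^+ 2 + 8 * b ^+ 2 / mu * (K1 * N * z).
  apply: (@le_trans _ _ (mu / 2 * z ^+ 2 + 8 * b ^+ 2 / mu * v ^+ 2)).
    have := sqr_ge0 (mu * z - 4 * b * v) => h.
    have : 0 <= (2 * mu)^-1 * (mu * z - 4 * b * v) ^+ 2.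
      by rewrite mulr_ge0// invr_ge0 mulr_ge0// ltW.
    have -> : (2 * mu)^-1 * (mu * z - 4 * b * v) ^+ 2 = mu / 2 * z ^+ 2
        + 8 * b ^+ 2 / mu * v ^+ 2 - 4 * b * (v * z) by field; rewrite gt_eqF.
    by rewrite subr_ge0.
  rewrite lerD2l ler_wpM2l// divr_ge0 ?mulr_ge0 ?sqr_ge0// ltW//.
have h4 : mu / 2 * z ^+ 2 <= z * K * lam * N + b * K4 * N ^+ 2 +
    8 * b ^+ 2 / mu * (K1 * N * z) by lra.
rewrite -(ler_pM2l (_ : 0 < mu / 2)) ?divr_gt0//; apply: (le_trans h4).
by rewrite le_eqVlt; apply/orP; left; apply/eqP; field; rewrite gt_eqF.
Qed.

End LayerArithmetic.

(** * The case eps = 0 and c bounded below: energy, then pure transport *)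

Section Degenerate.
Context {R : rcfType} {d : nat}.
Variables (L b : 'I_d -> R) (sigma c0 cm : R).
Hypotheses (L_gt0 : forall i, 0 < L i) (sigma_ge0 : 0 <= sigma) (c0_gt0 : 0 < c0)
  (cm_ge0 : 0 <= cm).
Variable P : adjoint R d.
Local Notation D := (@adir _ _ P).
Local Notation V := (@aV _ _ P).
Local Notation u := (@au _ _ P).
Local Notation h := (@ah _ _ P).
Local Notation rho := (@arho _ _ P).
Local Notation nu := (@anu _ _ P).
Local Notation be := (@abe _ _ P).
Local Notation c := (@ac _ _ P).
Local Notation M := (nrm (@au _ _ P)).
Hypotheses (h_gt0 : forall i, 0 < h i)
  (hn : forall i, h i * (len (D i))%:R = L i)
  (rhoE : forall i, rho i = sigma) (nu_ge0 : forall i, 0 <= nu i)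
  (beE : forall i, be i = b i / (2 * h i)) (c_bound : forall t, c0 <= c t <= cm).

Let L_ge0 i : 0 <= L i. Proof. exact: ltW. Qed.
Let h_ge0 i : 0 <= h i. Proof. exact: ltW. Qed.
Let c0_ge0 : 0 <= c0. Proof. exact: ltW. Qed.
Let V_ge0 : 0 <= nrm V. Proof. exact: nrm_ge0. Qed.
Let M_ge0 : 0 <= M. Proof. exact: nrm_ge0. Qed.
#[local] Hint Resolve L_ge0 h_ge0 c0_ge0 V_ge0 M_ge0 : core.

Lemma degenerate_energy :
  \sum_i nu i * nrm (lap (D i) V) ^+ 2 + c0 * nrm V ^+ 2 <= nrm V * M.
Proof.
apply: le_trans (dot_le _ _); rewrite -(adjoint_energy P).
apply: lerD; last by apply: dot_mass_ge => t; have /andP[] := c_bound t.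
by apply: ler_sum => i _; rewrite lerDr rhoE mulr_ge0// sqr_ge0.
Qed.

Lemma degenerate_nrm : nrm V <= M / c0.
Proof.
have h1 : c0 * nrm V ^+ 2 <= nrm V * M.
  apply: le_trans degenerate_energy; rewrite lerDr sumr_ge0// => i _.
  by apply: mulr_ge0 => //; exact: sqr_ge0.
rewrite ler_pdivlMr// mulrC; move: V_ge0; rewrite le_eqVlt => /predU1P[<-|V0].
  by rewrite mulr0.
by rewrite -(ler_pM2l V0) mulrCA -expr2.
Qed.

Lemma degenerate_lap : \sum_i nu i * nrm (lap (D i) V) ^+ 2 <= M ^+ 2 / c0.
Proof.
apply: (@le_trans _ _ (nrm V * M)).
  by apply: le_trans degenerate_energy; rewrite lerDl mulr_ge0// sqr_ge0.
by rewrite expr2 mulrAC ler_wpM2r// degenerate_nrm.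
Qed.

Lemma degenerate_lap_axis i : nu i * nrm (lap (D i) V) ^+ 2 <= M ^+ 2 / c0.
Proof.
apply: le_trans degenerate_lap; rewrite (bigD1 i)//= lerDl sumr_ge0// => j _.
by apply: mulr_ge0 => //; exact: sqr_ge0.
Qed.

(** The sigma term may be moved to the right-hand side: it carries no negative power of h, and [lap]
    has norm at most 4 on every mesh. *)
Definition residual t := u t + -1 * (c t * V t) + sigma * \sum_j lap (D j) V t.

Definition KF : R := 1 + cm / c0 + sigma * (4 * d%:R / c0).

Lemma KF_ge0 : 0 <= KF.
Proof.
apply: addr_ge0; first by apply: addr_ge0 => //; exact: divr_ge0.
by apply: mulr_ge0 => //; apply: divr_ge0 => //; exact: mulr_ge0.
Qed.

Lemma nrm_residual : nrm residual <= KF * M.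
Proof.
apply: le_trans (nrmD _ _) _; rewrite /KF mulrDl; apply: lerD.
  apply: le_trans (nrmD _ _) _; rewrite mulrDl mul1r lerD2l nrmM normrN1 mul1r.
  apply: (@le_trans _ _ (cm * nrm V)); last first.
    by rewrite mulrAC -mulrA ler_wpM2l// degenerate_nrm.
  apply: nrm_bounded => // t; rewrite normrM ler_wpM2r//.
  have /andP[c1 ?] := c_bound t; rewrite ger0_norm//; exact: le_trans c1.
rewrite nrmM ger0_norm// -mulrA ler_wpM2l//.
apply: le_trans (nrm_sum _ _) _.
apply: (@le_trans _ _ (\sum_(j < d) 4 * (M / c0))).
  apply: ler_sum => j _; apply: le_trans (nrm_lap_le _ _) _.
  by rewrite ler_wpM2l// degenerate_nrm.
rewrite sumr_const card_ord -mulr_natl; rewrite le_eqVlt; apply/orP; left; apply/eqP; ring.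
Qed.

Lemma degenerate_weak f : vanish_all f ->
  \sum_j (nu j * dot f (lap (D j) (lap (D j) V)) - be j * dot f (cen (D j) V))
  = dot f residual.
Proof.
move=> vf; rewrite /residual !dotDr !dotZr dot_sumr -(adjoint_weak vf).
rewrite mulN1r addrK big_distrr -big_split; apply: eq_bigr => j _ /=.
by rewrite rhoE; ring.
Qed.

Lemma face_V_le i E : along P i E -> face E V <= M ^+ 2 / c0 ^+ 2.
Proof.
move=> iE; apply: le_trans (face_le_nrm _ _) _; rewrite -exprVn -exprMn.
by apply: sqr_le_sqr => //; exact: degenerate_nrm.
Qed.

Definition KB i : R := 2 * (2 / c0 ^+ 2 + 4 * L i * KF / (`|b i| * c0)) / L i.

(** The norm of [hop] grows like len and [be i] like 1 / h, so their quotient stays bounded in terms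
    of L / |b|; the factor len - 1 in [face_hop] then yields the gain h, which compensates one of
    the two powers of 1 / h in be^2. *)
Lemma hop_face i E : along P i E -> b i != 0 -> (forall j, nu j = 0) ->
  face E V <= KB i * h i * M ^+ 2.
Proof.
move=> iE b0 nu0; have h0 := h_gt0 i.
have vV := along_vanish iE (@aV_vanish _ _ P).
have vhop : vanish_all (hop E V).
  move=> j; have [->|ij] := eqVneq j i.
    by move=> t wt; apply: vanish_hop; rewrite (along_wall _ iE).
  apply: vanish_hop_indep; last exact: avanish.
  exact/indep_sym/(along_indep iE).
have e := degenerate_weak vhop.
rewrite (bigD1 i)//= big1 in e; last first.
  move=> j ij; rewrite nu0 (dot_hop_cen_indep (along_indep iE ij)).
  by rewrite mul0r mulr0 subr0.
rewrite nu0 mul0r sub0r addr0 in e.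
have h1 : `|be i| * `|dot (hop E V) (cen E V)| <=
    2 * (len (D i))%:R * (M / c0) * (KF * M).
  rewrite (along_dot_cen _ _ iE) -normrM -normrN e.
  apply: le_trans (norm_dot_le _ _) _; apply: ler_pM; rewrite ?nrm_ge0//.
    apply: le_trans (nrm_hop _ _) _; rewrite (along_len iE) ler_wpM2l//.
    exact: degenerate_nrm.
  exact: nrm_residual.
have h2 := face_hop vV; rewrite (along_len iE) in h2.
pose k1 := 4 * L i * KF / (`|b i| * c0).
have h3 : `|dot (hop E V) (cen E V)| <= k1 * M ^+ 2.
  have bi : 0 < `|b i| by rewrite normr_gt0.
  have bei : 0 < `|be i| by rewrite beE normrM mulr_gt0// normr_gt0 invr_neq0// gt_eqF// mulr_gt0.
  rewrite -(ler_pM2l bei) (le_trans h1)// /k1 -hn beE normrM normfV normrM normr_nat.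
  rewrite (gtr0_norm h0) le_eqVlt; apply/orP; left; apply/eqP.
  by field; rewrite !gt_eqF.
have h4 : nrm V ^+ 2 <= M ^+ 2 / c0 ^+ 2.
  by rewrite -exprVn -exprMn; apply: sqr_le_sqr => //; exact: degenerate_nrm.
(* Used to replace len by 2 (len - 1). *)
have n2 : 2 <= (len (D i))%:R :> R by rewrite ler_nat len_gt1.
have f0 := face_ge0 E V.
have h5 : (len (D i))%:R * face E V <=
    2 * (2 / c0 ^+ 2 + k1) * M ^+ 2.
  have : (len (D i))%:R * face E V <= 2 * (((len (D i))%:R - 1) * face E V) by nra.
  by move: h2 h3 h4; move: k1 (dot _ _) => a2 a3; lra.
have nE : (len (D i))%:R = L i / h i by rewrite -hn mulrC mulKf// gt_eqF.
rewrite -(ler_pM2l (_ : 0 < L i / h i)) ?divr_gt0// -nE (le_trans h5)// nE.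
rewrite le_eqVlt; apply/orP; left; apply/eqP; rewrite /KB /k1.
by field; rewrite !gt_eqF//= normr_gt0.
Qed.

Lemma hop_flux i E x : along P i E -> (forall j, nu j = 0) -> x ^+ 2 = be i ^+ 2 ->
  face E (flux P x i) <= (2 * sigma ^+ 2 / c0 ^+ 2 * L i + b i ^+ 2 * KB i / 2) *
    M ^+ 2 / h i.
Proof.
move=> iE nu0 xE.
have -> : face E (flux P x i) = face E (fun t => (sigma + x) * V t).
  by apply: eq_bigr => t _; rewrite /flux rhoE nu0; congr (_ ^+ 2); ring.
rewrite faceM; have f0 := face_ge0 E V.
have h1 : (sigma + x) ^+ 2 * face E V <= 2 * (sigma ^+ 2 * face E V) +
    2 * (be i ^+ 2 * face E V).
  by rewrite -xE; have := mulr_ge0 (sqr_ge0 (sigma - x)) f0; lra.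
apply: le_trans h1 _; set A := _ * L i; set B := _ / 2.
rewrite (_ : (A + B) * M ^+ 2 / h i = A * M ^+ 2 / h i + B * M ^+ 2 / h i); last by ring.
rewrite /A /B; apply: lerD.
  have := ler_wpM2l (sqr_ge0 sigma) (face_V_le iE).
  (* The sigma part has no singular factor; L / h >= 1 is inserted to reach the common form of the
     bound. *)
  have : 1 <= L i / h i by rewrite ler_pdivlMr// mul1r (step_le _ (hn i)).
  move=> l1 f1.
  apply: (@le_trans _ _ (2 * (sigma ^+ 2 * (M ^+ 2 / c0 ^+ 2)) * 1)).
    by rewrite mulr1 ler_wpM2l.
  apply: (@le_trans _ _ (2 * (sigma ^+ 2 * (M ^+ 2 / c0 ^+ 2)) * (L i / h i))).
    apply: ler_wpM2l => //; apply: mulr_ge0 => //; apply: mulr_ge0; first exact: sqr_ge0.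
    by apply: divr_ge0; exact: sqr_ge0.
  by rewrite le_eqVlt; apply/orP; left; apply/eqP; field; rewrite !gt_eqF.
have [b0|b0] := eqVneq (b i) 0.
  by rewrite beE b0 !mul0r expr0n /= !mul0r mulr0.
have := ler_wpM2l (sqr_ge0 (be i)) (hop_face iE b0 nu0) => f1.
apply: (@le_trans _ _ (2 * (be i ^+ 2 * (KB i * h i * M ^+ 2)))).
  by rewrite ler_wpM2l.
by rewrite le_eqVlt; apply/orP; left; apply/eqP; rewrite beE; field; rewrite !gt_eqF.
Qed.

Definition hop_const : R :=
  c0^-1 + \sum_i (2 * sigma ^+ 2 / c0 ^+ 2 * L i + b i ^+ 2 * KB i / 2).

Lemma hop_bound : (forall j, nu j = 0) -> adjoint_bound P hop_const.
Proof.
move=> nu0; have kf := KF_ge0.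
have k0 i : 0 <= 2 * sigma ^+ 2 / c0 ^+ 2 * L i + b i ^+ 2 * KB i / 2.
  apply: addr_ge0.
    apply: mulr_ge0 => //; apply: divr_ge0; last exact: sqr_ge0.
    by apply: mulr_ge0 => //; exact: sqr_ge0.
  apply: divr_ge0 => //; apply: mulr_ge0; first exact: sqr_ge0.
  apply: divr_ge0 => //; apply: mulr_ge0 => //; apply: addr_ge0.
    by apply: divr_ge0 => //; exact: sqr_ge0.
  by apply: divr_ge0; [rewrite !mulr_ge0 | rewrite mulr_ge0].
split.
  apply: le_trans degenerate_nrm _; rewrite mulrC ler_wpM2r// lerDl.
  by apply: sumr_ge0 => i _; exact: k0.
move=> i E x iE xE; apply: le_trans (hop_flux iE nu0 xE) _.
rewrite ler_pM2r ?invr_gt0// ler_wpM2r ?sqr_ge0// /hop_const (bigD1 i)//=.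
rewrite addrCA lerDl; apply: addr_ge0; first by rewrite invr_ge0.
by apply: sumr_ge0 => j _; exact: k0.
Qed.

(** * The case eps = 0 and gamma positive: the numerical boundary layer *)

Variables (mu lam tau : 'I_d -> R).
Hypotheses (mu_gt0 : forall i, 0 < mu i) (tau_gt0 : forall i, 0 < tau i)
  (tau_le : forall i, tau i <= 2^-1) (h_tau : forall i, h i / tau i <= lam i)
  (nuE : forall i, nu i * (h i * tau i ^+ 3) = mu i).

Let mu_ge0 i : 0 <= mu i. Proof. exact: ltW. Qed.
Let tau_ge0 i : 0 <= tau i. Proof. exact: ltW. Qed.
#[local] Hint Resolve mu_ge0 tau_ge0 : core.

(* [om ^ 2] is the ratio of the mesh size to the width of the numerical
   boundary layer. *)
Definition om i : R := Num.sqrt (tau i).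
(** In these units each difference along axis i costs om^2. The weighted norms of V and [dif V] and
    the norms of [lap V] and [lap (lap V)] have sizes N / om, om N, om^3 N and om^7 N; the faces of
    V and [lap V] have sizes om^4 N^2 and om^12 N^2. The size of [lap V] is dictated by the energy,
    as nu = mu / (h om^6). *)
Definition N i : R := Num.sqrt (h i) * M.

Let om_gt0 i : 0 < om i. Proof. by rewrite sqrtr_gt0. Qed.
Let omE i : om i ^+ 2 = tau i. Proof. by rewrite sqr_sqrtr. Qed.
Let N_ge0 i : 0 <= N i. Proof. by rewrite mulr_ge0// sqrtr_ge0. Qed.
Let NE i : N i ^+ 2 = h i * M ^+ 2. Proof. by rewrite /N exprMn sqr_sqrtr. Qed.
#[local] Hint Resolve N_ge0 : core.

Lemma lam_gt0 i : 0 < lam i.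
Proof. by apply: lt_le_trans (h_tau i); rewrite divr_gt0. Qed.

Lemma nu_om i : nu i = mu i / (h i * om i ^+ 6).
Proof.
rewrite -nuE (_ : om i ^+ 6 = tau i ^+ 3); last by rewrite -omE -exprM.
by field; rewrite !gt_eqF.
Qed.

Definition K1 i : R := 1 + (mu i * c0)^-1.

Lemma K1_ge0 i : 0 <= K1 i.
Proof. by rewrite addr_ge0// invr_ge0 mulr_ge0. Qed.
#[local] Hint Resolve K1_ge0 : core.

Lemma layer_lap i : nrm (lap (D i) V) <= om i ^+ 3 * (K1 i * N i).
Proof.
apply: le_of_sqr_le; first by rewrite mulr_ge0 ?mulr_ge0 ?exprn_ge0// ltW.
have := degenerate_lap_axis i; rewrite nu_om -(ler_pM2l (_ : 0 < h i * om i ^+ 6 / mu i)).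
  have -> : h i * om i ^+ 6 / mu i * (mu i / (h i * om i ^+ 6) *
    nrm (lap (D i) V) ^+ 2) = nrm (lap (D i) V) ^+ 2 by field; rewrite !gt_eqF.
  move=> /le_trans; apply.
  have -> : h i * om i ^+ 6 / mu i * (M ^+ 2 / c0) =
     om i ^+ 6 * N i ^+ 2 * (mu i * c0)^-1 by rewrite NE; field; rewrite !gt_eqF.
  have -> : (om i ^+ 3 * (K1 i * N i)) ^+ 2 = om i ^+ 6 * N i ^+ 2 * K1 i ^+ 2.
    by ring.
  apply: ler_wpM2l; first by rewrite mulr_ge0 ?sqr_ge0// exprn_ge0// ltW.
  have : 0 <= (mu i * c0)^-1 by rewrite invr_ge0 mulr_ge0.
  by rewrite /K1; move: (_^-1) => k k0; nra.
by rewrite divr_gt0// mulr_gt0// exprn_gt0.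
Qed.

Definition K2 : R := KF / c0 + c0^-1.
Definition K3 i : R := 1 + 6 / `|b i| * (K2 + 3 * mu i * K1 i ^+ 2) +
  (K1 i / 2 + 24 * mu i * K1 i / `|b i|).

Lemma K2_ge0 : 0 <= K2.
Proof. by rewrite addr_ge0 ?invr_ge0// divr_ge0// KF_ge0. Qed.

Lemma K3_ge0 i : 0 <= K3 i.
Proof.
have k2 := K2_ge0; have k1 := K1_ge0 i; apply: addr_ge0.
  apply: addr_ge0 => //; apply: mulr_ge0; first by rewrite divr_ge0.
  by apply: addr_ge0 => //; apply: mulr_ge0; [exact: mulr_ge0 | exact: sqr_ge0].
by apply: addr_ge0; apply: divr_ge0 => //; apply: mulr_ge0 => //; exact: mulr_ge0.
Qed.

Let th i : R := (1 + tau i)^-1.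
Let thE i : th i * (1 + tau i) = 1.
Proof. by rewrite mulVf// gt_eqF// ltr_wpDl. Qed.

(** The weight is constant along the other axes, so their transport terms vanish and their moments
    become weighted squares. As [be i] may have either sign, these squares are not discarded but
    bounded by the energy. *)
Lemma layer_test i E : along P i E ->
  `|be i| * `|dot (fun t => expw E (th i) t * V t) (cen E V)| <=
  K2 * M ^+ 2 + nu i * (nrm (lap E V) ^+ 2 + tau i * nrm (lap E V) *
    (2 * wnrm E (th i) (dif E V) + 2 * tau i * wnrm E (th i) V)).
Proof.
move=> iE; have vV := along_vanish iE (@aV_vanish _ _ P).
pose f t := expw E (th i) t * V t.
have vf : vanish_all f by move=> j t wt; rewrite /f (@aV_vanish _ _ P j t wt) mulr0.
have e := degenerate_weak vf; rewrite (bigD1 i)//= in e.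
have w0 t : 0 <= expw E (th i) t <= 1.
  by rewrite (ltW (expw_gt0 _ (tau_gt0 i) (thE i) _)) (expw_le1 _ (tau_gt0 i) (thE i)).
have h1 : \sum_(j | j != i) (nu j * dot f (lap (D j) (lap (D j) V)) -
    be j * dot f (cen (D j) V)) = \sum_(j | j != i) nu j *
    \sum_t expw E (th i) t * lap (D j) V t ^+ 2.
  apply: eq_bigr => j ij; have ind := along_indep iE ij.
  have wj t : expw E (th i) (fwd (D j) t) = expw E (th i) t.
    by rewrite /expw (pos_fwd_indep ind).
  rewrite (dot_weight_cen _ wj) (dot_weight_lap2 wj); last exact: avanish.
  by rewrite mulr0 subr0.
set S := \sum_(j | j != i) nu j * _ in h1.
have S_ge0 : 0 <= S.
  apply: sumr_ge0 => j _; apply: mulr_ge0 => //; apply: sumr_ge0 => t _.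
  by apply: mulr_ge0; [case/andP: (w0 t) | exact: sqr_ge0].
have S_le : S <= M ^+ 2 / c0.
  apply: le_trans degenerate_lap; rewrite [leRHS](bigD1 i)//= -[S]add0r; apply: lerD.
    by apply: mulr_ge0 => //; exact: sqr_ge0.
  apply: ler_sum => j _; rewrite ler_wpM2l// nrm_sqE; apply: ler_sum => t _.
  by rewrite ler_piMl ?sqr_ge0//; case/andP: (w0 t).
have R_le : `|dot f residual| <= KF / c0 * M ^+ 2.
  apply: le_trans (norm_dot_le _ _) _.
  rewrite [leRHS](_ : _ = M / c0 * (KF * M)); last by ring.
  apply: ler_pM; rewrite ?nrm_ge0 ?nrm_residual//.
  apply: le_trans degenerate_nrm; apply: nrm_mono => t.
  have /andP[w1 w2] := w0 t.
  by rewrite normrM ger0_norm// ler_piMl.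
have L_le := dot_wV_lap2 (tau_gt0 i) (tau_le i) (thE i) vV.
rewrite (eq_dot (fun=> erefl) (along_lap2 V iE)) -/f in L_le.
rewrite (along_dot_cen _ _ iE) -normrM -/f.
have -> : be i * dot f (cen (D i) V) =
   nu i * dot f (lap (D i) (lap (D i) V)) + (S - dot f residual).
  by rewrite -e h1; ring.
apply: le_trans (ler_normD _ _) _; rewrite addrC; apply: lerD.
  apply: le_trans (ler_normB _ _) _; rewrite ger0_norm// addrC.
  by rewrite /K2 mulrDl (mulrC c0^-1); apply: lerD.
by rewrite normrM ger0_norm// ler_wpM2l.
Qed.

Lemma layer_wnrm i E : along P i E -> b i != 0 ->
  wnrm E (th i) V <= K3 i * N i / om i /\
  wnrm E (th i) (dif E V) <= om i * ((K3 i + K1 i) * N i).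
Proof.
move=> iE bi; have h0 := h_gt0 i.
have vV := along_vanish iE (@aV_vanish _ _ P).
have t0 := tau_gt0 i; have t1 := tau_le i.
have b0 : 0 < `|b i| by rewrite normr_gt0.
pose a := om i * wnrm E (th i) V; pose s := wnrm E (th i) (dif E V) / om i.
pose e := nrm (lap E V) / om i ^+ 3.
have a0 : 0 <= a by rewrite mulr_ge0 ?wnrm_ge0// ltW.
have s0 : 0 <= s by rewrite divr_ge0 ?wnrm_ge0// ltW.
have e0 : 0 <= e by rewrite divr_ge0 ?nrm_ge0// exprn_ge0// ltW.
have qE : wnrm E (th i) V = a / om i by rewrite /a; field; rewrite gt_eqF.
have yE : wnrm E (th i) (dif E V) = om i * s by rewrite /s; field; rewrite gt_eqF.
have lE : nrm (lap E V) = om i ^+ 3 * e by rewrite /e; field; rewrite gt_eqF.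
have tE := omE i.
have eN : e <= K1 i * N i.
  by rewrite /e ler_pdivrMr ?exprn_gt0// mulrC (along_nrm_lap _ iE) layer_lap.
have o2 : 0 < om i ^+ 2 by rewrite exprn_gt0.
have h1 : s ^+ 2 <= 2 * (a * e) + a ^+ 2.
  have := wnrm_dif t0 (thE i) vV; rewrite qE yE lE -tE -(ler_pM2l o2).
  have -> : om i ^+ 2 * (2 * (a / om i * (om i ^+ 3 * e)) +
      (om i ^+ 2) ^+ 2 * (a / om i) ^+ 2) = (om i ^+ 2) ^+ 2 * (2 * (a * e) + a ^+ 2).
    by field; rewrite gt_eqF.
  have -> : om i ^+ 2 * (om i * s) ^+ 2 = (om i ^+ 2) ^+ 2 * s ^+ 2 by ring.
  by rewrite ler_pM2l// exprn_gt0.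
pose z := \sum_t expw E (th i) t * (V t * V (fwd E t)).
have zE := wdot_fwd t0 (thE i) vV; rewrite -/z in zE.
pose X := 2 * om i ^+ 2 * z.
have XE : X = (2 + om i ^+ 2) * a ^+ 2 - om i ^+ 4 * s ^+ 2.
  rewrite /X (_ : 2 * om i ^+ 2 * z = om i ^+ 2 * (2 * z)); last by ring.
  by rewrite zE qE yE -tE; field; rewrite gt_eqF.
have h2 : 2 * a ^+ 2 - tau i ^+ 2 * s ^+ 2 <= X.
  rewrite XE -tE -exprM mulrDl.
  by have := mulr_ge0 (ltW o2) (sqr_ge0 a); lra.
have h3 : `|b i| / 4 * X <= (1 + tau i) *
    (K2 * N i ^+ 2 + mu i * (e ^+ 2 + 2 * (e * s) + 2 * (e * a))).
  have := layer_test iE; rewrite (dot_wV_cen (thE i) vV) -/z qE yE lE.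
  rewrite beE normrM normfV normrM normr_nat (gtr0_norm h0) nu_om -tE.
  move=> h3.
  have h4 : `|b i| / (2 * h i) * (om i ^+ 2 * th i * z) <= K2 * M ^+ 2 +
      mu i / (h i * om i ^+ 6) * ((om i ^+ 3 * e) ^+ 2 + om i ^+ 2 *
      (om i ^+ 3 * e) * (2 * (om i * s) + 2 * om i ^+ 2 * (a / om i))).
    apply: le_trans h3; apply: ler_wpM2l; last exact: ler_norm.
    by rewrite divr_ge0// mulr_ge0.
  (* This factor clears h from [be i] and [nu i], and 1 + tau cancels [th i]. *)
  have := ler_wpM2l (_ : 0 <= h i * (1 + tau i)) h4.
  rewrite mulr_ge0// ?addr_ge0// => /(_ isT).
  have -> : h i * (1 + tau i) * (`|b i| / (2 * h i) * (om i ^+ 2 * th i * z)) =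
      th i * (1 + tau i) * (`|b i| / 4 * X).
    by rewrite /X; field; rewrite gt_eqF.
  rewrite thE mul1r NE -tE.
  move=> /le_trans; apply; rewrite le_eqVlt; apply/orP; left; apply/eqP.
  by field; rewrite !gt_eqF.
have hK := layer_arith b0 (K1_ge0 i) K2_ge0 (mu_ge0 i) (N_ge0 i) a0 s0 e0
  (tau_ge0 i) t1 eN h1 h2 h3.
split; first by rewrite qE ler_pM2r ?invr_gt0.
rewrite yE ler_pM2l// mulrDl.
apply: le_trans (lerD hK eN).
by apply: le_of_sqr_le; [exact: addr_ge0 | nra].
Qed.

(** A mesh-independent lower bound for the jump th - th^len in [face_exp]: th >= 2/3 because tau <=
    1/2, and th^(len - 1) stays away from 1 by Bernoulli's inequality, since len tau >= L / lam and
    len <= 2 (len - 1). *)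
Definition kap i : R := 2 / 3 * (1 - (1 + L i / (2 * lam i))^-1).
Definition K4 i : R := ((K3 i + K1 i) ^+ 2 + 2 * K1 i * (K3 i + K1 i)) / kap i.

Lemma kap_gt0 i : 0 < kap i.
Proof.
have l0 := lam_gt0 i; rewrite mulr_gt0// subr_gt0 invf_lt1.
  by rewrite ltrDl divr_gt0// mulr_gt0.
by rewrite addr_gt0// divr_gt0// mulr_gt0.
Qed.

Lemma kap_le i E : along P i E -> kap i <= th i - th i ^+ len E.
Proof.
move=> iE; have l0 := lam_gt0 i; have t0 := tau_gt0 i.
have th0 : 0 < th i := th_gt0 t0 (thE i).
have nE := ltn_predK (len_gt1 E); set m := (len E).-1 in nE.
have m1 : (0 < m)%N by rewrite -ltnS nE len_gt1.
have mn : (len E)%:R <= 2 * m%:R :> R.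
  by rewrite -natrM ler_nat -nE mul2n -addnn -addn1 leq_add2l.
have h1 : 1 + L i / (2 * lam i) <= (1 + tau i) ^+ m.
  apply: (@le_trans _ _ (1 + m%:R * tau i)); last first.
    elim: (m) => [|k IH]; first by rewrite mul0r addr0 expr0.
    rewrite exprSr -natr1; have k0 : 0 <= k%:R * tau i ^+ 2 by rewrite mulr_ge0 ?sqr_ge0.
    have := ler_wpM2r (_ : 0 <= 1 + tau i) IH; rewrite addr_ge0// => /(_ isT).
    by nra.
  rewrite lerD2l ler_pdivrMr ?mulr_gt0// -hn -(along_len iE).
  have := h_tau i; rewrite ler_pdivrMr// => h2.
  apply: (@le_trans _ _ (lam i * tau i * (2 * m%:R))); last by lra.
  by apply: ler_pM.
have hth : th i ^+ m * (1 + tau i) ^+ m = 1 by rewrite -exprMn thE expr1n.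
have p0 : 0 < (1 + tau i) ^+ m by rewrite exprn_gt0// addr_gt0.
have l1 : 0 < 1 + L i / (2 * lam i) by rewrite addr_gt0// divr_gt0// mulr_gt0.
have h2 : th i ^+ m <= (1 + L i / (2 * lam i))^-1.
  by rewrite -(ler_pM2r p0) hth mulrC ler_pdivlMr// mul1r.
have th1 : 2 / 3 <= th i.
  have := thE i; rewrite mulrDr mulr1.
  have : th i * tau i <= th i * 2^-1 by rewrite ler_wpM2l// ltW.
  lra.
have -> : th i - th i ^+ len E = th i * (1 - th i ^+ m) by rewrite -nE exprS; ring.
apply: ler_pM => //; last by rewrite lerD2l lerN2.
by rewrite subr_ge0 invf_le1// lerDl divr_ge0// mulr_ge0// ltW.
Qed.

Lemma K4_ge0 i : 0 <= K4 i.
Proof.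
have k1 := K1_ge0 i; have k3 := K3_ge0 i.
apply: divr_ge0; last exact/ltW/kap_gt0.
by apply: addr_ge0; [exact: sqr_ge0 | rewrite mulr_ge0 ?mulr_ge0// addr_ge0].
Qed.

Lemma layer_face i E : along P i E -> b i != 0 ->
  face E V <= K4 i * N i ^+ 2 * om i ^+ 4.
Proof.
move=> iE bi; have [_ h2] := layer_wnrm iE bi; have k0 := kap_gt0 i.
have vV := along_vanish iE (@aV_vanish _ _ P); have tE := omE i.
have h1 := face_exp (tau_gt0 i) (thE i) vV.
have l1 : nrm (lap E V) <= om i ^+ 3 * (K1 i * N i).
  by rewrite (along_nrm_lap _ iE) layer_lap.
set y := wnrm _ _ _ in h1 h2; have y0 : 0 <= y by exact: wnrm_ge0.
have y2 : y ^+ 2 <= (om i * ((K3 i + K1 i) * N i)) ^+ 2 by exact: sqr_le_sqr.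
have ly : nrm (lap E V) * y <=
    om i ^+ 3 * (K1 i * N i) * (om i * ((K3 i + K1 i) * N i)).
  by apply: ler_pM; rewrite ?nrm_ge0.
have h3 : kap i * face E V <= om i ^+ 4 * N i ^+ 2 *
    ((K3 i + K1 i) ^+ 2 + 2 * K1 i * (K3 i + K1 i)).
  apply: le_trans (ler_wpM2r (face_ge0 _ _) (kap_le iE)) _; apply: (le_trans h1).
  have := ler_wpM2l (tau_ge0 i) y2; rewrite -tE; lra.
rewrite -(ler_pM2l k0); apply: (le_trans h3); rewrite /K4.
by rewrite le_eqVlt; apply/orP; left; apply/eqP; field; rewrite gt_eqF.
Qed.

Definition K5 i : R := 1 + 2 / mu i * (`|b i| * K4 i) +
  2 / mu i * (KF * (1 + lam i) + 8 * `|b i| ^+ 2 * K1 i / mu i).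

Lemma K5_ge0 i : 0 <= K5 i.
Proof.
have k1 := K1_ge0 i; have k4 := K4_ge0 i; have kf := KF_ge0.
have l0 := ltW (lam_gt0 i); have m0 : 0 <= 2 / mu i by rewrite divr_ge0.
apply: addr_ge0; first by rewrite addr_ge0// mulr_ge0// mulr_ge0.
apply: mulr_ge0 => //; apply: addr_ge0; first by rewrite mulr_ge0// addr_ge0.
by apply: divr_ge0 => //; rewrite mulr_ge0// mulr_ge0// sqr_ge0.
Qed.

Lemma sqrt_mul_le (p q e : R) : 0 <= p -> 0 <= q -> 0 < e ->
  Num.sqrt p * Num.sqrt q <= 2^-1 * (p / e ^+ 2 + q * e ^+ 2).
Proof.
move=> p0 q0 e0; have := sqr_ge0 (Num.sqrt p / e - Num.sqrt q * e) => h.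
have h2 : (Num.sqrt p / e - Num.sqrt q * e) ^+ 2 = p / e ^+ 2 + q * e ^+ 2 -
    2 * (Num.sqrt p * Num.sqrt q).
  move: (sqr_sqrtr p0) (sqr_sqrtr q0); move: (Num.sqrt p) (Num.sqrt q).
  by move=> x y <- <-; field; rewrite gt_eqF.
lra.
Qed.

(** The norm z of [lap (lap V)] is left free, because the estimate serves twice: to bound z in
    [layer_lap2], and then, with that bound, for the flux. *)
Lemma layer_face_lap i E (z := nrm (lap (D i) (lap (D i) V))) : along P i E ->
  face E (lap (D i) V) <= 4 * om i ^+ 5 *
    Num.sqrt (K1 i * N i * (z / om i ^+ 7)) * z.
Proof.
move=> iE; have o0 := om_gt0 i; have z0 : 0 <= z := nrm_ge0 _.
have vX : vanish E (lap (D i) V).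
  exact: (along_vanish iE (vanish_all_lap i (@aV_vanish _ _ P))).
apply: le_trans (face_le vX) _; rewrite (along_nrm_lap _ iE) -/z.
rewrite ler_wpM2r// -mulrA ler_wpM2l//.
have s0 : 0 <= K1 i * N i * (z / om i ^+ 7).
  apply: mulr_ge0; first exact: mulr_ge0.
  by rewrite divr_ge0// exprn_ge0// ltW.
apply: le_of_sqr_le.
  by apply: mulr_ge0; [exact/exprn_ge0/ltW | exact: sqrtr_ge0].
apply: le_trans (nrm_dif_interp vX) _; rewrite (along_nrm_lap _ iE) -/z.
rewrite exprMn sqr_sqrtr//.
apply: le_trans (ler_wpM2r z0 (layer_lap i)) _.
by rewrite le_eqVlt; apply/orP; left; apply/eqP; field; rewrite gt_eqF.
Qed.

(** After testing with lap_i^2 V, the other axes contribute nonnegative terms, and transport along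
    axis i reduces to face terms. These grow only like z^(3/2), so the quadratic left-hand side
    absorbs them. *)
Lemma layer_lap2 i : nrm (lap (D i) (lap (D i) V)) <= om i ^+ 7 * (K5 i * N i).
Proof.
set z := nrm _; have z0 : 0 <= z := nrm_ge0 _.
have o0 := om_gt0 i; have h0 := h_gt0 i; have m0 := mu_gt0 i.
have vi := @avanish _ _ P i.
pose f := lap (D i) (lap (D i) V).
have vf : vanish_all f.
  by apply: vanish_all_lap; apply: vanish_all_lap; exact: aV_vanish.
have e := degenerate_weak vf; rewrite (bigD1 i)//= -nrm_sq -/z in e.
have h1 : 0 <= \sum_(j | j != i) (nu j * dot f (lap (D j) (lap (D j) V)) -
    be j * dot f (cen (D j) V)).
  apply: sumr_ge0 => j ij; rewrite eq_sym in ij.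
  have ind := @aindep _ _ P _ _ ij.
  rewrite (dot_lap2_cen_indep ind vi) mulr0 subr0; apply: mulr_ge0 => //.
  by apply: dot_lap2_lap2_ge0 => //; exact: avanish.
have h2 : nu i * z ^+ 2 <= z * (KF * M) + `|be i| * `|dot f (cen (D i) V)|.
  have r1 : dot f residual <= z * (KF * M).
    apply: le_trans (dot_le _ _) _; rewrite -/z ler_wpM2l//.
    exact: nrm_residual.
  rewrite -normrM; have := ler_norm (be i * dot f (cen (D i) V)).
  by move: e h1 r1; move: (\sum_(j | _) _) => S; lra.
pose zh := z / om i ^+ 7; pose v := Num.sqrt (K1 i * N i * zh).
have zE : z = om i ^+ 7 * zh by rewrite /zh; field; rewrite gt_eqF.
have zh0 : 0 <= zh by rewrite divr_ge0// exprn_ge0// ltW.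
have v0 : 0 <= v by exact: sqrtr_ge0.
have s0 : 0 <= K1 i * N i * zh by apply: mulr_ge0 => //; exact: mulr_ge0.
have vE : v ^+ 2 = K1 i * N i * zh by rewrite sqr_sqrtr.
have h3 : `|be i| * `|dot f (cen (D i) V)| <=
    `|be i| * (2 * om i ^+ 8 * (4 * (v * zh) + K4 i * N i ^+ 2)).
  have [b0|b0] := eqVneq (b i) 0; first by rewrite beE b0 mul0r normr0 !mul0r.
  rewrite ler_wpM2l//; apply: le_trans (norm_dot_lap2_cen vi) _.
  have side E : along P i E -> Num.sqrt (face E (lap (D i) V)) * Num.sqrt (face E V)
      <= 2^-1 * (om i ^+ 8 * (4 * (v * zh) + K4 i * N i ^+ 2)).
    move=> iE; have o2 : 0 < om i ^+ 2 by rewrite exprn_gt0.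
    (* The two faces scale like om^12 and om^4; the parameter om^2 balances both terms at om^8. *)
    apply: le_trans (sqrt_mul_le (face_ge0 _ _) (face_ge0 _ _) o2) _.
    rewrite ler_wpM2l// mulrDr; apply: lerD.
      rewrite ler_pdivrMr ?exprn_gt0//; apply: le_trans (layer_face_lap iE) _.
      rewrite -/z -/zh -/v zE le_eqVlt; apply/orP; left; apply/eqP; ring.
    apply: le_trans (ler_wpM2r (sqr_ge0 _) (layer_face iE b0)) _.
    by rewrite le_eqVlt; apply/orP; left; apply/eqP; ring.
  have := side (D i) (or_introl erefl); have := side (rev (D i)) (or_intror erefl).
  lra.
have h4 : mu i * zh ^+ 2 <= zh * KF * (1 + lam i) * N i +
    `|b i| * (4 * (v * zh) + K4 i * N i ^+ 2).
  have h5 := le_trans h2 (lerD (lexx _) h3).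
  have := ler_wpM2l (_ : 0 <= h i / om i ^+ 8) h5.
  rewrite divr_ge0 ?exprn_ge0 ?(ltW o0)// => /(_ isT).
  rewrite mulrDr nu_om beE normrM normfV normrM normr_nat (gtr0_norm h0) zE.
  have -> : h i / om i ^+ 8 * (mu i / (h i * om i ^+ 6) * (om i ^+ 7 * zh) ^+ 2) =
    mu i * zh ^+ 2 by field; rewrite !gt_eqF.
  move=> /le_trans; apply; apply: lerD.
    have -> : h i / om i ^+ 8 * (om i ^+ 7 * zh * (KF * M)) =
      zh * KF * (h i / om i * M) by field; rewrite !gt_eqF.
    rewrite -(mulrA _ _ (N i)); apply: ler_wpM2l; first by rewrite mulr_ge0// KF_ge0.
    (* The square root of h divided by om is the square root of h / tau <= lam, hence at most 1 +
       lam. *)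
    have l0 := lam_gt0 i; rewrite mulrA ler_wpM2r// ler_pdivrMr//.
    rewrite -{1}[h i]sqr_sqrtr// expr2 mulrAC ler_wpM2r ?sqrtr_ge0//.
    apply: le_of_sqr_le; first by rewrite mulr_ge0 ?addr_ge0 ?ltW.
    rewrite sqr_sqrtr// exprMn omE -ler_pdivrMr//; apply: le_trans (h_tau i) _.
    by nra.
  by rewrite le_eqVlt; apply/orP; left; apply/eqP; field; rewrite !gt_eqF.
rewrite zE ler_wpM2l ?exprn_ge0 ?(ltW o0)//.
apply: (interior_arith _ (K1_ge0 i) (K4_ge0 i) KF_ge0 m0 _ (N_ge0 i) zh0 v0) => //.
- by rewrite addr_ge0// ltW// lam_gt0.
- by rewrite vE.
Qed.

Definition K6 i : R := 4 * sigma ^+ 2 * L i / c0 ^+ 2 + b i ^+ 2 * K4 i +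
  4 * mu i ^+ 2 * (K1 i * K5 i + K5 i ^+ 2).

Lemma K6_ge0 i : 0 <= K6 i.
Proof.
have k1 := K1_ge0 i; have k4 := K4_ge0 i; have k5 := K5_ge0 i.
have s2 := sqr_ge0 sigma; have m2 := sqr_ge0 (mu i); have b2 := sqr_ge0 (b i).
apply: addr_ge0; first apply: addr_ge0.
- by apply: divr_ge0 => //; rewrite mulr_ge0// mulr_ge0.
- exact: mulr_ge0.
- by apply: mulr_ge0; [exact: mulr_ge0 | rewrite addr_ge0// mulr_ge0].
Qed.

(** The factor om^(-12) in nu^2 is exactly compensated by the face of [lap V], while the transport
    part retains a harmless om^4 <= 1. *)
Lemma layer_flux i E x : along P i E -> x ^+ 2 = be i ^+ 2 ->
  face E (flux P x i) <= K6 i * M ^+ 2 / h i.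
Proof.
move=> iE xE.
have k1 := K1_ge0 i; have k4 := K4_ge0 i.
have -> : face E (flux P x i) =
    face E (fun t => (sigma + x) * V t + - nu i * lap (D i) V t).
  by apply: eq_bigr => t _; rewrite /flux rhoE; congr (_ ^+ 2); ring.
apply: le_trans (faceD _ _ _) _; rewrite !faceM sqrrN.
have f0 := face_ge0 E V.
have h1 : 2 * ((sigma + x) ^+ 2 * face E V) <= 4 * (sigma ^+ 2 * face E V) +
    4 * (be i ^+ 2 * face E V).
  by rewrite -xE; have := mulr_ge0 (sqr_ge0 (sigma - x)) f0; lra.
have h2 : sigma ^+ 2 * face E V <= sigma ^+ 2 * L i / c0 ^+ 2 * M ^+ 2 / h i.
  apply: le_trans (ler_wpM2l (sqr_ge0 sigma) (face_V_le iE)) _.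
  have l1 : 1 <= L i / h i by rewrite ler_pdivlMr// mul1r (step_le _ (hn i)).
  have -> : sigma ^+ 2 * L i / c0 ^+ 2 * M ^+ 2 / h i =
    sigma ^+ 2 * (M ^+ 2 / c0 ^+ 2) * (L i / h i) by field; rewrite !gt_eqF.
  by rewrite ler_peMr// mulr_ge0 ?sqr_ge0// divr_ge0// sqr_ge0.
have h3 : be i ^+ 2 * face E V <= b i ^+ 2 * K4 i / 4 * M ^+ 2 / h i.
  have [b0|b0] := eqVneq (b i) 0.
    by rewrite beE b0 expr0n /= !mul0r expr0n /= !mul0r.
  apply: le_trans (ler_wpM2l (sqr_ge0 _) (layer_face iE b0)) _.
  have -> : be i ^+ 2 * (K4 i * N i ^+ 2 * om i ^+ 4) =
      b i ^+ 2 * K4 i / 4 * M ^+ 2 / h i * om i ^+ 4.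
    by rewrite beE NE; field; rewrite gt_eqF.
  apply: ler_piMr.
    apply: divr_ge0 => //; apply: mulr_ge0; last exact: sqr_ge0.
    by apply: divr_ge0 => //; apply: mulr_ge0 => //; exact: sqr_ge0.
  rewrite (_ : om i ^+ 4 = tau i ^+ 2); last by rewrite -omE; ring.
  by have := tau_le i; have := tau_ge0 i; nra.
have h4 : nu i ^+ 2 * face E (lap (D i) V) <=
    2 * mu i ^+ 2 * (K1 i * K5 i + K5 i ^+ 2) * M ^+ 2 / h i.
  apply: le_trans (ler_wpM2l (sqr_ge0 _) (layer_face_lap iE)) _.
  set z := nrm _; pose zh := z / om i ^+ 7; rewrite -/zh.
  set v := Num.sqrt _; have z0 : 0 <= z := nrm_ge0 _.
  have zh0 : 0 <= zh by rewrite divr_ge0// exprn_ge0// ltW.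
  have zhN : zh <= K5 i * N i.
    by rewrite ler_pdivrMr ?exprn_gt0// mulrC layer_lap2.
  have v2 : v ^+ 2 <= K1 i * N i * (K5 i * N i).
    rewrite sqr_sqrtr; last by apply: mulr_ge0 => //; exact: mulr_ge0.
    by apply: ler_wpM2l => //; exact: mulr_ge0.
  have zE : z = om i ^+ 7 * zh by rewrite /zh; field; rewrite gt_eqF.
  have zh2 := sqr_le_sqr zh0 zhN.
  have vz : v * zh <= 2^-1 * ((K1 i * K5 i + K5 i ^+ 2) * N i ^+ 2).
    by have := sqr_ge0 (v - zh); lra.
  rewrite nu_om zE.
  have -> : (mu i / (h i * om i ^+ 6)) ^+ 2 * (4 * om i ^+ 5 * v * (om i ^+ 7 * zh)) =
    4 * mu i ^+ 2 / h i ^+ 2 * (v * zh) by field; rewrite !gt_eqF.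
  have q0 : 0 <= 4 * mu i ^+ 2 / h i ^+ 2.
    by rewrite divr_ge0 ?mulr_ge0 ?sqr_ge0.
  apply: le_trans (ler_wpM2l q0 vz) _; rewrite NE.
  by rewrite le_eqVlt; apply/orP; left; apply/eqP; field; rewrite gt_eqF.
rewrite /K6; set A := sigma ^+ 2 * L i / c0 ^+ 2 * M ^+ 2 / h i in h2.
have -> : (4 * sigma ^+ 2 * L i / c0 ^+ 2 + b i ^+ 2 * K4 i +
  4 * mu i ^+ 2 * (K1 i * K5 i + K5 i ^+ 2)) * M ^+ 2 / h i =
  4 * A + 4 * (b i ^+ 2 * K4 i / 4 * M ^+ 2 / h i) +
  2 * (2 * mu i ^+ 2 * (K1 i * K5 i + K5 i ^+ 2) * M ^+ 2 / h i).
  by rewrite /A; field; rewrite !gt_eqF.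
lra.
Qed.

Definition layer_const : R := c0^-1 + \sum_i K6 i.

Lemma layer_bound : adjoint_bound P layer_const.
Proof.
split.
  apply: le_trans degenerate_nrm _; rewrite mulrC ler_wpM2r// lerDl.
  by apply: sumr_ge0 => i _; exact: K6_ge0.
move=> i E x iE xE; apply: le_trans (layer_flux iE xE) _.
rewrite ler_pM2r ?invr_gt0// ler_wpM2r ?sqr_ge0// /layer_const (bigD1 i)//=.
rewrite addrCA lerDl; apply: addr_ge0; first by rewrite invr_ge0.
by apply: sumr_ge0 => j _; exact: K6_ge0.
Qed.

End Degenerate.

(** * Solvability of the adjoint scheme *)

Lemma injective_surjective (K : fieldType) (W : vectType K) (f : W -> W) :
  linear f -> (forall v, f v = 0 -> v = 0) -> forall w, exists v, f v = w.
Proof.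
move=> f_lin f_inj w.
pose g : {linear W -> W} := HB.pack f (GRing.isLinear.Build K W W _ f f_lin).
have gE v : linfun g v = f v by rewrite lfunE.
have ker0 : lker (linfun g) == 0%VS.
  apply/eqP/vspaceP => v; rewrite memv_ker memv0 gE.
  by apply/eqP/eqP => [/f_inj //|->]; rewrite -gE linear0.
exists ((linfun g)^-1%VF w); rewrite -gE.
by rewrite (lker0_lfunVK ker0).
Qed.

Section AdjointSolve.
Context {R : rcfType} {d : nat} {T : finType}.
Variables (D : 'I_d -> direction T) (h rho nu be : 'I_d -> R) (c : T -> R).
Hypothesis D_indep : forall i j, i != j -> indep (D i) (D j).

Definition interior t := [forall i, ~~ wall (D i) t].

Definition adjoint_op (V : T -> R) t : R :=
  \sum_i (- rho i * lap (D i) V t + nu i * lap (D i) (lap (D i) V) t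
          - be i * cen (D i) V t) + c t * V t.

(** The identity at the remaining nodes makes the system square, and with a right-hand side that is
    zero there it forces V to vanish on the walls. *)
Definition closed_op (V : T -> R) t : R := if interior t then adjoint_op V t else V t.

Lemma adjoint_op_lin (x : R) V W t : adjoint_op (fun s => x * V s + W s) t =
  x * adjoint_op V t + adjoint_op W t.
Proof.
rewrite /adjoint_op [x * (_ + _)]mulrDr addrACA; congr (_ + _); last by ring.
rewrite big_distrr -big_split; apply: eq_bigr => i _ /=.
have lapD f g r : lap (D i) (fun s => x * f s + g s) r = x * lap (D i) f r + lap (D i) g r.
  by rewrite /lap; case: ifP => _; ring.
rewrite (eq_lap (D i) (lapD V W)) !lapD /cen.
ring.
Qed.

Lemma eq_adjoint_op V W : V =1 W -> adjoint_op V =1 adjoint_op W.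
Proof.
move=> VW t; rewrite /adjoint_op VW; congr (_ + _); apply: eq_bigr => i _.
by rewrite (eq_lap _ VW) (eq_lap _ (eq_lap (D i) VW)) (eq_cen _ VW).
Qed.

Lemma closed_op_vanish V u i : closed_op V =1 u ->
  (forall t, ~~ interior t -> u t = 0) -> vanish (D i) V.
Proof.
move=> Vu u0 t wt; have it : ~~ interior t.
  by apply/forallPn; exists i; rewrite negbK.
by have := Vu t; rewrite /closed_op (negbTE it) u0.
Qed.

Lemma closed_op_eq V u t : closed_op V =1 u -> (forall i, ~~ wall (D i) t) ->
  adjoint_op V t = u t.
Proof. by move=> Vu /forallP it; rewrite -Vu /closed_op /interior it. Qed.

Definition solved V u (Vu : closed_op V =1 u)
    (u0 : forall t, ~~ interior t -> u t = 0) : adjoint R d :=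
  Adjoint h D_indep (fun i => closed_op_vanish (i := i) Vu u0)
    (fun t => closed_op_eq (t := t) Vu).

(* Uniqueness, hence solvability in finite dimension, comes from the a priori
   bound itself. *)
Lemma adjoint_solve (C : R) u :
  (forall V v (Vv : closed_op V =1 v) (v0 : forall t, ~~ interior t -> v t = 0),
     adjoint_bound (solved Vv v0) C) ->
  exists V : T -> R, closed_op V =1 u.
Proof.
move=> bound.
pose F (v : {ffun T -> R^o}) : {ffun T -> R^o} := [ffun t => closed_op v t].
have F_lin : linear F.
  move=> x v w; apply/ffunP => t; rewrite !ffunE /closed_op.
  case: ifP => _; last by rewrite !ffunE.
  rewrite (@eq_adjoint_op _ (fun s => x * v s + w s)); first exact: adjoint_op_lin.
  by move=> s; rewrite !ffunE.
have F_inj v : F v = 0 -> v = 0.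
  move=> Fv; have V0 : closed_op v =1 (fun=> 0).
    by move=> t; have := congr1 (fun k : {ffun T -> R^o} => k t) Fv; rewrite !ffunE.
  have [+ _] := bound _ _ V0 (fun _ _ => erefl).
  rewrite /= [X in _ <= C * X](_ : _ = 0); last first.
    by rewrite /nrm /dot big1 ?sqrtr0// => t _; rewrite mul0r.
  rewrite mulr0 => n0; apply/ffunP => t; rewrite ffunE.
  have : nrm v ^+ 2 = 0.
    have -> : nrm v = 0 by apply/eqP; rewrite eq_le n0 nrm_ge0.
    by rewrite expr0n.
  rewrite nrm_sqE => /eqP; rewrite psumr_eq0 => [/allP/(_ t)|s _]; last exact: sqr_ge0.
  by rewrite mem_index_enum sqrf_eq0 => /(_ isT)/eqP.
have [v Fv] := injective_surjective F_lin F_inj [ffun t => u t].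
exists v => t; have := congr1 (fun k : {ffun T -> R^o} => k t) Fv.
by rewrite !ffunE.
Qed.

End AdjointSolve.

(** * Counting wall nodes and pairing data with fluxes *)

Section Walls.
Context {R : rcfType} {T : finType}.
Variable D : direction T.

Definition wall_count : R := \sum_(t | wall D t) 1.

(** Around the cycle the coordinate rises by 1 at each step and loses an additional len on entering
    the wall; the total change is zero. *)
Lemma wall_countE : (len D)%:R * wall_count = #|T|%:R.
Proof.
have e : \sum_(t : T) ((1 : R) - (len D)%:R * (wall D (fwd D t))%:R) = 0.
  apply: (sum_telescope0 (D := D) (G := fun t => (pos D t)%:R)) => t.
  have [wt|wt] := boolP (wall D (fwd D t)).
    by rewrite (eqP wt) -(pos_fwd_wall wt) -natr1 /=; ring.
  by rewrite (pos_fwdS wt) -natr1 /=; ring.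
move: e; rewrite sumrB sumr_const -big_distrr /= (sum_fwd D (fun t => (wall D t)%:R)).
move=> /eqP; rewrite subr_eq0 => /eqP ->; congr (_ * _).
by rewrite /wall_count big_mkcond; apply: eq_bigr => t _; case: (wall D t).
Qed.

(** The bound on g is asked only where q is nonzero: g will be boundary data seen from interior
    nodes, and q a flux that vanishes on all walls. *)
Lemma sum_face_le (G K : R) (g q : T -> R) : 0 <= G -> 0 <= K ->
  (forall t, q t != 0 -> `|g t| <= G) -> face D q <= K ^+ 2 ->
  \sum_t (wall D (bwd D t))%:R * (g t * q t) <= G * (Num.sqrt wall_count * K).
Proof.
move=> G0 K0 gG qK.
have -> : \sum_t (wall D (bwd D t))%:R * (g t * q t) =
    dot (fun t => (wall D t)%:R) (fun t => (wall D t)%:R * (g (fwd D t) * q (fwd D t))).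
  rewrite -(sum_fwd D); apply: eq_bigr => t _; rewrite fwdK.
  by case: (wall D t); rewrite ?mul1r ?mul0r.
apply: le_trans (dot_le _ _) _.
rewrite mulrCA; apply: ler_pM; rewrite ?nrm_ge0//.
  rewrite /nrm (_ : dot _ _ = wall_count)// /dot /wall_count [RHS]big_mkcond.
  by apply: eq_bigr => t _; case: (wall D t); rewrite ?mulr1 ?mulr0.
apply: nrm_le; first exact: mulr_ge0.
apply: (@le_trans _ _ (G ^+ 2 * face D q)); last first.
  by rewrite exprMn ler_wpM2l ?sqr_ge0.
rewrite /face [X in _ * X]big_mkcond big_distrr; apply: ler_sum => t _ /=.
case: (wall D t); rewrite ?mul1r ?mul0r ?expr0n ?mulr0//.
rewrite exprMn; have [->|/gG h] := eqVneq (q (fwd D t)) 0.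
  by rewrite expr0n !mulr0.
rewrite ler_wpM2r ?sqr_ge0// -(real_normK (num_real (g _))).
exact: sqr_le_sqr.
Qed.

End Walls.

Lemma wall_count_rev (R : rcfType) (T : finType) (D : direction T) :
  wall_count (rev D) = wall_count D :> R.
Proof. by apply: eq_bigl => t; rewrite wall_rev. Qed.

(** * Green's formula and the bound on the primal solution *)

Section Primal.
Context {R : rcfType} {d : nat}.
Variable P : adjoint R d.
Local Notation T := (adom P).
Local Notation D := (@adir _ _ P).
Local Notation V := (@aV _ _ P).
Local Notation u := (@au _ _ P).
Local Notation h := (@ah _ _ P).
Local Notation rho := (@arho _ _ P).
Local Notation nu := (@anu _ _ P).
Local Notation be := (@abe _ _ P).
Local Notation c := (@ac _ _ P).
Local Notation M := (nrm (@au _ _ P)).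
Variables (W gl gr : 'I_d -> T -> R) (f : T -> R) (G F C : R) (L : 'I_d -> R).
Hypotheses (u_vanish : vanish_all u) (W_vanish : forall i, vanish_all (W i)).

Definition inside t := [forall i, ~~ wall (D i) t].

Hypotheses
  (WE : forall i t, inside t -> W i t = lap (D i) u t +
     (wall (D i) (bwd (D i) t))%:R * gl i t + (wall (D i) (fwd (D i) t))%:R * gr i t)
  (schemeE : forall t, inside t ->
     \sum_i (- rho i * W i t + nu i * lap (D i) (W i) t + be i * (cen (D i) u t +
       (wall (D i) (fwd (D i) t))%:R * gr i t - (wall (D i) (bwd (D i) t))%:R * gl i t))
     + c t * u t = f t)
  (C_ge0 : 0 <= C) (G_ge0 : 0 <= G) (F_ge0 : 0 <= F)
  (gl_le : forall i t, inside t -> `|gl i t| <= G)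
  (gr_le : forall i t, inside t -> `|gr i t| <= G)
  (f_le : forall t, inside t -> `|f t| <= F)
  (h_gt0 : forall i, 0 < h i)
  (hn : forall i, h i * (len (D i))%:R = L i)
  (bound : adjoint_bound P C).

Lemma dot_inside (k g1 g2 : T -> R) : vanish_all k ->
  (forall t, inside t -> g1 t = g2 t) -> dot k g1 = dot k g2.
Proof.
move=> vk g12; apply: eq_bigr => t _.
have [/g12 ->//|/forallPn[i]] := boolP (inside t).
by rewrite negbK => wt; rewrite (vk i t wt) !mul0r.
Qed.

Lemma flux_vanish x i : vanish_all (flux P x i).
Proof.
move=> j t wt; rewrite /flux (@aV_vanish _ _ P j t wt).
by rewrite (vanish_all_lap i (@aV_vanish _ _ P) wt); ring.
Qed.

(** Since u is zero on the walls, its differences miss the boundary values [gl] and [gr], which [W]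
    restores. After all operators are moved onto V only these values remain, and along each axis
    they collect into a flux, with opposite signs of [be i] at the two faces. *)
Lemma green : M ^+ 2 = dot V f + \sum_i
  (\sum_t (wall (D i) (bwd (D i) t))%:R * (gl i t * flux P (be i) i t) +
   \sum_t (wall (D i) (fwd (D i) t))%:R * (gr i t * flux P (- be i) i t)).
Proof.
have vV : vanish_all V := @aV_vanish _ _ P.
rewrite nrm_sq -(adjoint_weak u_vanish).
rewrite -(dot_inside vV schemeE) dotDr dot_sumr addrAC -big_split /=.
congr (_ + _); last by apply: eq_bigr => t _; ring.
apply: eq_bigr => i _.
set b1 := fun t => (wall (D i) (bwd (D i) t))%:R * gl i t.
set b2 := fun t => (wall (D i) (fwd (D i) t))%:R * gr i t.
have WdE k : vanish_all k -> dot k (W i) = dot k (lap (D i) u) + dot k b1 + dot k b2.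
  by move=> vk; rewrite -!dotDr; apply: dot_inside => // t it; rewrite WE.
have eV : dot V (fun t => - rho i * W i t + nu i * lap (D i) (W i) t +
      be i * (cen (D i) u t + (wall (D i) (fwd (D i) t))%:R * gr i t -
      (wall (D i) (bwd (D i) t))%:R * gl i t)) =
    - rho i * dot V (W i) + nu i * dot V (lap (D i) (W i)) +
    be i * (dot V (cen (D i) u) + dot V b2 - dot V b1).
  rewrite /dot !big_distrr -!big_split -sumrB big_distrr -big_split /=.
  by apply: eq_bigr => t _; rewrite /b1 /b2; ring.
have eg : \sum_t (wall (D i) (bwd (D i) t))%:R * (gl i t * flux P (be i) i t) =
    rho i * dot V b1 - nu i * dot (lap (D i) V) b1 + be i * dot V b1.
  rewrite /dot !big_distrr -sumrB -big_split /=.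
  by apply: eq_bigr => t _; rewrite /b1 /flux; ring.
have er : \sum_t (wall (D i) (fwd (D i) t))%:R * (gr i t * flux P (- be i) i t) =
    rho i * dot V b2 - nu i * dot (lap (D i) V) b2 - be i * dot V b2.
  rewrite /dot !big_distrr -!sumrB /=.
  by apply: eq_bigr => t _; rewrite /b2 /flux; ring.
have vX := vanish_all_lap i vV.
rewrite eV eg er (dot_lapC (vV i) (@W_vanish i i)) !WdE//.
have sym k : vanish_all k -> dot k (lap (D i) u) = dot u (lap (D i) k).
  by move=> vk; rewrite (dot_lapC (vk i) (@u_vanish i)) dotC.
have ec : dot V (cen (D i) u) = - dot u (cen (D i) V) by rewrite dot_cen dotC.
by rewrite !sym// ec; ring.
Qed.

Lemma primal_bound : M <= Num.sqrt #|T|%:R *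
  (F * C + \sum_i 2 * (G * Num.sqrt (C / L i))).
Proof.
have M0 : 0 <= M := nrm_ge0 _; have [Vb fb] := bound.
have face_b i E x : along P i E -> x ^+ 2 = be i ^+ 2 ->
    face E (flux P x i) <= (Num.sqrt (C / h i) * M) ^+ 2.
  move=> iE xE; rewrite exprMn sqr_sqrtr; last by rewrite divr_ge0// ltW.
  by rewrite mulrAC; exact: fb.
(* As h len = L, the number of wall nodes divided by h equals #T / L. *)
have cnt i : Num.sqrt (wall_count (D i)) * (Num.sqrt (C / h i) * M) =
    Num.sqrt #|T|%:R * Num.sqrt (C / L i) * M.
  have h0 := h_gt0 i; have n0 : 0 < (len (D i))%:R :> R by exact: len_gt0.
  rewrite mulrA -sqrtrM; last by apply: sumr_ge0.
  rewrite -sqrtrM ?ler0n// -(wall_countE (D i)) -hn.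
  by congr (Num.sqrt _ * _); field; rewrite !gt_eqF.
have q_in x i t : flux P x i t != 0 -> inside t.
  apply: contraNT => /forallPn[j]; rewrite negbK => wt.
  by rewrite (@flux_vanish x i j t wt).
have K0 i : 0 <= Num.sqrt (C / h i) * M by rewrite mulr_ge0// sqrtr_ge0.
have M2 : M ^+ 2 <= Num.sqrt #|T|%:R *
    (F * C + \sum_i 2 * (G * Num.sqrt (C / L i))) * M.
  rewrite green mulrDr mulrDl; apply: lerD.
    have -> : dot V f = dot V (fun t => (inside t)%:R * f t).
      apply: dot_inside; first exact: (@aV_vanish _ _ P).
      by move=> t ->; rewrite mul1r.
    apply: le_trans (dot_le _ _) _.
    have fn : nrm (fun t => (inside t)%:R * f t) <= Num.sqrt #|T|%:R * F.
      apply: nrm_le; first by rewrite mulr_ge0// sqrtr_ge0.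
      rewrite exprMn sqr_sqrtr// mulr_natl -sumr_const; apply: ler_sum => t _.
      case: (boolP (inside t)) => it; last by rewrite mul0r expr0n sqr_ge0.
      by rewrite mul1r -(real_normK (num_real (f t))); exact/sqr_le_sqr/f_le.
    apply: le_trans (ler_pM _ _ Vb fn) _; rewrite ?nrm_ge0//.
    by rewrite le_eqVlt; apply/orP; left; apply/eqP; ring.
  rewrite -mulrA big_distrl big_distrr; apply: ler_sum => i _ /=.
  have g1 := sum_face_le (D := D i) G_ge0 (K0 i) (fun t h => gl_le i (q_in _ _ _ h))
    (face_b i (D i) (be i) (or_introl erefl) erefl).
  have g2 := sum_face_le (D := rev (D i)) G_ge0 (K0 i) (fun t h => gr_le i (q_in _ _ _ h))
    (face_b i (rev (D i)) (- be i) (or_intror erefl) (sqrrN _)).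
  rewrite wall_count_rev in g2; rewrite cnt in g1 g2.
  have e2 : \sum_t (wall (rev (D i)) (bwd (rev (D i)) t))%:R *
      (gr i t * flux P (- be i) i t) =
      \sum_t (wall (D i) (fwd (D i) t))%:R * (gr i t * flux P (- be i) i t).
    by apply: eq_bigr => t _; rewrite wall_rev.
  rewrite e2 in g2; apply: le_trans (lerD g1 g2) _.
  by rewrite le_eqVlt; apply/orP; left; apply/eqP; ring.
move: M0; rewrite le_eqVlt => /predU1P[<-|M0]; last first.
  by rewrite -(ler_pM2r M0) -expr2.
rewrite mulr_ge0 ?sqrtr_ge0// addr_ge0 ?mulr_ge0// sumr_ge0// => i _.
by rewrite mulr_ge0// mulr_ge0// sqrtr_ge0.
Qed.

End Primal.

Lemma adjoint_bound_mono (R : rcfType) (d : nat) (P : adjoint R d) (C C' : R) :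
  (forall i, 0 < ah P i) -> C <= C' -> adjoint_bound P C -> adjoint_bound P C'.
Proof.
move=> h0 CC [Vb fb]; have M0 : 0 <= nrm (@au _ _ P) := nrm_ge0 _.
split; first by apply: (le_trans Vb); rewrite ler_wpM2r.
move=> i E x iE xE; apply: le_trans (fb i E x iE xE) _.
by rewrite ler_pM2r ?invr_gt0// ler_wpM2r// sqr_ge0.
Qed.

(** * Choice of the layer parameters and a mesh-independent adjoint bound *)

Lemma uniform_adjoint_bound (R : realType) (d : nat) (L b : 'I_d -> R)
    (eps sigma gamma p c0 cm : R) : (0 < d)%N -> (forall i, 0 < L i) ->
  0 <= eps -> 0 <= sigma -> 0 <= gamma -> 0 <= p <= 1 -> 0 <= c0 -> 0 <= cm ->
  0 < eps \/ 0 < c0 ->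
  exists2 C : R, 0 <= C & forall P : adjoint R d, (forall i, 0 < ah P i) ->
    (forall i, ah P i * (len (adir P i))%:R = L i) ->
    (forall i, arho P i = eps / ah P i ^+ 2 + sigma) ->
    (forall i, anu P i = gamma * (ah P i `^ p) / (4 * ah P i ^+ 2)) ->
    (forall i, abe P i = b i / (2 * ah P i)) ->
    (forall t, c0 <= ac P t <= cm) -> adjoint_bound P C.
Proof.
move=> d0 L0 e0 s0 g0 /andP[p0 p1] c00 cm0 ec.
have nu0 (P : adjoint R d) : (forall i, 0 < ah P i) ->
    (forall i, anu P i = gamma * (ah P i `^ p) / (4 * ah P i ^+ 2)) ->
    forall i, 0 <= anu P i.
  move=> h0 nuE i; rewrite nuE; apply: divr_ge0.
    by apply: mulr_ge0 => //; exact: powR_ge0.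
  by apply: mulr_ge0 => //; exact: sqr_ge0.
have conclude C : (forall P : adjoint R d, (forall i, 0 < ah P i) ->
    (forall i, ah P i * (len (adir P i))%:R = L i) ->
    (forall i, arho P i = eps / ah P i ^+ 2 + sigma) ->
    (forall i, anu P i = gamma * (ah P i `^ p) / (4 * ah P i ^+ 2)) ->
    (forall i, abe P i = b i / (2 * ah P i)) ->
    (forall t, c0 <= ac P t <= cm) -> adjoint_bound P C) ->
  exists2 C' : R, 0 <= C' & forall P : adjoint R d, (forall i, 0 < ah P i) ->
    (forall i, ah P i * (len (adir P i))%:R = L i) ->
    (forall i, arho P i = eps / ah P i ^+ 2 + sigma) ->
    (forall i, anu P i = gamma * (ah P i `^ p) / (4 * ah P i ^+ 2)) ->
    (forall i, abe P i = b i / (2 * ah P i)) ->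
    (forall t, c0 <= ac P t <= cm) -> adjoint_bound P C'.
  move=> H; exists `|C| => // P h1 h2 h3 h4 h5 h6.
  by apply: (adjoint_bound_mono h1 (ler_norm C)); exact: H.
have [eps_gt0|eps0] := ltP 0 eps.
  apply: (conclude (parabolic_const L b eps cm)) => P h1 h2 h3 h4 h5 h6.
  apply: (parabolic_bound (sigma := sigma)) => //; first exact: nu0.
  by move=> t; have /andP[c1 ->] := h6 t; rewrite (le_trans c00 c1).
have {}eps0 : eps = 0 by apply/eqP; rewrite eq_le eps0.
have c0_gt0 : 0 < c0 by case: ec; rewrite ?eps0 ?ltxx.
have rhoE (P : adjoint R d) : (forall i, arho P i = eps / ah P i ^+ 2 + sigma) ->
    forall i, arho P i = sigma.
  by move=> H i; rewrite H eps0 mul0r add0r.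
move: g0; rewrite le_eqVlt => /predU1P[g0|gamma_gt0].
  apply: (conclude (hop_const L b sigma c0 cm)) => P h1 h2 h3 h4 h5 h6.
  have nuz i : anu P i = 0 by rewrite h4 -g0 !mul0r.
  apply: hop_bound => //; [exact: rhoE | by move=> i; rewrite nuz].
(* Solving nu h tau^3 = mu with nu h = gamma h^(p - 1) / 4 makes tau a multiple of (h / L)^((1 - p)
   / 3). The multiple 1/2 ensures tau <= 1/2 because p <= 1, and 32 is 4 times 2^3. *)
pose mu i := gamma * (L i `^ p) / (32 * L i).
apply: (conclude (layer_const L b sigma c0 cm mu (fun i => 2 * L i))) => P h1 h2 h3 h4 h5 h6.
pose y i := ah P i / L i.
have y_gt0 i : 0 < y i by rewrite divr_gt0.
have y_le1 i : y i <= 1.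
  rewrite ler_pdivrMr// mul1r -h2 -[leLHS]mulr1 ler_pM2l// ler1n ltnW//.
  exact: len_gt1.
have q0 : 0 <= (1 - p) / 3 by rewrite divr_ge0// subr_ge0.
pose tau i := 2^-1 * (y i `^ ((1 - p) / 3)).
have tau_gt0 i : 0 < tau i by rewrite mulr_gt0// powR_gt0.
apply: (@layer_bound _ _ L b sigma c0 cm L0 s0 c0_gt0 cm0 P h1 h2 (rhoE P h3)
  (nu0 P h1 h4) h5 h6 mu (fun i => 2 * L i) tau) => //.
- by move=> i; rewrite divr_gt0// mulr_gt0// powR_gt0.
- move=> i; rewrite /tau ler_piMr//.
  have : y i `^ ((1 - p) / 3) <= 1 `^ ((1 - p) / 3).
    by apply: ge0_ler_powR; rewrite ?nnegrE// ltW.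
  by rewrite powR1.
- move=> i; rewrite ler_pdivrMr// /tau.
  (* The exponent is at most 1 because p >= 0, so the power dominates h / L itself and the layer
     width h / tau is at most 2 L. *)
  have h : y i <= y i `^ ((1 - p) / 3).
    apply: ger1_powR; first by rewrite (y_gt0 i) y_le1.
    by rewrite ler_pdivrMr// mul1r; lra.
  have -> : 2 * L i * (2^-1 * (y i `^ ((1 - p) / 3))) = L i * (y i `^ ((1 - p) / 3)).
    by field.
  apply: le_trans (ler_wpM2l (ltW (L0 i)) h).
  by rewrite /y mulrCA mulfV ?mulr1// gt_eqF.
- move=> i; have h0 := h1 i; have l0 := L0 i.
  have t3 : tau i ^+ 3 = 8^-1 * (y i `^ (1 - p)).
    have -> : y i `^ (1 - p) = (y i `^ ((1 - p) / 3)) ^+ 3.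
      by rewrite -powR_mulrn ?powR_ge0// -powRrM; congr (_ `^ _); field.
    by rewrite /tau; field.
  have hp : ah P i `^ p = (y i `^ p) * (L i `^ p).
    by rewrite -powRM ?(ltW l0) ?(ltW (y_gt0 i))// /y divfK// gt_eqF.
  have yy : (y i `^ p) * (y i `^ (1 - p)) = y i.
    rewrite -powRD; last by rewrite (gt_eqF (y_gt0 i)) implybT.
    by rewrite addrC subrK powRr1// ltW.
  rewrite h4 t3 hp /mu.
  have -> : gamma * (y i `^ p * L i `^ p) / (4 * ah P i ^+ 2) *
     (ah P i * (8^-1 * y i `^ (1 - p))) = gamma * L i `^ p / (32 * ah P i) *
     (y i `^ p * y i `^ (1 - p)) by field; rewrite gt_eqF.
  by rewrite yy /y; field; rewrite !gt_eqF.
Qed.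

(** * Closure and boundary of the box, and boundedness of the data *)

Section Box.
Context {R : realType} {d : nat}.
Variables (a b : 'rV[R]_d).
Hypothesis ab : forall i, a 0 i < b 0 i.
Implicit Types x : 'rV[R]_d.

Lemma closure_open_box x : closure (open_box a b) x <->
  forall i, a 0 i <= x 0 i <= b 0 i.
Proof.
split => [cx i|xab].
  have near_pt e : 0 < e -> exists2 y, open_box a b y & forall i, `|x 0 i - y 0 i| < e.
    move=> e0; have [|y [yab [_ yx]]] := cx (ball x e); first exact: nbhsx_ballx.
    by exists y => // j; exact: yx.
  by apply/andP; split; apply/ler_addgt0Pr => e e0;
    have [y /(_ i)/andP[y1 y2] /(_ i)] := near_pt _ e0; rewrite ltr_norml => /andP[]; lra.
move=> B /nbhs_ballP[e e0 eB].
pose K := \sum_i (b 0 i - a 0 i); have K0 : 0 <= K.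
  by apply: sumr_ge0 => i _; rewrite subr_ge0 ltW.
have eK : 0 < e + K by rewrite ltr_pwDl.
(* The point is moved towards the centre by the fraction s. As K bounds every side and s K < e, it
   stays within distance e. *)
pose s := e / (e + K).
have s0 : 0 < s by rewrite divr_gt0.
have s1 : s <= 1 by rewrite ler_pdivrMr// mul1r lerDl.
have sK : s * (e + K) = e by rewrite divfK// gt_eqF.
pose y := \row_i ((1 - s) * x 0 i + s * ((a 0 i + b 0 i) / 2)).
exists y; split.
  move=> i; rewrite mxE; have /andP[x1 x2] := xab i; have abi := ab i.
  have h1 : (1 - s) * a 0 i <= (1 - s) * x 0 i by rewrite ler_wpM2l// subr_ge0.
  have h2 : (1 - s) * x 0 i <= (1 - s) * b 0 i by rewrite ler_wpM2l// subr_ge0.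
  have h3 := mulr_gt0 s0 (_ : 0 < b 0 i - a 0 i).
  rewrite subr_gt0 in h3; have {}h3 := h3 abi.
  by apply/andP; split; lra.
apply: eB; split => // i0 i; rewrite (ord1 i0) /ball /= mxE.
have /andP[x1 x2] := xab i; have abi := ab i.
have ki : b 0 i - a 0 i <= K.
  rewrite /K (bigD1 i)//= lerDl sumr_ge0// => j _.
  by rewrite subr_ge0 ltW.
have -> : x 0 i - ((1 - s) * x 0 i + s * ((a 0 i + b 0 i) / 2)) =
    s * (x 0 i - (a 0 i + b 0 i) / 2) by field.
rewrite normrM gtr0_norm//.
apply: (@le_lt_trans _ _ (s * K)).
  by rewrite ler_wpM2l ?(ltW s0)// ler_norml; apply/andP; split; lra.
have se := mulr_gt0 s0 e0; move: sK; rewrite mulrDr; lra.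
Qed.

Lemma boundary_open_box x i : (forall j, a 0 j <= x 0 j <= b 0 j) ->
  x 0 i = a 0 i \/ x 0 i = b 0 i -> boundary (open_box a b) x.
Proof.
move=> xab xi; split; first exact/closure_open_box.
move=> /interior_subset/(_ i); case: xi => ->; by rewrite ltxx ?andbF.
Qed.

Lemma bounded_on_boundary (g : 'rV[R]_d -> R) :
  {within boundary (open_box a b), continuous g} ->
  exists2 G : R, 0 <= G & forall x, boundary (open_box a b) x -> `|g x| <= G.
Proof.
move=> gc; have cB : compact (boundary (open_box a b)).
  apply: (@subclosed_compact _ _ [set x : 'rV[R]_d | forall i, `[a 0 i, b 0 i]%classic (x ord0 i)]).
  - rewrite /boundary setDE; apply: closedI; first exact: closed_closure.
    by apply: open_closedC; exact: open_interior.
  - by apply: (@rV_compact R d (fun i => `[a 0 i, b 0 i]%classic)) => i; exact: segment_compact.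
  - by move=> x [/closure_open_box xab _] i; rewrite /= in_itv; exact: xab.
have [M [_ HM]] := compact_bounded (continuous_compact gc cB).
exists (`|M| + 1); first by rewrite addr_ge0.
move=> x xB; apply: (HM (`|M| + 1)); last by exists x.
by rewrite (le_lt_trans (ler_norm M))// ltrDl.
Qed.

End Box.

Lemma bounded_on (R : realType) (T : Type) (A : set T) (f : T -> R) :
  [bounded f x | x in A] -> exists2 F : R, 0 <= F & forall x, A x -> `|f x| <= F.
Proof.
move=> [M [_ HM]]; exists (`|M| + 1); first by rewrite addr_ge0.
move=> x xA; apply: (HM (`|M| + 1)) => //.
by rewrite (le_lt_trans (ler_norm M))// ltrDl.
Qed.

(* The interval index runs over Z/(J-1): it is the 1-based index of the paper
   minus one, with the two opposite faces identified. *)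
Section Torus.
Context {d : nat}.
Variable J : 'I_d -> nat.
Hypothesis J_ge3 : forall i, (3 <= J i)%N.

Definition torus := {dffun forall i : 'I_d, 'I_((J i).-1)}.

Definition torus_fwd i (t : torus) : torus :=
  [ffun j : 'I_d => if j == i then ordS (t j) else t j].
Definition torus_bwd i (t : torus) : torus :=
  [ffun j : 'I_d => if j == i then ord_pred (t j) else t j].

Lemma torus_fwdK i : cancel (torus_fwd i) (torus_bwd i).
Proof.
by move=> t; apply/ffunP => j; rewrite ffunE; case: ifP => ji; rewrite ffunE ji ?ordSK.
Qed.

Lemma torus_bwdK i : cancel (torus_bwd i) (torus_fwd i).
Proof.
by move=> t; apply/ffunP => j; rewrite ffunE; case: ifP => ji; rewrite ffunE ji ?ord_predK.
Qed.

Lemma torus_len i : (1 < (J i).-1)%N.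
Proof. by have := J_ge3 i; case: (J i) => [|[|[|k]]]. Qed.

Lemma torus_pos_fwd i t :
  nat_of_ord (torus_fwd i t i) = ((nat_of_ord (t i)).+1 %% (J i).-1)%N.
Proof. by rewrite ffunE eqxx. Qed.

Definition torus_dir i : direction torus :=
  Direction (torus_fwdK i) (torus_bwdK i) (torus_len i)
    (fun t : torus => ltn_ord (t i)) (torus_pos_fwd i).

Lemma torus_indep i j : i != j -> indep (torus_dir i) (torus_dir j).
Proof.
move=> ij; split => t /=.
- apply/ffunP => k; rewrite !ffunE.
  by case: (eqVneq k i) => [->|ki]; rewrite ?(negbTE ij)//; case: ifP.
- by rewrite ffunE (negbTE ij).
- by rewrite ffunE eq_sym (negbTE ij).
Qed.

Lemma card_torus : #|{: torus}| = (\prod_i (J i).-1)%N.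
Proof.
rewrite card_dep_ffun foldrE big_map big_enum; apply: eq_bigr => i _.
by rewrite card_ord.
Qed.

(** Wall nodes receive index 1, that of the left face, and index J is never attained. Hence the
    shift lemmas below assume that the step does not cross the wall. *)
Definition torus_index (t : torus) : 'rV[int]_d := \row_i ((t i)%:Z + 1).

Lemma torus_index_inj : injective torus_index.
Proof.
move=> t r /rowP tr; apply/ffunP => i; apply: val_inj.
by have := tr i; rewrite !mxE => /addIr[].
Qed.

Lemma torus_index_fwd i t : ~~ wall (torus_dir i) (fwd (torus_dir i) t) ->
  torus_index (fwd (torus_dir i) t) = torus_index t + unit_index i.
Proof.
move=> wt; have p := pos_fwdS wt; apply/rowP => j; rewrite !mxE /=.
have [->|ji] := eqVneq j i; last by rewrite ffunE (negbTE ji) addr0.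
by rewrite [nat_of_ord _]p /= -addn1 PoszD addrAC.
Qed.

Lemma torus_index_bwd i t : ~~ wall (torus_dir i) t ->
  torus_index (bwd (torus_dir i) t) = torus_index t - unit_index i.
Proof.
move=> wt; have := @torus_index_fwd i (bwd (torus_dir i) t).
by rewrite bwdK => /(_ wt) ->; rewrite addrK.
Qed.

End Torus.

(** * Mesh nodes as torus points *)

Section Scheme.
Context {R : realType} {d : nat}.
Variables (a b : 'rV[R]_d) (J : 'I_d -> nat).
Hypotheses (ab : forall i, a 0 i < b 0 i) (J_ge3 : forall i, (3 <= J i)%N).
Local Notation D := (torus_dir J_ge3).
Local Notation h := (mesh_size a b J).
Implicit Types (t : torus J).

Lemma mesh_size_len i : h i * (len (D i))%:R = b 0 i - a 0 i.
Proof.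
have J0 : (0 < J i)%N by apply: leq_trans (J_ge3 i).
have e : (J i)%:R - 1 = (J i).-1%:R :> R by rewrite -[in LHS](prednK J0) -natr1 addrK.
rewrite /mesh_size e mulfVK// pnatr_eq0 -lt0n.
exact: ltn_trans (torus_len J_ge3 i).
Qed.

Lemma mesh_size_gt0 i : 0 < h i.
Proof.
have n0 : 0 < (len (D i))%:R :> R by exact: len_gt0.
by rewrite -(pmulr_lgt0 _ n0) mesh_size_len subr_gt0.
Qed.

Lemma torus_pos_gt0 t i : interior D t -> (0 < t i)%N.
Proof. by move=> /forallP/(_ i); rewrite /wall /= -lt0n. Qed.

Lemma node_index t i : node a b J (torus_index t) 0 i = a 0 i + (t i)%:R * h i.
Proof. by rewrite !mxE addrK. Qed.

Lemma len_predn i : (len (D i)).+1 = J i.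
Proof. by rewrite /= prednK//; apply: leq_trans (J_ge3 i). Qed.

Lemma interior_index t : interior D t -> interior_nodes a b J (torus_index t).
Proof.
move=> it; split=> i.
  rewrite mxE; have := ltn_ord (t i); rewrite -(ltn_add2r 1) !addn1.
  rewrite (prednK (leq_trans _ (J_ge3 i)))// => tJ.
  by apply/andP; split; [rewrite lerDr | rewrite -PoszD lez_nat addn1 ltnW].
rewrite node_index; have h0 := mesh_size_gt0 i; have t0 := torus_pos_gt0 i it.
rewrite ltrDl mulr_gt0 ?ltr0n//= -ltrBrDl -mesh_size_len mulrC ltr_pM2l//.
by rewrite ltr_nat.
Qed.

Lemma interior_index_surj alpha : interior_nodes a b J alpha ->
  exists2 t, interior D t & torus_index t = alpha.
Proof.
move=> [galpha oalpha].
have h1 i : (1 < alpha 0 i)%R.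
  have /andP[+ _] := oalpha i; rewrite mxE ltrDl pmulr_lgt0 ?mesh_size_gt0//.
  by rewrite ltr0z subr_gt0.
have h2 i : alpha 0 i - 1 < (len (D i))%:Z.
  have /andP[_ +] := oalpha i; rewrite mxE -ltrBrDl -mesh_size_len mulrC.
  by rewrite ltr_pM2l ?mesh_size_gt0// -[(len _)%:R]/((len _)%:Z%:~R) ltr_int.
have h3 i : (absz (alpha 0%R i - 1)%R < (J i).-1)%N.
  by rewrite -ltz_nat gez0_abs ?subr_ge0 ?(ltW (h1 i))//; exact: h2.
pose t : torus J := [ffun i => Ordinal (h3 i)].
have tE i : (t i)%:Z = alpha 0 i - 1.
  by rewrite ffunE /= gez0_abs// subr_ge0 ltW.
exists t; last by apply/rowP => i; rewrite mxE tE subrK.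
apply/forallP => i; rewrite /wall /= -lt0n -ltz_nat tE subr_gt0.
exact: h1.
Qed.

Lemma boundary_index alpha i : grid J alpha ->
  alpha 0 i = 1 \/ alpha 0 i = (J i)%:Z -> boundary_nodes a b J alpha.
Proof.
move=> galpha ai; split => //.
have xab j : a 0 j <= node a b J alpha 0 j <= b 0 j.
  have /andP[g1 g2] := galpha j; rewrite mxE.
  have h0 := mesh_size_gt0 j.
  have g3 : alpha 0 j - 1 <= (len (D j))%:Z.
    by rewrite lerBlDr -PoszD addn1 len_predn.
  rewrite lerDl mulr_ge0 ?(ltW h0) ?ler0z ?subr_ge0//=.
  rewrite -lerBrDl -mesh_size_len mulrC ler_pM2l//.
  by rewrite -[(len _)%:R]/((len _)%:Z%:~R) ler_int.
suff xi : node a b J alpha 0 i = a 0 i \/ node a b J alpha 0 i = b 0 i.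
  exact: boundary_open_box xab xi.
rewrite mxE; case: ai => ->; [left|right].
  by rewrite subrr mul0r addr0.
have -> : (J i)%:Z - 1 = (len (D i))%:Z by rewrite -len_predn -addn1 PoszD addrK.
rewrite mulrC; have := mesh_size_len i; rewrite -[(len _)%:R]/((len _)%:Z%:~R) => ->.
by rewrite addrC subrK.
Qed.

Lemma index_fwd_boundary t i : interior D t -> wall (D i) (fwd (D i) t) ->
  boundary_nodes a b J (torus_index t + unit_index i).
Proof.
move=> it wt; have p := pos_fwd_wall wt.
have [git _] := interior_index it.
have ei : (torus_index t + unit_index i) 0 i = (J i)%:Z.
  have e : (t i + 1 + 1)%N = J i by rewrite !addn1; have := len_predn i; rewrite -p.
  by rewrite !mxE !eqxx /= -[in RHS]e !PoszD.
apply: (@boundary_index _ i); last by right.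
move=> j; have [->|ji] := eqVneq j i.
  by rewrite ei lexx andbT lez_nat (leq_trans _ (J_ge3 i)).
by have := git j; rewrite !mxE (negbTE ji) addr0.
Qed.

Lemma index_bwd_boundary t i : interior D t -> wall (D i) (bwd (D i) t) ->
  boundary_nodes a b J (torus_index t - unit_index i).
Proof.
move=> it wt; have [git _] := interior_index it.
have p : nat_of_ord (t i) = 1%N.
  have wti : ~~ wall (D i) t by move/forallP: it.
  by have := @pos_fwdS _ (D i) (bwd (D i) t); rewrite bwdK (eqP wt) => /(_ wti).
have ei : (torus_index t - unit_index i) 0 i = 1.
  by rewrite !mxE !eqxx p.
apply: (@boundary_index _ i); last by left.
move=> j; have [->|ji] := eqVneq j i.
  by rewrite ei lexx lez_nat (leq_trans _ (J_ge3 i)).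
by have := git j; rewrite !mxE (negbTE ji) subr0.
Qed.

Lemma interior_fwd t i : interior D t -> ~~ wall (D i) (fwd (D i) t) ->
  interior D (fwd (D i) t).
Proof.
move=> /forallP it wt; apply/forallP => j.
have [->//|ij] := eqVneq j i.
by rewrite (wall_fwd_indep (torus_indep J_ge3 ij)).
Qed.

Lemma interior_bwd t i : interior D t -> ~~ wall (D i) (bwd (D i) t) ->
  interior D (bwd (D i) t).
Proof.
move=> /forallP it wt; apply/forallP => j.
have [->//|ij] := eqVneq j i.
by rewrite (wall_bwd_indep (torus_indep J_ge3 ij)).
Qed.

Lemma ell2_nrm (U : 'rV[int]_d -> R) :
  ell2_norm a b J U = nrm (fun t => if interior D t then U (torus_index t) else 0).
Proof.
rewrite /ell2_norm /nrm; congr Num.sqrt.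
rewrite (@reindex_fsbig _ _ _ _ _ (@torus_index d J) [set` [pred t | interior D t]]); last first.
  split.
  - by move=> t; exact: interior_index.
  - by move=> t r _ _; exact: torus_index_inj.
  - by move=> alpha /interior_index_surj[t it <-]; exists t.
rewrite -(@bigfs _ _ _ _ (index_enum (torus J)))// ?index_enum_uniq//; last first.
  by move=> t _; rewrite mem_index_enum.
rewrite /dot [RHS](bigID [pred t | interior D t]) /= [X in _ + X]big1 ?addr0; last first.
  by move=> t /negbTE ->; rewrite mul0r.
by apply: eq_bigr => t it; rewrite it real_normK ?num_real// expr2.
Qed.

End Scheme.

(** * The scheme rewritten on the torus *)

Section Link.
Context {R : realType} {d : nat}.
Variables (a b : 'rV[R]_d) (J : 'I_d -> nat).
Hypotheses (ab : forall i, a 0 i < b 0 i) (J_ge3 : forall i, (3 <= J i)%N).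
Local Notation D := (torus_dir J_ge3).
Local Notation h := (mesh_size a b J).
Local Notation idx := (@torus_index d J).
Implicit Types (t : torus J).

(** For U the extension by zero forgets the boundary data; for the second difference along axis i it
    loses nothing at the neighbours along that axis, by the ghost-point condition. *)
Definition restrict (F : 'rV[int]_d -> R) t : R := if interior D t then F (idx t) else 0.

Lemma restrict_vanish F i : vanish (D i) (restrict F).
Proof.
move=> t wt; rewrite /restrict ifN//; apply/forallPn; exists i.
by rewrite negbK.
Qed.

Lemma restrict_fwd F i t : interior D t ->
  F (idx t + unit_index i) = restrict F (fwd (D i) t) +
    (wall (D i) (fwd (D i) t))%:R * F (idx t + unit_index i).
Proof.
move=> it; have [wt|wt] := boolP (wall (D i) (fwd (D i) t)).
  by rewrite (restrict_vanish F wt) add0r mul1r.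
by rewrite /restrict (interior_fwd it wt) (torus_index_fwd wt) mul0r addr0.
Qed.

Lemma restrict_bwd F i t : interior D t ->
  F (idx t - unit_index i) = restrict F (bwd (D i) t) +
    (wall (D i) (bwd (D i) t))%:R * F (idx t - unit_index i).
Proof.
move=> it; have [wt|wt] := boolP (wall (D i) (bwd (D i) t)).
  by rewrite (restrict_vanish F wt) add0r mul1r.
have wti : ~~ wall (D i) t by move/forallP: it.
by rewrite /restrict (interior_bwd it wt) (torus_index_bwd wti) mul0r addr0.
Qed.

(** Left undivided to match [lap]; the powers of h go into the coefficients. *)
Definition diff2 (U : 'rV[int]_d -> R) i (alpha : 'rV[int]_d) : R :=
  U (alpha + unit_index i) - 2 * U alpha + U (alpha - unit_index i).

(** If W is the undivided second difference, the wide one, multiplied by 4 h^2, is W(+1) + 2 W +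
    W(-1). Subtracting 4 W leaves the second difference of W, so the moment is a fourth difference
    with coefficient gamma h^p / (4 h^2). *)
Lemma scheme_restrict beta (c f g : 'rV[R]_d -> R) eps sigma gamma p U t :
  scheme_solution a b beta c f g eps sigma gamma p J U -> interior D t ->
  \sum_i (- (eps / h i ^+ 2 + sigma) * restrict (diff2 U i) t
    + gamma * (h i `^ p) / (4 * h i ^+ 2) * lap (D i) (restrict (diff2 U i)) t
    + beta 0 i / (2 * h i) * (cen (D i) (restrict U) t +
      (wall (D i) (fwd (D i) t))%:R * U (idx t + unit_index i) -
      (wall (D i) (bwd (D i) t))%:R * U (idx t - unit_index i)))
  + c (node a b J (idx t)) * restrict U t = f (node a b J (idx t)).
Proof.
move=> [scheme _ ghost] it; have int_t := interior_index ab it.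
have ghost0 i alpha : ghosted_nodes a b J i alpha -> diff2 U i alpha = 0.
  move=> /ghost/eqP; rewrite oppr_eq0 /second_diff mulf_eq0 invr_eq0.
  by rewrite expf_eq0 /= (gt_eqF (mesh_size_gt0 ab J_ge3 i)) orbF => /eqP.
(* A neighbour behind the wall is a boundary node adjacent to an interior one, so the ghost
   condition makes its second difference zero. *)
have Wf i : restrict (diff2 U i) (fwd (D i) t) = diff2 U i (idx t + unit_index i).
  rewrite [RHS](restrict_fwd _ _ it).
  have [wt|_] := boolP (wall (D i) (fwd (D i) t)); last by rewrite mul0r addr0.
  rewrite ghost0 ?mulr0 ?addr0//; split; first exact: index_fwd_boundary.
  by right; rewrite addrK.
have Wb i : restrict (diff2 U i) (bwd (D i) t) = diff2 U i (idx t - unit_index i).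
  rewrite [RHS](restrict_bwd _ _ it).
  have [wt|_] := boolP (wall (D i) (bwd (D i) t)); last by rewrite mul0r addr0.
  rewrite ghost0 ?mulr0 ?addr0//; split; first exact: index_bwd_boundary.
  by left; rewrite subrK.
rewrite -(scheme _ int_t) /numerical_operator /discrete_laplacian /numerical_moment.
have rU : restrict U t = U (idx t) by rewrite /restrict it.
have rW i : restrict (diff2 U i) t = diff2 U i (idx t) by rewrite /restrict it.
rewrite rU [RHS]addrAC; congr (_ + _).
rewrite !big_distrr -sumrB -!big_split; apply: eq_bigr => i _ /=.
have h0 := mesh_size_gt0 ab J_ge3 i.
have -> : cen (D i) (restrict U) t +
      (wall (D i) (fwd (D i) t))%:R * U (idx t + unit_index i) -
      (wall (D i) (bwd (D i) t))%:R * U (idx t - unit_index i) =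
    U (idx t + unit_index i) - U (idx t - unit_index i).
  by rewrite [in RHS](restrict_fwd _ _ it) [in RHS](restrict_bwd _ _ it) /cen; ring.
rewrite /lap ifN; last by move/forallP: it.
rewrite Wf Wb rW /diff2 mxE /central_diff /second_diff /wide_second_diff.
have e2 : idx t + unit_index i + unit_index i = idx t + unit_index i *+ 2.
  by rewrite -addrA -mulr2n.
have e2' : idx t - unit_index i - unit_index i = idx t - unit_index i *+ 2.
  by rewrite -addrA -opprD -mulr2n.
rewrite e2 e2' (addrK (unit_index i) (idx t)) (subrK (unit_index i) (idx t)).
by field; rewrite gt_eqF.
Qed.

End Link.

Theorem theorem6p3 (R : realType) (d : nat) (d_gt0 : (0 < d)%N)
  (a b : 'rV[R]_d) (ab : forall i : 'I_d, a 0 i < b 0 i)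
  (beta : 'rV[R]_d) (c f g : 'rV[R]_d -> R) (eps sigma gamma p : R)
  (c_bounded : [bounded c x | x in open_box a b])
  (c_ge0 : forall x, open_box a b x -> 0 <= c x)
  (f_bounded : [bounded f x | x in open_box a b])
  (g_continuous : {within boundary (open_box a b), continuous g})
  (eps_ge0 : 0 <= eps) (sigma_ge0 : 0 <= sigma) (gamma_ge0 : 0 <= gamma)
  (p01 : 0 <= p <= 1)
  (eps_or_c0 : 0 < eps \/ 0 < inf [set c x | x in open_box a b]) :
  exists C : R,
    forall (J : 'I_d -> nat), (forall i, (3 <= J i)%N) ->
    forall U : 'rV[int]_d -> R,
      scheme_solution a b beta c f g eps sigma gamma p J U ->
      (\prod_i Num.sqrt (mesh_size a b J i)) * ell2_norm a b J U <= C.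
Proof.
have [Cm Cm0 c_le] := bounded_on c_bounded.
have [F F0 f_le] := bounded_on f_bounded.
have [G G0 g_le] := bounded_on_boundary ab g_continuous.
pose mid : 'rV[R]_d := \row_i ((a 0 i + b 0 i) / 2).
have mid_box : open_box a b mid.
  by move=> i; rewrite mxE; have := ab i => abi; apply/andP; split; lra.
(* For eps > 0 the lower bound 0 will do; otherwise the infimum of c is taken. *)
have [c0 [c00 c0_le eps_c0]] : exists c0, [/\ 0 <= c0,
    forall x, open_box a b x -> c0 <= c x & 0 < eps \/ 0 < c0].
  case: eps_or_c0 => [e0|i0]; first by exists 0; split => //; left.
  exists (inf [set c x | x in open_box a b]); split; [exact: ltW| |by right].
  move=> x xab; apply: ge_inf; last by exists x.
  by exists 0 => _ [y yab <-]; exact: c_ge0.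
pose L i := b 0 i - a 0 i.
have L0 i : 0 < L i by rewrite subr_gt0.
have [Ca Ca0 bound] := @uniform_adjoint_bound R d L (fun i => beta 0 i) eps sigma
  gamma p c0 Cm d_gt0 L0 eps_ge0 sigma_ge0 gamma_ge0 p01 c00 Cm0 eps_c0.
exists (Num.sqrt (\prod_i L i) * (F * Ca + \sum_i 2 * (G * Num.sqrt (Ca / L i)))).
move=> J J3 U sol; pose D := torus_dir J3; pose h := mesh_size a b J.
have h0 i : 0 < h i by exact: mesh_size_gt0.
have hn i : h i * (len (D i))%:R = L i by exact: mesh_size_len.
pose idx := @torus_index d J.
(* Wall nodes lie outside the open box; giving them the value of c at the centre keeps the bounds on
   c valid on the whole torus. *)
pose ct (t : torus J) := if interior D t then c (node a b J (idx t)) else c mid.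
have ct_bound t : c0 <= ct t <= Cm.
  have cb x : open_box a b x -> c0 <= c x <= Cm.
    move=> xab; rewrite c0_le//=; apply: le_trans (c_le x xab); exact: ler_norm.
  rewrite /ct; case: ifPn => it; last exact: cb.
  by apply: cb; have [] := interior_index ab it.
pose rho i := eps / h i ^+ 2 + sigma.
pose nu i := gamma * (h i `^ p) / (4 * h i ^+ 2).
pose be i := beta 0 i / (2 * h i).
pose u := restrict J3 U.
have u0 t : ~~ interior D t -> u t = 0 by move=> /negbTE it; rewrite /u /restrict it.
(* Stated for every right-hand side v, because solvability for u rests on the case v = 0. *)
have ab_bound V v (Vv : closed_op D rho nu be ct V =1 v)
    (v0 : forall t, ~~ interior D t -> v t = 0) :
    adjoint_bound (solved h (torus_indep J3) Vv v0) Ca.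
  exact: bound.
have [V Vu] := @adjoint_solve R d _ D h rho nu be ct (torus_indep J3) Ca u ab_bound.
(* Only the values of U behind a wall are boundary data, hence bounded by G. *)
pose gl i t := if wall (D i) (bwd (D i) t) then U (idx t - unit_index i) else 0.
pose gr i t := if wall (D i) (fwd (D i) t) then U (idx t + unit_index i) else 0.
have glE i t : (wall (D i) (bwd (D i) t))%:R * gl i t =
    (wall (D i) (bwd (D i) t))%:R * U (idx t - unit_index i).
  by rewrite /gl; case: ifP => // _; rewrite !mul0r.
have grE i t : (wall (D i) (fwd (D i) t))%:R * gr i t =
    (wall (D i) (fwd (D i) t))%:R * U (idx t + unit_index i).
  by rewrite /gr; case: ifP => // _; rewrite !mul0r.
have [_ bdry _] := sol.
have U_le alpha : boundary_nodes a b J alpha -> `|U alpha| <= G.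
  by move=> ba; rewrite bdry//; apply: g_le; case: ba.
have main : nrm u <= Num.sqrt #|{: torus J}|%:R *
    (F * Ca + \sum_i 2 * (G * Num.sqrt (Ca / L i))).
  apply: (@primal_bound _ _ (solved h (torus_indep J3) Vu u0)
    (fun i => restrict J3 (diff2 U i)) gl gr (fun t => f (node a b J (idx t))) G F Ca L).
  - by move=> i; exact: restrict_vanish.
  - by move=> i j; exact: restrict_vanish.
  - move=> i t it; have {}it : interior D t := it.
    have wti : ~~ wall (D i) t by move/forallP: it.
    rewrite [_ * gl _ _]glE [_ * gr _ _]grE /= {1}/restrict it /diff2.
    rewrite {1}(restrict_fwd (J_ge3 := J3) U _ it) {1}(restrict_bwd (J_ge3 := J3) U _ it).
    have -> : U (idx t) = u t by rewrite /u /restrict it.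
    by rewrite /lap ifN// /u /=; ring.
  - move=> t it; have {}it : interior D t := it.
    rewrite -(scheme_restrict ab sol it) /= /ct it; congr (_ + _).
    by apply: eq_bigr => i _; rewrite [_ * gl _ _]glE [_ * gr _ _]grE.
  - exact: Ca0.
  - exact: G0.
  - exact: F0.
  - move=> i t it; rewrite /gl; case: ifPn => wt; last by rewrite normr0.
    by apply: U_le; exact: index_bwd_boundary ab _ _ _ it wt.
  - move=> i t it; rewrite /gr; case: ifPn => wt; last by rewrite normr0.
    by apply: U_le; exact: index_fwd_boundary ab _ _ _ it wt.
  - by move=> t it; apply: f_le; have [] := interior_index ab it.
  - exact: h0.
  - exact: hn.
  - exact: ab_bound.
have prod_sqrt (x : 'I_d -> R) : (forall i, 0 <= x i) ->
    \prod_i Num.sqrt (x i) = Num.sqrt (\prod_i x i).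
  move=> x0; suff [] : \prod_i Num.sqrt (x i) = Num.sqrt (\prod_i x i) /\ 0 <= \prod_i x i by [].
  elim/big_ind2: _ => [|x1 x2 y1 y2 [-> x20] [-> y20]|i _]; first by rewrite sqrtr1.
    by rewrite sqrtrM ?mulr_ge0.
  by split.
rewrite (ell2_nrm ab J3) prod_sqrt => [|i]; last exact/ltW.
(* The torus has prod L_i / h_i nodes, so the weight turns sqrt #T into the square root of the
   volume of the box. *)
have -> : \prod_i L i = (\prod_i h i) * #|{: torus J}|%:R.
  rewrite card_torus natr_prod -big_split /=; apply: eq_bigr => i _.
  by rewrite -hn.
rewrite sqrtrM; last by apply: prodr_ge0 => i _; exact: ltW.
by rewrite -mulrA; apply: ler_wpM2l main; exact: sqrtr_ge0.
Qed.
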